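(* Let $T>0$, $\ell>0$, $\alpha\in(0,1)$. Let $a,f\in C^2([0,T]\times[-\ell,\ell]\times\mathbb{R}\times\mathbb{R})$ and $b(\cdot,\pm\ell,\cdot),\,g(\cdot,\pm\ell,\cdot)\in C^2([0,T]\times\mathbb{R})$ (gradient-independent) be real-valued with $a>0$ and $b(\cdot,\pm\ell,\cdot)>0$. Let $u^0\in C^{2+\alpha}([-\ell,\ell])$ satisfy the compatibility condition $$\mp b(0,x,u^0)u^0_x+g(0,x,u^0)=a(0,x,u^0,u^0_x)u^0_{xx}+f(0,x,u^0,u^0_x)\quad\text{at }x=\pm\ell,$$ and let $K$ be such that $|u^0(x)-u^0(y)|\le K|x-y|$ for $x,y\in[-\ell,\ell]$. Suppose there are a number $B>0$ and a non-decreasing positive function $\Phi$ on $[0,\infty)$ with $\int_0^\infty\frac{dr}{\Phi(r)}=\infty$ such that $$z f(t,x,z,0)\le\Phi(|z|)|z|+B,\qquad z g(t,\pm\ell,z)\le\Phi(|z|)|z|+B,\qquad (t,x,z)\in\Omega_T\times\mathbb{R}.$$ Let $\phi$ be the increasing function determined by $\int_0^{\phi(\xi)}\frac{dr}{\Phi(r)}=\ln\xi$ and set $$M:=\inf\left\{\phi(\xi)\,:\,\lambda>1,\ \xi=e^{\lambda T}\max\left\{1,\ \phi^{-1}\!\left(\frac{B}{(\lambda-1)\Phi(0)}\right),\ \phi^{-1}\big(|u^0|_{[-\ell,\ell]}\big)\right\}\right\}.$$ Suppose further that, for this $M$, there are $q_0\ge K$ and $\psi\in C^1([0,\infty),[1,\infty))$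 with $$\int_{q_0}^\infty\frac{\rho\,d\rho}{\psi(\rho)}>2M$$ such that $$|f(t,x,z,p)|\le a(t,x,z,p)\,\psi(|p|),\qquad (t,x,z,p)\in\overline{\Omega}_T\times[-M,M]\times\mathbb{R},$$ and such that for all $(t,z)\in(0,T]\times[-M,M]$ and all $p\ge q_0$ $$\pm g(t,\ell,z)\le b(t,\ell,z)p,\qquad \mp g(t,-\ell,z)\le b(t,-\ell,z)p$$ (for both choices of sign). Then there exists a global solution $u\in\mathcal{C}^{1+\frac{\alpha}{2},2+\alpha}(\Omega_T)$ to $$u_t-a(t,x,u,u_x)u_{xx}=f(t,x,u,u_x),\qquad (t,x)\in(0,T)\times(-\ell,\ell),$$ $$u_t\pm b(t,x,u)u_x=g(t,x,u),\qquad t\in(0,T),\ x=\pm\ell,$$ subject to $u(0,\cdot)=u^0$ on $[-\ell,\ell]$.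
   Context: Conventions. $\Omega=(-\ell,\ell)$, $\Omega_T=(0,T)\times(-\ell,\ell)$; $|v|_S=\sup_S|v|$. Equations at $x=\pm\ell$ with $\pm$ (or $\mp$) mean two equations: the upper sign at $x=+\ell$, the lower sign at $x=-\ell$. In the definition of $M$ only the restriction of $\phi$ to $[1,\infty)$ is used: $\phi:[1,\infty)\to[0,\infty)$ is the increasing bijection with $\int_0^{\phi(\xi)}dr/\Phi(r)=\ln\xi$, so $\phi(1)=0$ and $\phi^{-1}(s)=\exp\big(\int_0^s dr/\Phi(r)\big)$ for $s\ge0$. Hölder spaces. For an interval $I$ and $\beta\in(0,1)$: $[v]^{(\beta)}_I=\sup_{x\ne y\in I}|v(x)-v(y)|/|x-y|^\beta$; $C^{2+\alpha}([-\ell,\ell])$ consists of $C^2$ functions with $\alpha$-Hölder continuous second derivative. For $u:\Omega_T\to\mathbb{R}$ set $\langle u\rangle^{(\beta)}_{t,\Omega_T}=\sup_{x\in\Omega}[u(\cdot,x)]^{(\beta)}_{(0,T)}$, $\langle u\rangle^{(\beta)}_{x,\Omega_T}=\sup_{t\in(0,T)}[u(t,\cdot)]^{(\beta)}_{\Omega}$, and $\langle u\rangle^{(\frac{\alpha}{2},\alpha)}_{\Omega_T}=\langle u\rangle^{(\alpha/2)}_{t,\Omega_T}+\langle u\rangle^{(\alpha)}_{x,\Omega_T}$. $\mathcal{C}^{1+\frac{\alpha}{2},2+\alpha}(\Omega_T)$ is the set of $u:\Omega_T\to\mathbb{R}$ with finite norm $$|u|_{\Omega_T}+|u_x|_{\Omega_T}+|u_{xx}|_{\Omega_T}+|u_t|_{\Omega_T}+\langle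 u_t\rangle^{(\frac{\alpha}{2},\alpha)}_{\Omega_T}+\langle u_{xx}\rangle^{(\frac{\alpha}{2},\alpha)}_{\Omega_T}+\langle u_x\rangle^{(\frac{1+\alpha}{2})}_{t,\Omega_T}.$$ For such $u$ the functions $u,u_x,u_{xx},u_t$ extend continuously to $\overline{\Omega}_T$, so boundary and initial conditions make sense pointwise. *)

(* Defs.v *)
From HB Require Import structures.
From mathcomp Require Import all_boot all_order all_algebra.
From mathcomp Require Import all_classical all_reals all_analysis.

Set Implicit Arguments.
Unset Strict Implicit.
Unset Printing Implicit Defensive.

Import Order.TTheory GRing.Theory Num.Theory.
Import numFieldNormedType.Exports.

Local Open Scope classical_set_scope.
Local Open Scope ring_scope.

(* Derivative of f at x in the direction v *relative to* D: the increment h is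
   restricted to those h with x + h v in D. At interior points it is the usual
   directional derivative, at boundary points of an interval or box a one-sided
   one. *)
Definition diff_within (R : realType) (V : normedModType R) (D : set V) (v : V)
    (f : V -> R) (x : V) : set_system R :=
  h^-1 * (f (h *: v + x) - f x) @[h --> within [set h | D (h *: v + x)] 0^'].

Definition deriv_within (R : realType) (V : normedModType R) (D : set V) (v : V)
    (f : V -> R) (x : V) : R :=
  lim (diff_within D v f x).

(* f is of class C^k on D, where E is the set of coordinate directions of V.
   Meant for D a box with nonempty interior; it agrees there with
   "C^k in the interior, and all partial derivatives of order <= k extend
   continuously to D". *)
Fixpoint Ck_on (R : realType) (V : normedModType R) (E D : set V) (k : nat)
    (f : V -> R) : Prop :=
  {within D, continuous f} /\
  match k with
  | 0%N => True
  | k'.+1 => forall v, E v ->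
      (forall x, D x -> cvg (diff_within D v f x)) /\
      Ck_on E D k' (deriv_within D v f)
  end.

Definition coord_dirs (R : realType) (n : nat) : set 'rV[R]_n :=
  [set delta_mx 0 i | i in [set: 'I_n]].

Definition Ck_on1 (R : realType) (D : set R) (k : nat) (f : R -> R) : Prop :=
  @Ck_on R R^o [set 1] D k f.

Definition Ck_on2 (R : realType) (D1 D2 : set R) (k : nat) (F : R -> R -> R)
    : Prop :=
  Ck_on (@coord_dirs R 2)
    [set v : 'rV[R]_2 | D1 (v 0 0) /\ D2 (v 0 1)] k
    (fun v => F (v 0 0) (v 0 1)).

Definition Ck_on4 (R : realType) (D1 D2 D3 D4 : set R) (k : nat)
    (F : R -> R -> R -> R -> R) : Prop :=
  Ck_on (@coord_dirs R 4)
    [set v : 'rV[R]_4 |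
      [/\ D1 (v 0 0), D2 (v 0 1), D3 (v 0 2%:R) & D4 (v 0 3%:R)]] k
    (fun v => F (v 0 0) (v 0 1) (v 0 2%:R) (v 0 3%:R)).

Definition derivI (R : realType) (D : set R) (f : R -> R) (x : R) : R :=
  @deriv_within R R^o D 1 f x.

Definition sup_norm (R : realType) (X : Type) (S : set X) (v : X -> R) : \bar R :=
  ereal_sup [set `|v x|%:E | x in S].

Definition holder_semi (R : realType) (I : set R) (beta : R) (v : R -> R)
    : \bar R :=
  ereal_sup [set (`|v p.1 - v p.2| / `|p.1 - p.2| `^ beta)%:E
            | p in [set p : R * R | [/\ I p.1, I p.2 & p.1 != p.2]]].

Definition C2alpha (R : realType) (I : set R) (alpha : R) (v : R -> R) : Prop :=
  Ck_on1 I 2 v /\ (holder_semi I alpha (derivI I (derivI I v)) < +oo)%E.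

Section Parabolic.
Variables (R : realType) (T l alpha : R).

Definition OmegaT : set (R * R) := `]0, T[ `*` `](- l), l[.

Definition dt (u : R -> R -> R) : R -> R -> R := fun t x => derive1 (u^~ x) t.
Definition dx (u : R -> R -> R) : R -> R -> R := fun t x => derive1 (u t) x.

Definition holder_t (beta : R) (u : R -> R -> R) : \bar R :=
  ereal_sup [set holder_semi `]0, T[ beta (u^~ x) | x in `](- l), l[].

Definition holder_x (beta : R) (u : R -> R -> R) : \bar R :=
  ereal_sup [set holder_semi `](- l), l[ beta (u t) | t in `]0, T[].

Definition holder_par (u : R -> R -> R) : \bar R :=
  (holder_t (alpha / 2) u + holder_x alpha u)%E.

Definition norm_T (u : R -> R -> R) : \bar R :=
  sup_norm OmegaT (fun p => u p.1 p.2).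

Definition par_norm (u : R -> R -> R) : \bar R :=
  (norm_T u + norm_T (dx u) + norm_T (dx (dx u)) + norm_T (dt u)
   + holder_par (dt u) + holder_par (dx (dx u))
   + holder_t ((1 + alpha) / 2) (dx u))%E.

(* Only the values of u on the open set OmegaT matter. *)
Definition par_space (u : R -> R -> R) : Prop :=
  (forall t x, OmegaT (t, x) ->
    [/\ derivable (u^~ x) t 1, derivable (u t) x 1
      & derivable (dx u t) x 1]) /\
  (par_norm u < +oo)%E.

(* Continuous extension of w from OmegaT to its closure. *)
Definition ext (w : R -> R -> R) (t x : R) : R :=
  lim (w p.1 p.2 @[p --> within OmegaT (nbhs (t, x))]).

End Parabolic.

Section Bound.
Variables (R : realType) (Phi : R -> R).
Let mu := @lebesgue_measure R.

(* Phi is only meaningful on [0, +oo[; there it is positive and monotone, so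
   1 / Phi is measurable and bounded on [0, s]. *)
Definition int_inv (s : R) : R := Rintegral mu `[0, s] (fun r => (Phi r)^-1).

(* phi xi, for xi >= 1, is the s >= 0 with \int_0^s dr / Phi r = ln xi. *)
Definition phi (xi : R) : R := xget 0 [set s | 0 <= s /\ int_inv s = ln xi].

Definition phi_inv (s : R) : R := expR (int_inv s).

(* N stands for |u0|_[-l, l]. *)
Definition Mbound (T B N : R) : R :=
  inf [set phi (expR (lambda * T) *
             Num.max 1 (Num.max (phi_inv (B / ((lambda - 1) * Phi 0)))
                                (phi_inv N)))
      | lambda in [set lambda : R | 1 < lambda]].

End Bound.

(* Main.v *)
(* An explicit finite difference scheme with space step [h] and time step of
   order [h ^ 2] is monotone, so discrete maximum principles give bounds that do
   not depend on [h]. Supersolutions built from [Phi] bound the solution by [M].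
   Doubling the space variable, |u_i - u_j| stays below a concave modulus whose
   slopes solve the ordinary differential equation [p' = - psi(p)]; Nagumo's
   integral condition makes the modulus exceed the oscillation [2 M], and the
   boundary inequalities keep it from being crossed at the end points. This
   bounds the slopes. The same argument for the slopes, whose equation has
   quadratic growth, bounds the second differences, hence the time differences
   [v]; applied to [v] with the modulus [K s ^ alpha] it gives Hölder continuity
   in space, where the compatibility condition enters at time [0]. A parabolic
   barrier then yields the exponent [alpha / 2] in time. The limit along an
   ultrafilter on the grid parameter inherits all bounds; discrete Taylor
   estimates pass to the limit and identify the derivatives, and the mean value
   theorem gives the exponent [(1 + alpha) / 2] of [u_x] in time. *)
Require Import Defs.
From HB Require Import structures.
From mathcomp Require Import all_boot all_order all_algebra.
From mathcomp Require Import all_classical all_reals all_analysis.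
From mathcomp Require Import measurable_realfun.
From mathcomp Require Import ring lra zify.

Set Implicit Arguments.
Unset Strict Implicit.
Unset Printing Implicit Defensive.

Import Order.TTheory GRing.Theory Num.Theory.
Import numFieldNormedType.Exports.

Local Open Scope classical_set_scope.
Local Open Scope ring_scope.

(** * Discrete comparison *)

(** The data are bounded, Lipschitz and elliptic only on a box of values and slopes, while the
    scheme stays in that box only thanks to the bounds being proved. Hence values and slopes are
    bounded in one induction over the time steps, and the constants are chosen in a fixed order: [Z]
    and [P] first, then [a0], [a1], [L] on that box, then the slope range [q2], [q3] for second
    differences, then the Hölder constants; the step [h] is made small last.

    The coefficients are never differentiated. An increment of a Lipschitz function is written as
    bounded coefficients times increments of its arguments; a coefficient in front of a difference
    of the unknown becomes a drift, which the diffusion weights absorb for small [h].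

    The boundary equation is of first order in space. With [b > 0] the end rows are upwind, hence
    monotone, and a slope bound alone controls the time difference there, which supplies the end
    condition needed for second differences.

    Along an ultrafilter every bounded sequence converges, so limits exist at all points at once
    without compactness in function spaces; regularity is read off afterwards from the inherited
    inequalities. *)

Lemma positive_stencil (R : realFieldType) (tau ap am y yp ym B Bp Bm : R) :
  0 <= tau -> 0 <= ap -> 0 <= am -> 2 * tau * (ap + am) <= 1 ->
  y <= B -> yp <= Bp -> ym <= Bm ->
  2 * tau * (ap * (yp - y) + am * (ym - y)) <=
  B - y + 2 * tau * (ap * (Bp - B) + am * (Bm - B)).
Proof.
move=> t0 ap0 am0 cfl yB ypB ymB.
have h1 : 0 <= tau * (ap * (Bp - yp)) by rewrite !mulr_ge0 // subr_ge0.
have h2 : 0 <= tau * (am * (Bm - ym)) by rewrite !mulr_ge0 // subr_ge0.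
have h3 : 0 <= (1 - 2 * tau * (ap + am)) * (B - y).
  by rewrite mulr_ge0 // subr_ge0.
rewrite -subr_ge0.
have -> : B - y + 2 * tau * (ap * (Bp - B) + am * (Bm - B)) -
   2 * tau * (ap * (yp - y) + am * (ym - y)) =
   2 * (tau * (ap * (Bp - yp))) + 2 * (tau * (am * (Bm - ym))) +
   (1 - 2 * tau * (ap + am)) * (B - y) by ring.
by rewrite !addr_ge0 // mulr_ge0.
Qed.

Lemma between_dist (R : realDomainType) (lo hi x y : R) :
  lo <= x <= hi -> lo <= y <= hi -> `|x - y| <= hi - lo.
Proof.
by move=> /andP[? ?] /andP[? ?]; rewrite ler_norml; apply/andP; split; lra.
Qed.

Lemma midpoint_between (R : realFieldType) (lo hi x y : R) :
  lo <= x <= hi -> lo <= y <= hi -> lo <= (x + y) / 2 <= hi.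
Proof. by move=> /andP[? ?] /andP[? ?]; apply/andP; split; lra. Qed.

(** Replaces the mean value theorem for Lipschitz data: the increment [X] becomes linear in [A] and
    [B] with bounded coefficients, so the part multiplying a difference of the unknown can enter the
    stencil as a drift. *)
Lemma lin_decomp (R : realFieldType) (L A B X : R) :
  0 <= L -> 0 <= A -> `|X| <= L * (A + `|B|) ->
  exists xi th, [/\ `|xi| <= L, `|th| <= L & X = xi * A + th * B].
Proof.
move=> L0 A0 XL.
have [S0|S0] := eqVneq (A + `|B|) 0.
  exists 0, 0; split; rewrite ?normr0 //.
  by move: XL; rewrite S0 mulr0 normr_le0 => /eqP ->; rewrite !mul0r addr0.
have Sp : 0 < A + `|B| by rewrite lt_def S0 addr_ge0.
have q : `|X / (A + `|B|)| <= L.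
  by rewrite normrM normfV (gtr0_norm Sp) ler_pdivrMr.
exists (X / (A + `|B|)), (Num.sg B * (X / (A + `|B|))); split => //.
  rewrite normrM; apply: le_trans q.
  by rewrite ler_piMl // normr_sg; case: (B != 0).
by rewrite [Num.sg B * _ * B]mulrAC -normrEsg [`|B| * _]mulrC -mulrDr mulfVK.
Qed.

(* [y] is advanced by [v] with a three-point stencil at node [i]; [e] is
   dominated by what the stencil gains on the concave modulus [H] at distance
   [k], the drift being evaluated on [sg *: H]. *)
Definition node_ok (R : realFieldType) (N : nat) (tau : R) (y v H : nat -> R)
    (i k : nat) (sg : R) : Prop :=
  exists ap am e : R,
  [/\ 0 <= ap, 0 <= am, 2 * tau * (ap + am) <= 1,
      v i = ap * (y i.+1 - y i) + am * (y i.-1 - y i) + e &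
      if i == 0%N then am = 0 /\ `|e| <= ap * (H k - H k.-1)
      else if i == N then ap = 0 /\ `|e| <= am * (H k - H k.-1)
      else `|e + sg * ((ap - am) * ((H k.+1 - H k.-1) / 2))|
           <= - ((ap + am) * ((H k.+1 + H k.-1 - 2 * H k) / 2))].

Section Doubling.
Variables (R : realFieldType) (N : nat) (tau : R) (y v H : nat -> R).
Hypotheses (tau_ge0 : 0 <= tau) (H0 : H 0%N = 0).
Hypothesis yH : forall i j, (j < i <= N)%N -> `|y i - y j| <= H (i - j)%N.

Let yH_sg sg i j : `|sg| = 1 -> (j <= i <= N)%N ->
  sg * (y i - y j) <= H (i - j)%N.
Proof.
move=> sg1 /andP[ji iN]; move: ji; rewrite leq_eqVlt => /predU1P[->|ji].
  by rewrite subrr mulr0 subnn H0.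
apply: le_trans (ler_norm _) _; rewrite normrM sg1 mul1r.
by apply: yH; rewrite ji.
Qed.

(** Each of the two nodes may spend half of the slack [H (i - j) - sg * (y i - y j)], whence the
    doubled time step. By [node_ok], what the stencil does to [H] and the error [e] add up to
    something nonpositive. *)
Let upper_node sg i j : `|sg| = 1 -> (j < i <= N)%N ->
  node_ok N tau y v H i (i - j) sg ->
  2 * tau * (sg * v i) <= H (i - j)%N - sg * (y i - y j).
Proof.
move=> sg1 /andP[ji iN] [ap [am [e [ap0 am0 cfl -> he]]]].
have i0 : (i == 0)%N = false by lia.
have hy : sg * (y i - y j) <= H (i - j)%N by apply: yH_sg => //; rewrite iN ltnW.
have hm : sg * (y i.-1 - y j) <= H (i - j).-1.
  have -> : (i - j).-1 = (i.-1 - j)%N by lia.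
  by apply: yH_sg => //; lia.
rewrite i0 in he.
have sge : sg * sg = 1.
  by rewrite -expr2 -(real_normK (num_real _)) sg1 expr1n.
case: ifP he => [_ [ap00 he]|iN' he].
  rewrite ap00 in cfl.
  have := positive_stencil tau_ge0 (lexx 0) am0 cfl hy (lexx 0) hm.
  have := ler_norm (sg * e); rewrite normrM sg1 mul1r => e1.
  have : tau * (sg * e) <= tau * (am * (H (i - j)%N - H (i - j)%N.-1)).
    by rewrite ler_wpM2l // (le_trans e1).
  rewrite ap00; lra.
have hp : sg * (y i.+1 - y j) <= H (i - j).+1.
  have -> : (i - j).+1 = (i.+1 - j)%N by lia.
  by apply: yH_sg => //; lia.
have := positive_stencil tau_ge0 ap0 am0 cfl hy hp hm.
have := le_trans (ler_norm (sg * (e + sg * ((ap - am) * ((H (i - j)%N.+1 -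
   H (i - j)%N.-1) / 2))))) _.
rewrite normrM sg1 mul1r => /(_ _ he) e1.
have : tau * (sg * (e + sg * ((ap - am) * ((H (i - j)%N.+1 -
   H (i - j)%N.-1) / 2)))) <= tau * (- ((ap + am) * ((H (i - j)%N.+1 + H (i - j)%N.-1 - 2 * H (i - j)%N) / 2))).
  by rewrite ler_wpM2l.
rewrite mulrDr (mulrA sg sg) sge mul1r; lra.
Qed.

(** Moving [j] to the right shortens the distance, so both the drift on [H] and [e] change sign
    relative to the upper node; the absolute value in [node_ok] covers the two cases. At [j = 0] the
    only neighbour lies inwards, so the distance can only shrink. *)
Let lower_node sg i j : `|sg| = 1 -> (j < i <= N)%N ->
  node_ok N tau y v H j (i - j) sg ->
  - (2 * tau * (sg * v j)) <= H (i - j)%N - sg * (y i - y j).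
Proof.
move=> sg1 /andP[ji iN] [ap [am [e [ap0 am0 cfl -> he]]]].
have jN : (j == N)%N = false by lia.
have hy : sg * (y i - y j) <= H (i - j)%N by apply: yH_sg => //; rewrite iN ltnW.
have hp : sg * (y i - y j.+1) <= H (i - j).-1.
  have -> : (i - j).-1 = (i - j.+1)%N by lia.
  by apply: yH_sg => //; lia.
rewrite jN in he.
have sge : sg * sg = 1.
  by rewrite -expr2 -(real_normK (num_real _)) sg1 expr1n.
case: ifP he => [_ [am00 he]|j0 he].
  rewrite am00 in cfl.
  have := positive_stencil tau_ge0 ap0 (lexx 0) cfl hy hp (lexx 0).
  have := ler_norm (- (sg * e)); rewrite normrN normrM sg1 mul1r => e1.
  have : tau * (- (sg * e)) <= tau * (ap * (H (i - j)%N - H (i - j)%N.-1)).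
    by rewrite ler_wpM2l // (le_trans e1).
  rewrite am00; lra.
have hm : sg * (y i - y j.-1) <= H (i - j).+1.
  have -> : (i - j).+1 = (i - j.-1)%N by lia.
  by apply: yH_sg => //; lia.
have := positive_stencil tau_ge0 ap0 am0 cfl hy hp hm.
have := le_trans (ler_norm (- (sg * (e + sg * ((ap - am) * ((H (i - j)%N.+1 -
   H (i - j)%N.-1) / 2)))))) _.
rewrite normrN normrM sg1 mul1r => /(_ _ he) e1.
have : tau * (- (sg * (e + sg * ((ap - am) * ((H (i - j)%N.+1 -
   H (i - j)%N.-1) / 2))))) <= tau * (- ((ap + am) * ((H (i - j)%N.+1 + H (i - j)%N.-1 - 2 * H (i - j)%N) / 2))).
  by rewrite ler_wpM2l.
rewrite mulrDr (mulrA sg sg) sge mul1r; lra.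
Qed.

Lemma doubling_step i j : (j < i <= N)%N ->
  (forall sg, `|sg| = 1 -> node_ok N tau y v H i (i - j) sg) ->
  (forall sg, `|sg| = 1 -> node_ok N tau y v H j (i - j) sg) ->
  `|y i + tau * v i - (y j + tau * v j)| <= H (i - j)%N.
Proof.
move=> ijN ni nj.
have n1 : `|1 : R| = 1 by rewrite normr1.
have m1 : `|-1 : R| = 1 by rewrite normrN1.
have := upper_node n1 ijN (ni _ n1); have := lower_node n1 ijN (nj _ n1).
have := upper_node m1 ijN (ni _ m1); have := lower_node m1 ijN (nj _ m1).
by rewrite ler_norml => *; apply/andP; split; lra.
Qed.

End Doubling.

(** * The explicit scheme *)

(* [lia] preprocesses every hypothesis, so those that are not about [nat] go first. *)
Ltac nlia := repeat match goal with H : ?P |- _ =>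
  lazymatch type of P with Prop =>
    lazymatch P with
    | is_true (@leq _ _) => fail
    | is_true (andb (@leq _ _) (@leq _ _)) => fail
    | is_true (negb (@eq_op _ _ _)) => fail
    | @eq ?T _ _ => tryif (first [unify T nat | unify T bool]) then fail else clear H
    | _ => clear H
    end end end; lia.

Lemma sg_sqr (R : realFieldType) (sg : R) : `|sg| = 1 -> sg * sg = 1.
Proof. by move=> sg1; rewrite -expr2 -(real_normK (num_real _)) sg1 expr1n. Qed.

Lemma normr_avg_le (R : realFieldType) (P x y : R) :
  `|x| <= P -> `|y| <= P -> `|(x + y) / 2| <= P.
Proof.
by rewrite !ler_norml => /andP[? ?] /andP[? ?]; apply/andP; split; lra.
Qed.

(** Half of the reserve [S - sg * y] pays for the stencil, the other half for the Lipschitz error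
    [L * (S - sg * y)]. The alternatives with a zero weight serve the end nodes, which lack a
    neighbour. *)
Lemma supersolution_node (R : realFieldType) (sg tau ap am L y yp ym e eS S S' : R) :
  `|sg| = 1 -> 0 <= tau -> 0 <= ap -> 0 <= am -> 2 * tau * (ap + am) <= 1 ->
  2 * tau * L <= 1 ->
  sg * y <= S -> (ap = 0 \/ sg * yp <= S) -> (am = 0 \/ sg * ym <= S) ->
  sg * e <= eS + L * (S - sg * y) -> S + tau * eS <= S' ->
  sg * (y + tau * (ap * (yp - y) + am * (ym - y) + e)) <= S'.
Proof.
move=> sg1 t0 ap0 am0 cfl tL yS ypS ymS he SS'.
have h1 : 0 <= tau * (ap * (S - sg * yp)).
  by case: ypS => [->|?]; rewrite ?mul0r ?mulr0 // !mulr_ge0 // subr_ge0.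
have h2 : 0 <= tau * (am * (S - sg * ym)).
  by case: ymS => [->|?]; rewrite ?mul0r ?mulr0 // !mulr_ge0 // subr_ge0.
have h3 : 0 <= (1 - 2 * tau * (ap + am)) * (S - sg * y).
  by rewrite mulr_ge0 // subr_ge0.
have h4 : 0 <= (1 - 2 * tau * L) * (S - sg * y).
  by rewrite mulr_ge0 // subr_ge0.
have h5 : tau * (sg * e) <= tau * (eS + L * (S - sg * y)) by rewrite ler_wpM2l.
lra.
Qed.

(** [p k] is the slope of a piecewise linear modulus on cell [k]. The last clause is the discrete
    form of [p' <= - psi(p)], with [psi] taken at the central difference of the modulus. It is
    waived where the modulus exceeds [osc], since the bound is then trivial. *)
Definition slopes_ok (R : realFieldType) (psi : R -> R) (h q0 q1 osc : R)
    (p : nat -> R) : Prop :=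
  (forall k, q0 <= p k <= q1) /\
  forall k, osc <= h * (\sum_(m < k.+1) p m) \/
    h * psi ((p k + p k.+1) / 2) <= p k - p k.+1.

Definition lip2 (R : realFieldType) (L T Z : R) (F : R -> R -> R) : Prop :=
  forall t t' z z', 0 <= t <= T -> 0 <= t' <= T -> `|z| <= Z -> `|z'| <= Z ->
  `|F t z - F t' z'| <= L * (`|t - t'| + `|z - z'|).

Definition lip4 (R : realFieldType) (L T l Z P : R) (F : R -> R -> R -> R -> R)
    : Prop :=
  forall t t' x x' z z' p p', 0 <= t <= T -> 0 <= t' <= T ->
  - l <= x <= l -> - l <= x' <= l -> `|z| <= Z -> `|z'| <= Z ->
  `|p| <= P -> `|p'| <= P ->
  `|F t x z p - F t' x' z' p'|
  <= L * ((`|t - t'| + `|x - x'| + `|z - z'|) + `|p - p'|).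

(** [box_qlip] is about [f / a] because the growth condition compares [f] with [a * psi]: once [a]
    is factored out, it cancels against the diffusion coefficient. *)
Record box_bounds (R : realFieldType) (T l Z P a0 a1 b0 L : R)
    (a f : R -> R -> R -> R -> R) (br bl gr gl : R -> R -> R) : Prop := BoxBounds {
  box_T : 0 < T; box_l : 0 < l; box_Z : 0 <= Z; box_P : 0 <= P;
  box_a0 : 0 < a0; box_b0 : 0 < b0; box_L : 0 <= L;
  box_a : forall t x z p, 0 <= t <= T -> - l <= x <= l -> `|z| <= Z ->
    `|p| <= P -> a0 <= a t x z p <= a1;
  box_f : forall t x z p, 0 <= t <= T -> - l <= x <= l -> `|z| <= Z ->
    `|p| <= P -> `|f t x z p| <= L;
  box_br : forall t z, 0 <= t <= T -> `|z| <= Z -> b0 <= br t z <= L;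
  box_bl : forall t z, 0 <= t <= T -> `|z| <= Z -> b0 <= bl t z <= L;
  box_gr : forall t z, 0 <= t <= T -> `|z| <= Z -> `|gr t z| <= L;
  box_gl : forall t z, 0 <= t <= T -> `|z| <= Z -> `|gl t z| <= L;
  box_alip : lip4 L T l Z P a;
  box_flip : lip4 L T l Z P f;
  box_qlip : lip4 L T l Z P (fun t x z p => f t x z p / a t x z p);
  box_brlip : lip2 L T Z br;
  box_bllip : lip2 L T Z bl;
  box_grlip : lip2 L T Z gr;
  box_gllip : lip2 L T Z gl }.

Section Differences.
Variables (R : realFieldType) (h : R) (u : nat -> R).
Definition diff0 i := (u i.+1 - u i.-1) / (2 * h).
Definition diff1 i := (u i.+1 - u i) / h.
Definition diff2 i := (u i.+1 + u i.-1 - 2 * u i) / h ^+ 2.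
End Differences.

(** [cfl] and [cfl_bdry] make the interior and end stencils monotone. [cfl_drift] and [cfl_drift0]
    keep the weights nonnegative after adding a drift of size [L], with or without the factor [a] in
    front. [cfl_zero] pays for Lipschitz dependence on the value. *)
Record grid_ok (R : realFieldType) (l a0 a1 L : R) (N : nat) (h tau : R) : Prop := GridOk {
  N_gt1 : (1 < N)%N; h_gt0 : 0 < h; Nh : N%:R * h = 2 * l; tau_gt0 : 0 < tau;
  cfl : 4 * tau * a1 <= h ^+ 2;
  cfl_drift : h * L <= 2; cfl_drift0 : h * L <= 2 * a0;
  cfl_bdry : 2 * tau * L <= h; cfl_zero : 2 * tau * L <= 1 }.

Section Scheme.
Variables (R : realFieldType) (T l Z P a0 a1 b0 L : R).
Variables (a f : R -> R -> R -> R -> R) (br bl gr gl : R -> R -> R).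
Hypothesis box : box_bounds T l Z P a0 a1 b0 L a f br bl gr gl.
Variables (N : nat) (h tau : R) (u0 : nat -> R).

Definition grid_node (i : nat) : R := - l + i%:R * h.

(** The one-sided differences at the ends look inwards; for positive [bl] and [br] this is the
    upwind choice. *)
Definition scheme_rate (t : R) (u : nat -> R) (i : nat) : R :=
  if i == 0%N then gl t (u 0%N) + bl t (u 0%N) * diff1 h u 0
  else if i == N then gr t (u N) - br t (u N) * diff1 h u N.-1
  else a t (grid_node i) (u i) (diff0 h u i) * diff2 h u i
       + f t (grid_node i) (u i) (diff0 h u i).

Fixpoint scheme (n : nat) : nat -> R :=
  if n is m.+1
  then fun i => scheme m i + tau * scheme_rate (m%:R * tau) (scheme m) i
  else u0.

Hypothesis gok : grid_ok l a0 a1 L N h tau.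

Let h0 : 0 < h := h_gt0 gok.
Let tau0 : 0 <= tau := ltW (tau_gt0 gok).
Let hn0 : h != 0 := lt0r_neq0 h0.

Lemma node_in i : (i <= N)%N -> - l <= grid_node i <= l.
Proof.
move=> iN; rewrite /grid_node lerDl mulr_ge0 ?(ltW h0) //=.
have : i%:R * h <= N%:R * h by rewrite ler_pM2r // ler_nat.
by rewrite (Nh gok); lra.
Qed.

Lemma tau_in n : n%:R * tau <= T -> 0 <= n%:R * tau <= T.
Proof. by move=> ->; rewrite andbT mulr_ge0. Qed.

Lemma diff0E u i : (0 < i)%N -> diff0 h u i = (diff1 h u i + diff1 h u i.-1) / 2.
Proof.
by move=> i0; rewrite /diff0 /diff1 prednK //; field.
Qed.

Lemma diff2E u i : (0 < i)%N -> diff2 h u i = (diff1 h u i - diff1 h u i.-1) / h.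
Proof.
by move=> i0; rewrite /diff2 /diff1 prednK //; field.
Qed.

Definition slope_modulus (p : nat -> R) (k : nat) : R := h * \sum_(m < k) p m.

Lemma modulusS p k : slope_modulus p k.+1 = slope_modulus p k + h * p k.
Proof. by rewrite /slope_modulus big_ord_recr /= mulrDr. Qed.

Section SupBound.
Variables (t : R) (u : nat -> R) (S S' sg : R).
Hypotheses (t_in : 0 <= t <= T) (sg1 : `|sg| = 1).
Hypotheses (uZ : forall i, (i <= N)%N -> `|u i| <= Z).
Hypotheses (du : forall i, (i < N)%N -> `|diff1 h u i| <= P).
Hypotheses (S_in : `|S| <= Z).
Hypotheses (uS : forall i, (i <= N)%N -> sg * u i <= S).
Hypotheses (fS : forall x, - l <= x <= l ->
              S + tau * (sg * f t x (sg * S) 0) <= S')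
  (grS : S + tau * (sg * gr t (sg * S)) <= S')
  (glS : S + tau * (sg * gl t (sg * S)) <= S').

Lemma diff0_le i : (0 < i < N)%N -> `|diff0 h u i| <= P.
Proof.
move=> /andP[i0 iN]; rewrite diff0E //.
by apply: normr_avg_le; apply: du => //; nlia.
Qed.

Let lipS (X : R -> R) : (forall z z', `|z| <= Z -> `|z'| <= Z ->
    `|X z - X z'| <= L * `|z - z'|) -> forall i, (i <= N)%N ->
  sg * X (u i) <= sg * X (sg * S) + L * (S - sg * u i).
Proof.
move=> XL i iN; have := XL (u i) (sg * S) (uZ iN).
rewrite normrM sg1 mul1r => /(_ S_in).
have -> : `|u i - sg * S| = S - sg * u i.
  rewrite -[LHS]mul1r -sg1 -normrM mulrBr mulrA sg_sqr // mul1r distrC ger0_norm //.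
  by rewrite subr_ge0 uS.
move=> XL'; have := le_trans (ler_norm (sg * (X (u i) - X (sg * S)))) _.
by rewrite normrM sg1 mul1r => /(_ _ XL'); rewrite mulrBr lerBlDl.
Qed.

(** Replacing [u i] by [sg * S] in the zero-order terms costs at most [L * (S - sg * u i)], which
    [supersolution_node] absorbs; so the inequalities are required at the constant state [sg * S]
    only. *)
Lemma sup_step i : (i <= N)%N -> sg * (u i + tau * scheme_rate t u i) <= S'.
Proof.
have bL := box_L box; have N1 := N_gt1 gok.
have z2 := cfl_zero gok.
move=> iN; rewrite /scheme_rate; have [->|i0] := eqVneq i 0%N.
  have /andP[b0b bL'] := box_bl box t_in (uZ (leq0n _)).
  have -> : gl t (u 0%N) + bl t (u 0%N) * diff1 h u 0 =
    bl t (u 0%N) / h * (u 1%N - u 0%N) + 0 * (0 - u 0%N) + gl t (u 0%N).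
    by rewrite /diff1; field.
  have bh : 0 <= bl t (u 0%N) / h.
    by rewrite divr_ge0 ?ltW // (lt_le_trans (box_b0 box)).
  apply: (supersolution_node (S := S) sg1 tau0 bh (lexx 0) _ z2 _ _ _ _ glS).
  - rewrite addr0 mulrA ler_pdivrMr // mul1r; apply: le_trans (cfl_bdry gok).
    by rewrite ler_wpM2l // mulr_ge0.
  - exact: uS.
  - by right; apply: uS; nlia.
  - by left.
  - apply: (lipS (X := gl t)) => // z z' zZ z'Z.
    by have := box_gllip box t_in t_in zZ z'Z; rewrite subrr normr0 add0r.
have [->|iN'] := eqVneq i N.
  have /andP[b0b bL'] := box_br box t_in (uZ (leqnn _)).
  have -> : gr t (u N) - br t (u N) * diff1 h u N.-1 =
    0 * (0 - u N) + br t (u N) / h * (u N.-1 - u N) + gr t (u N).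
    by rewrite /diff1 prednK; [field|nlia].
  have bh : 0 <= br t (u N) / h.
    by rewrite divr_ge0 ?ltW // (lt_le_trans (box_b0 box)).
  apply: (supersolution_node (S := S) sg1 tau0 (lexx 0) bh _ z2 _ _ _ _ grS).
  - rewrite add0r mulrA ler_pdivrMr // mul1r; apply: le_trans (cfl_bdry gok).
    by rewrite ler_wpM2l // mulr_ge0.
  - exact: uS.
  - by left.
  - by right; apply: uS; nlia.
  - apply: (lipS (X := gr t)) => // z z' zZ z'Z.
    by have := box_grlip box t_in t_in zZ z'Z; rewrite subrr normr0 add0r.
have xin := node_in iN.
have d0P : `|diff0 h u i| <= P by apply: diff0_le; nlia.
have P0 : `|0 : R| <= P by rewrite normr0 (box_P box).
set x := grid_node i in xin *; set A := a t x (u i) _.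
have /andP[aA Aa] : a0 <= A <= a1 by apply: (box_a box) => //; apply: uZ.
have fL := box_flip box t_in t_in xin xin (uZ iN) (uZ iN) d0P P0.
rewrite !subrr !normr0 !add0r subr0 in fL.
(* Only the slope dependence of [f] is expanded, about slope [0], the slope at which the barrier
   hypothesis is stated; [th] then joins the weights as a drift. *)
have [xi [th [_ thL]]] := lin_decomp bL (lexx 0) (B := diff0 h u i)
   (X := f t x (u i) (diff0 h u i) - f t x (u i) 0) ltac:(by rewrite add0r).
rewrite mulr0 add0r => /eqP; rewrite subr_eq => /eqP ->.
have -> : A * diff2 h u i + (th * diff0 h u i + f t x (u i) 0) =
  (A / h ^+ 2 + th / (2 * h)) * (u i.+1 - u i)
  + (A / h ^+ 2 - th / (2 * h)) * (u i.-1 - u i) + f t x (u i) 0.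
  by rewrite /diff2 /diff0; field.
have /andP[? ?] : - (A / h ^+ 2) <= th / (2 * h) <= A / h ^+ 2.
  rewrite -ler_norml normrM normfV (gtr0_norm (_ : 0 < 2 * h)) ?mulr_gt0 //.
  rewrite ler_pdivrMr ?mulr_gt0 // (le_trans thL) //.
  have -> : A / h ^+ 2 * (2 * h) = 2 * A / h by field.
  rewrite ler_pdivlMr // mulrC; apply: le_trans (cfl_drift0 gok) _.
  by rewrite ler_pM2l.
apply: (supersolution_node (S := S) sg1 tau0 _ _ _ z2 _ _ _ _ (fS xin)).
- by rewrite addrC -lerBlDr sub0r.
- by rewrite subr_ge0.
- rewrite [X in X <= _](_ : _ = 4 * tau * A / h ^+ 2); last by field.
  rewrite ler_pdivrMr ?exprn_gt0 // mul1r; apply: le_trans (cfl gok).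
  by rewrite ler_wpM2l // mulr_ge0.
- exact: uS.
- by right; apply: uS; nlia.
- by right; apply: uS; nlia.
- apply: (lipS (X := fun z => f t x z 0)) => // z z' zZ z'Z.
  by have := box_flip box t_in t_in xin xin zZ z'Z P0 P0;
     rewrite !subrr !normr0 !add0r addr0.
Qed.

End SupBound.
End Scheme.

(** * Bounds for the slopes *)

Section Gradient.
Variables (R : realFieldType) (T l Z P a0 a1 b0 L : R).
Variables (a f : R -> R -> R -> R -> R) (br bl gr gl : R -> R -> R).
Hypothesis box : box_bounds T l Z P a0 a1 b0 L a f br bl gr gl.
Variables (N : nat) (h tau : R) (u0 : nat -> R).
Hypothesis gok : grid_ok l a0 a1 L N h tau.

Notation rate := (scheme_rate l a f br bl gr gl N h).
Notation grid := (scheme l a f br bl gr gl N h tau u0).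
Notation node := (grid_node l h).
Notation modulus := (slope_modulus h).

Let h0 : 0 < h := h_gt0 gok.
Let tau0 : 0 <= tau := ltW (tau_gt0 gok).
Let hn0 : h != 0 := lt0r_neq0 h0.

Lemma stencil_cfl A : A <= a1 -> 2 * tau * (2 * A / h ^+ 2) <= 1.
Proof.
move=> Aa; rewrite [X in X <= _](_ : _ = 4 * tau * A / h ^+ 2); last by field.
rewrite ler_pdivrMr ?exprn_gt0 // mul1r; apply: le_trans (cfl gok).
by rewrite ler_wpM2l // mulr_ge0.
Qed.

Lemma bdry_cfl b : 0 <= b <= L -> 2 * tau * (b / h) <= 1.
Proof.
move=> /andP[_ bL]; rewrite mulrA ler_pdivrMr // mul1r.
by apply: le_trans (cfl_bdry gok); rewrite ler_wpM2l // mulr_ge0.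
Qed.

Lemma bl_ge0 t z : 0 <= t <= T -> `|z| <= Z -> 0 <= bl t z <= L.
Proof.
move=> tT zZ; have /andP[b0b ->] := box_bl box tT zZ; rewrite andbT.
by apply: le_trans b0b; rewrite ltW ?(box_b0 box).
Qed.

Lemma br_ge0 t z : 0 <= t <= T -> `|z| <= Z -> 0 <= br t z <= L.
Proof.
move=> tT zZ; have /andP[b0b ->] := box_br box tT zZ; rewrite andbT.
by apply: le_trans b0b; rewrite ltW ?(box_b0 box).
Qed.

Variables (M q0 q1 : R) (psi : R -> R).
Hypotheses (MZ : M <= Z) (q0_ge0 : 0 <= q0) (q1P : q1 <= P).
Hypothesis f_bound : forall t x z p, 0 <= t <= T -> - l <= x <= l ->
  `|z| <= M -> `|f t x z p| <= a t x z p * psi `|p|.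
Hypothesis g_bound : forall t z p, 0 <= t <= T -> `|z| <= M -> q0 <= p ->
  `|gr t z| <= br t z * p /\ `|gl t z| <= bl t z * p.

(** At an end node the modulus gains [b * p k], which dominates [g] because [p k >= q0]. Inside, the
    coefficient [A] cancels and what remains is [psi s <= (p k - p k.+1) / h]. *)
Lemma gradient_node t u p k i sg :
  0 <= t <= T -> (forall i, (i <= N)%N -> `|u i| <= M) ->
  (forall i, (i < N)%N -> `|diff1 h u i| <= q1) ->
  (forall k, q0 <= p k <= q1) ->
  h * psi ((p k + p k.+1) / 2) <= p k - p k.+1 ->
  (i <= N)%N -> `|sg| = 1 ->
  node_ok N tau u (rate t u) (modulus p) i k.+1 sg.
Proof.
move=> tT uM du pq slope iN sg1.
have uZ j : (j <= N)%N -> `|u j| <= Z by move=> /uM uMj; apply: le_trans MZ.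
have bL := box_L box; have N1 := N_gt1 gok.
have /andP[qpk pkq] := pq k; have /andP[qpk' pkq'] := pq k.+1.
rewrite /node_ok /rate; have [->|i0] := eqVneq i 0%N.
  have /andP[b0b bL'] := bl_ge0 tT (uZ 0%N isT).
  exists (bl t (u 0%N) / h), 0, (gl t (u 0%N)); split => //.
  - by rewrite divr_ge0 // ltW.
  - by rewrite addr0 bdry_cfl ?b0b.
  - by rewrite /diff1; field.
  - split=> //; rewrite modulusS /= addrC addKr mulrA divfK //.
    by have [] := g_bound tT (uM 0%N isT) qpk.
have [->|iN'] := eqVneq i N.
  have /andP[b0b bL'] := br_ge0 tT (uZ N (leqnn _)).
  exists 0, (br t (u N) / h), (gr t (u N)); split => //.
  - by rewrite divr_ge0 // ltW.
  - by rewrite add0r bdry_cfl ?b0b.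
  - by rewrite /diff1 prednK; [field|nlia].
  - split=> //; rewrite modulusS /= addrC addKr mulrA divfK //.
    by have [] := g_bound tT (uM N (leqnn _)) qpk.
have xin := node_in gok iN.
set s := (p k + p k.+1) / 2 in slope *.
have q00 := q0_ge0; have q1P' := q1P.
have s0 : 0 <= s by rewrite /s; lra.
have ssg : `|sg * s| = s by rewrite normrM sg1 mul1r ger0_norm.
have sP : `|sg * s| <= P by rewrite ssg /s; lra.
have d0P : `|diff0 h u i| <= P.
  by apply: (diff0_le gok _) => [j jN|]; [exact: le_trans (du _ jN) q1P|nlia].
set x := node i in xin *; set A := a t x (u i) _.
have uiZ := uZ _ iN; have uiM := uM _ iN.
have /andP[aA Aa] : a0 <= A <= a1 by apply: (box_a box).
have A0 : 0 < A by apply: lt_le_trans aA; apply: (box_a0 box).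
have An0 : A != 0 by rewrite gt_eqF.
have As0 : a t x (u i) (sg * s) != 0.
  have /andP[aA' _] : a0 <= a t x (u i) (sg * s) <= a1 by apply: (box_a box).
  by rewrite gt_eqF // (lt_le_trans (box_a0 box)).
(* The quotient [f / a] is expanded about [sg * s], the slope of the signed modulus at this
   distance. There the growth condition bounds it by [psi s], and the coefficient [c] of the
   expansion becomes a drift. *)
have qL := box_qlip box tT tT xin xin uiZ uiZ d0P sP.
rewrite !subrr !normr0 !add0r in qL.
have := lin_decomp bL (lexx 0) (B := diff0 h u i - sg * s)
   (X := f t x (u i) (diff0 h u i) / A
         - f t x (u i) (sg * s) / a t x (u i) (sg * s)).
rewrite add0r => /(_ qL) [xi [c [_ cL]]].
rewrite mulr0 add0r => /eqP; rewrite subr_eq => /eqP fE.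
set F := f t x (u i) (sg * s) / a t x (u i) (sg * s) in fE.
have FE : `|F| <= psi s.
  rewrite normrM normfV ler_pdivrMr ?normr_gt0 // [psi s * _]mulrC.
  have := f_bound (sg * s) tT xin uiM; rewrite ssg => /le_trans; apply.
  have /andP[aA' _] : a0 <= a t x (u i) (sg * s) <= a1 by apply: (box_a box).
  rewrite ger0_norm //.
  by apply: le_trans aA'; apply: ltW (box_a0 box).
have ch : `|c * h / 2| <= 1.
  rewrite normrM normfV normrM (gtr0_norm h0) (ger0_norm (ler0n R 2)) ler_pdivrMr // mul1r mulrC.
  by apply: le_trans (cfl_drift gok); rewrite ler_pM2l.
move: ch; rewrite ler_norml => /andP[ch1 ch2].
exists (A / h ^+ 2 * (1 + c * h / 2)), (A / h ^+ 2 * (1 - c * h / 2)),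
   (A * (F - c * (sg * s))); split.
- by rewrite mulr_ge0 ?divr_ge0 ?exprn_ge0 ?(ltW A0) ?(ltW h0) // -lerBlDl sub0r.
- by rewrite mulr_ge0 ?divr_ge0 ?exprn_ge0 ?(ltW A0) ?(ltW h0) // subr_ge0.
- rewrite [X in 2 * tau * X](_ : _ = 2 * A / h ^+ 2) ?stencil_cfl //; by field.
- have -> : f t x (u i) (diff0 h u i) = A * (c * (diff0 h u i - sg * s) + F).
    by rewrite -fE mulrC divfK.
  by rewrite /diff2 /diff0; field.
- have sgs := sg_sqr sg1.
  rewrite !modulusS /=.
  have -> : A * (F - c * (sg * s)) +
    sg * ((A / h ^+ 2 * (1 + c * h / 2) - A / h ^+ 2 * (1 - c * h / 2)) *
     ((modulus p k + h * p k + h * p k.+1 - modulus p k) / 2)) = A * F.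
    by rewrite /s; field.
  have -> : - ((A / h ^+ 2 * (1 + c * h / 2) + A / h ^+ 2 * (1 - c * h / 2)) *
   ((modulus p k + h * p k + h * p k.+1 + modulus p k
     - 2 * (modulus p k + h * p k)) / 2)) = A * ((p k - p k.+1) / h) by field.
  rewrite normrM (gtr0_norm A0) ler_pM2l // (le_trans FE) //.
  by rewrite ler_pdivlMr // mulrC.
Qed.

(** The sign [sg] lets one sequence act both as a barrier [S] from above and as a barrier [- S] from
    below. *)
Definition supersolution (S : nat -> R) : Prop :=
  (forall n, n%:R * tau <= T -> 0 <= S n <= Z) /\
  forall n sg, n.+1%:R * tau <= T -> `|sg| = 1 ->
  [/\ forall x, - l <= x <= l ->
        S n + tau * (sg * f (n%:R * tau) x (sg * S n) 0) <= S n.+1,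
      S n + tau * (sg * gr (n%:R * tau) (sg * S n)) <= S n.+1 &
      S n + tau * (sg * gl (n%:R * tau) (sg * S n)) <= S n.+1].

Variable p : nat -> R.
Hypothesis p_ok : slopes_ok psi h q0 q1 (2 * M) p.
Hypothesis sup_inf : forall n eps, n%:R * tau <= T -> 0 < eps ->
  exists S, [/\ supersolution S, forall i, (i <= N)%N -> `|u0 i| <= S 0%N
    & S n <= M + eps].
Hypothesis u0_lip : forall i j, (j < i <= N)%N ->
  `|u0 i - u0 j| <= q0 * ((i - j)%:R * h).

Lemma modulus_ge k : q0 * (k%:R * h) <= modulus p k.
Proof.
elim: k => [|k IH]; first by rewrite /modulus big_ord0 !mul0r !mulr0.
rewrite modulusS -natr1 mulrDl mulrDr lerD // mul1r mulrC ler_pM2l //.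
by have /andP[] := p_ok.1 k.
Qed.

Lemma modulus1_diff1 u : (forall i j, (j < i <= N)%N -> `|u i - u j| <= modulus p (i - j)%N) ->
  forall i, (i < N)%N -> `|diff1 h u i| <= q1.
Proof.
move=> uH i iN; have := uH i.+1 i; rewrite iN ltnSn subSnn => /(_ isT).
rewrite modulusS /modulus big_ord0 mulr0 add0r => h1.
rewrite /diff1 normrM normfV (gtr0_norm h0) ler_pdivrMr // (le_trans h1) //.
by rewrite mulrC ler_pM2r //; have /andP[] := p_ok.1 0%N.
Qed.

(** The bounds cannot be separated: the value bound at the next step needs slopes in the box, the
    slope bound needs values in [[- M, M]]. As [M] is an infimum, the values are compared with every
    supersolution and [M] itself is reached by letting [eps] tend to zero. *)
Lemma C1_bounds_aux n : n%:R * tau <= T ->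
  (forall S, supersolution S -> (forall i, (i <= N)%N -> `|u0 i| <= S 0%N) ->
    forall i, (i <= N)%N -> `|grid n i| <= S n) /\
  (forall i j, (j < i <= N)%N -> `|grid n i - grid n j| <= modulus p (i - j)%N).
Proof.
elim: n => [|n IH] nT.
  split=> [S _ //|i j ij]; apply: le_trans (u0_lip ij) _; exact: modulus_ge.
have nT' : n%:R * tau <= T.
  by apply: le_trans nT; rewrite ler_wpM2r // ler_nat.
have tT : 0 <= n%:R * tau <= T by rewrite nT' mulr_ge0.
have supM m : m%:R * tau <= T ->
    (forall S, supersolution S -> (forall i, (i <= N)%N -> `|u0 i| <= S 0%N) ->
    forall i, (i <= N)%N -> `|grid m i| <= S m) ->
    forall i, (i <= N)%N -> `|grid m i| <= M.
  move=> mT HS i iN; apply/ler_addgt0Pr => e e0.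
  have [S [Ss S0 Se]] := sup_inf mT e0.
  by apply: le_trans Se; apply: HS.
have [IHS IHH] := IH nT'.
have uM := supM _ nT' IHS.
have du := modulus1_diff1 IHH.
have NS S : supersolution S -> (forall i, (i <= N)%N -> `|u0 i| <= S 0%N) ->
    forall i, (i <= N)%N -> `|grid n.+1 i| <= S n.+1.
  move=> Ss S0 i iN.
  have /andP[Sn0 SnZ] := Ss.1 _ nT'.
  have key sg : `|sg| = 1 -> sg * grid n.+1 i <= S n.+1.
    move=> sg1; have [fS grS glS] := Ss.2 n sg nT sg1.
    apply: (sup_step box gok tT sg1 _ _ (S := S n)) => //.
    - by move=> j jN; apply: le_trans (uM _ jN) MZ.
    - by move=> j jN; apply: le_trans (du _ jN) q1P.
    - by rewrite ger0_norm.
    - move=> j jN; apply: le_trans (ler_norm _) _; rewrite normrM sg1 mul1r.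
      exact: IHS.
  rewrite ler_norml.
  have := key 1 (normr1 _); have := key (-1) (normrN1 _); rewrite mul1r mulN1r lerNl.
  by move=> -> ->.
split=> // i j ijN.
have uM' := supM _ nT NS.
have /andP[ji iN] := ijN.
have kE : (i - j)%N = (i - j).-1.+1 by nlia.
(* If the modulus has reached [2 * M], the value bound at the new step is enough and no comparison
   is made. *)
have [osc|slope] := p_ok.2 (i - j).-1.
  rewrite -kE in osc; apply: le_trans osc.
  apply: le_trans (ler_normB _ _) _.
  have := uM' _ iN; have := uM' j (ltnW (leq_trans ji iN)); lra.
apply: (@doubling_step _ N tau (grid n) (rate (n%:R * tau) (grid n)) (modulus p)) => //.
- by rewrite /modulus big_ord0 mulr0.
- by move=> sg sg1; rewrite kE; apply: gradient_node => //; exact: p_ok.1.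
- move=> sg sg1; rewrite kE; apply: gradient_node => //; first exact: p_ok.1.
  by apply: ltnW; apply: leq_trans iN.
Qed.

Lemma grid_bound n i : n%:R * tau <= T -> (i <= N)%N -> `|grid n i| <= M.
Proof.
move=> nT iN; apply/ler_addgt0Pr => e e0.
have [S [Ss S0 Se]] := sup_inf nT e0.
by apply: le_trans Se; apply: (C1_bounds_aux nT).1.
Qed.

Lemma grid_diff1_bound n i : n%:R * tau <= T -> (i < N)%N ->
  `|diff1 h (grid n) i| <= q1.
Proof. by move=> nT; apply: modulus1_diff1; apply: (C1_bounds_aux nT).2. Qed.

End Gradient.

(** * Bounds for the second differences *)

Section Curvature.
Variables (R : realFieldType) (T l Z P a0 a1 b0 L : R).
Variables (a f : R -> R -> R -> R -> R) (br bl gr gl : R -> R -> R).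
Hypothesis box : box_bounds T l Z P a0 a1 b0 L a f br bl gr gl.
Variables (N : nat) (h tau : R) (u0 : nat -> R).
Hypothesis gok : grid_ok l a0 a1 L N h tau.

Notation rate := (scheme_rate l a f br bl gr gl N h).
Notation grid := (scheme l a f br bl gr gl N h tau u0).
Notation node := (grid_node l h).
Notation modulus := (slope_modulus h).

Let h0 : 0 < h := h_gt0 gok.
Let tau0 : 0 <= tau := ltW (tau_gt0 gok).
Let hn0 : h != 0 := lt0r_neq0 h0.

Lemma nodeS i : node i.+1 - node i = h.
Proof. by rewrite /grid_node -natr1; ring. Qed.

Lemma diff1S u v i : diff1 h (fun i => u i + tau * v i) i = diff1 h u i + tau * diff1 h v i.
Proof. by rewrite /diff1; field. Qed.

(** The boundary row contains no second difference, so a slope bound already controls the rate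
    there. This acts as a flux condition for the scheme of the slopes. *)
Lemma rate_bdryr t u : 0 <= t <= T -> (forall i, (i <= N)%N -> `|u i| <= Z) ->
  (forall i, (i < N)%N -> `|diff1 h u i| <= P) -> `|rate t u N| <= L + L * P.
Proof.
move=> tT uZ du; have N1 := N_gt1 gok.
rewrite /scheme_rate eqxx; have -> : (N == 0%N) = false by nlia.
rewrite (le_trans (ler_normB _ _)) // lerD ?(box_gr box) ?uZ // normrM.
have /andP[b0b bL'] := br_ge0 box tT (uZ N (leqnn _)).
by apply: ler_pM => //; [rewrite ger0_norm|apply: du; nlia].
Qed.

Lemma rate_bdryl t u : 0 <= t <= T -> (forall i, (i <= N)%N -> `|u i| <= Z) ->
  (forall i, (i < N)%N -> `|diff1 h u i| <= P) -> `|rate t u 0| <= L + L * P.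
Proof.
move=> tT uZ du; have N1 := N_gt1 gok.
rewrite /scheme_rate eqxx.
rewrite (le_trans (ler_normD _ _)) // lerD ?(box_gl box) ?uZ // normrM.
have /andP[b0b bL'] := bl_ge0 box tT (uZ 0%N isT).
by apply: ler_pM => //; [rewrite ger0_norm|apply: du; nlia].
Qed.

(** The central slope changes by [(diff1 h u i.+1 - diff1 h u i.-1) / 2] between neighbouring nodes;
    this difference is kept explicit because it is the one that the drift acts on. *)
Lemma lip4_space F t u i : lip4 L T l Z P F -> 0 <= t <= T ->
  (forall i, (i <= N)%N -> `|u i| <= Z) ->
  (forall i, (i < N)%N -> `|diff1 h u i| <= P) -> (0 < i)%N -> (i.+1 < N)%N ->
  exists xi th, [/\ `|xi| <= L * (1 + P), `|th| <= L &
    F t (node i.+1) (u i.+1) (diff0 h u i.+1) - F t (node i) (u i) (diff0 h u i)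
    = h * xi + th * ((diff1 h u i.+1 - diff1 h u i.-1) / 2)].
Proof.
move=> FL tT uZ du i0 iN.
have iN' := ltnW (ltnW iN); have iN'' := ltnW iN.
have d0 j : (0 < j < N)%N -> `|diff0 h u j| <= P by exact: (diff0_le gok).
have := FL t t _ _ _ _ _ _ tT tT (node_in gok iN'') (node_in gok iN')
  (uZ _ iN'') (uZ _ iN') (d0 i.+1 iN) (d0 i _).
rewrite i0 (ltnW iN) => /(_ isT).
rewrite subrr normr0 add0r nodeS (gtr0_norm h0).
have -> : diff0 h u i.+1 - diff0 h u i = (diff1 h u i.+1 - diff1 h u i.-1) / 2.
  by rewrite !(diff0E gok) //=; field.
have -> : u i.+1 - u i = h * diff1 h u i by rewrite /diff1; field.
rewrite normrM (gtr0_norm h0) => /(lin_decomp (box_L box)).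
have hw : 0 <= h + h * `|diff1 h u i| by rewrite addr_ge0 ?mulr_ge0 // ltW.
move=> /(_ hw) [xi [th [xiL thL ->]]]; exists (xi * (1 + `|diff1 h u i|)), th.
split => //; last by ring.
by rewrite normrM; apply: ler_pM => //; rewrite ger0_norm ?addr_ge0 // lerD2l; apply: du; nlia.
Qed.

Variables (q2 q3 : R) (psi : R -> R).
Hypotheses (q2_ge0 : 0 <= q2) (q2_bdry : 2 * L + L * P <= a0 * q2).
Hypothesis q3_small : h * (L * (1 + P / 2 + q3)) <= a0.
Hypothesis psi_quad : forall s, 0 <= s ->
  L * (s ^+ 2 + (2 + P) * s + (1 + P)) <= a0 * psi s.

(** The variation of [a] along the solution makes the equation for the slopes quadratic in their
    differences. The quadratic term is linearised about the value it takes on the modulus, leaving a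
    drift [C1] and a remainder [E] of size [h ^+ 2 * psi s]. *)
Lemma curvature_node t u p k i sg :
  0 <= t <= T -> (forall i, (i <= N)%N -> `|u i| <= Z) ->
  (forall i, (i < N)%N -> `|diff1 h u i| <= P) ->
  (forall k, q2 <= p k <= q3) ->
  (forall i j, (j < i < N)%N -> `|diff1 h u i - diff1 h u j| <= modulus p (i - j)) ->
  h * psi ((p k + p k.+1) / 2) <= p k - p k.+1 ->
  (i < N)%N -> `|sg| = 1 ->
  node_ok N.-1 tau (diff1 h u) (diff1 h (rate t u)) (modulus p) i k.+1 sg.
Proof.
move=> tT uZ du pq wH slope iN sg1.
have bL := box_L box; have bP := box_P box; have N1 := N_gt1 gok.
have /andP[qpk pkq] := pq k; have /andP[qpk' pkq'] := pq k.+1.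
have q20 := q2_ge0.
have a00 := box_a0 box.
have xin j : (j <= N)%N -> - l <= node j <= l by exact: (node_in gok).
have d0P j : (0 < j < N)%N -> `|diff0 h u j| <= P by exact: (diff0_le gok).
pose A j := a t (node j) (u j) (diff0 h u j).
pose F j := f t (node j) (u j) (diff0 h u j).
have Ab j : (0 < j < N)%N -> a0 <= A j <= a1.
  by move=> jN; apply: (box_a box) => //; [apply: xin|apply: uZ|exact: d0P]; nlia.
have Fb j : (0 < j < N)%N -> `|F j| <= L.
  by move=> jN; apply: (box_f box) => //; [apply: xin|apply: uZ|exact: d0P]; nlia.
have A0 j : (0 < j < N)%N -> 0 <= A j.
  by move=> /Ab/andP[a0A _]; apply: le_trans a0A; apply: ltW.
have rI j : (0 < j < N)%N -> rate t u j =
    A j * ((diff1 h u j - diff1 h u j.-1) / h) + F j.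
  move=> /andP[j0 jN]; rewrite /scheme_rate -(diff2E gok) //.
  by have [-> ->] : (j == 0%N) = false /\ (j == N) = false by nlia.
(* At the ends the error is a bounded quantity over [h], and the modulus gains [A j * p k / h];
   [q2_bdry] makes the gain larger. *)
have bdry j E : (0 < j < N)%N -> `|E| <= 2 * L + L * P ->
    `|E / h| <= A j / h ^+ 2 * (modulus p k.+1 - modulus p k.+1.-1).
  move=> jN EL; rewrite modulusS /= addrC addKr normrM normfV (gtr0_norm h0).
  rewrite ler_pdivrMr //; have -> : A j / h ^+ 2 * (h * p k) * h = A j * p k by field.
  apply: le_trans EL _; apply: le_trans q2_bdry _.
  by have /andP[aA _] := Ab _ jN; rewrite ler_pM // ltW.
have bdry_h j : (0 < j < N)%N -> 2 * tau * (A j / h ^+ 2) <= 1.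
  move=> jN; have /andP[_ Aa] := Ab _ jN; apply: le_trans (stencil_cfl gok Aa).
  rewrite ler_wpM2l ?mulr_ge0 // ler_pM2r ?invr_gt0 ?exprn_gt0 //.
  by have := A0 _ jN; lra.
rewrite /node_ok; have [->|i0] := eqVneq i 0%N.
  have j1 : (0 < 1 < N)%N by nlia.
  exists (A 1%N / h ^+ 2), 0, ((F 1%N - rate t u 0) / h); split => //.
  - by rewrite divr_ge0 ?A0 // exprn_ge0 // ltW.
  - by rewrite addr0 bdry_h.
  - by rewrite {1}/diff1 rI //=; field.
  - split=> //; apply: bdry => //; apply: le_trans (ler_normB _ _) _.
    by have := Fb _ j1; have := rate_bdryl tT uZ du; lra.
have [iE|iN'] := eqVneq i N.-1.
  have j1 : (0 < i < N)%N by nlia.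
  have iS : i.+1 = N by nlia.
  exists 0, (A i / h ^+ 2), ((rate t u N - F i) / h); split => //.
  - by rewrite divr_ge0 ?A0 // exprn_ge0 // ltW.
  - by rewrite add0r bdry_h.
  - by rewrite {1}/diff1 iS (rI _ j1); field.
  - split=> //; apply: bdry => //; apply: le_trans (ler_normB _ _) _.
    by have := Fb _ j1; have := rate_bdryr tT uZ du; lra.
have iN2 : (i.+1 < N)%N by nlia.
have i1 : (0 < i)%N by nlia.
have [xi [th [xiL thL AE]]] := lip4_space (box_alip box) tT uZ du i1 iN2.
have [xi' [th' [xiL' thL' FE]]] := lip4_space (box_flip box) tT uZ du i1 iN2.
set s := (p k + p k.+1) / 2 in slope *.
have /andP[sq2 sq3] : q2 <= s <= q3 by exact: midpoint_between.
have s0 : 0 <= s by exact: le_trans sq2.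
set wp := diff1 h u i.+1 in AE FE *; set wm := diff1 h u i.-1 in AE FE *.
set w := diff1 h u i.
(* [D] is the value of [wp - wm] on the signed modulus. *)
have [D DE] : exists D, D = 2 * h * s * sg by exists (2 * h * s * sg).
(* From [X ^ 2 = D ^ 2 + (X + D) * (X - D)] with [X = wp - wm]: [C1] collects what multiplies
   [X - D], and [E] is the value at [X = D]. *)
pose C1 := h * xi / 2 + th * ((wp - wm) + D) / 4 + h * th' / 2.
pose E := (h * xi) * D / 2 + th * D ^+ 2 / 4 + h ^+ 2 * xi' + h * th' * D / 2.
pose Am := (A i + A i.+1) / 2.
have /andP[aA Aa] : a0 <= A i <= a1 by apply: Ab; rewrite i1 ltnW.
have /andP[aA' Aa'] : a0 <= A i.+1 <= a1 by apply: Ab; rewrite iN2.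
have /andP[aAm Ama] : a0 <= Am <= a1 by apply: midpoint_between; apply/andP.
have q30 : 0 <= 2 * h * s by apply: mulr_ge0 => //; apply: mulr_ge0 => //; apply: ltW h0.
have Dle : `|D| <= 2 * h * q3.
  by rewrite DE normrM sg1 mulr1 ger0_norm // ler_pM2l // mulr_gt0.
(* The modulus being propagated bounds the drift itself: [wp - wm] is a difference over two cells,
   so [wH] applies and [q3_small] keeps the weights nonnegative. *)
have wle : `|wp - wm| <= 2 * h * q3.
  have := wH i.+1 i.-1; have -> : (i.+1 - i.-1 = 2)%N by nlia.
  have -> : (i.-1 < i.+1 < N)%N by nlia.
  move=> /(_ isT)/le_trans; apply.
  rewrite !modulusS /slope_modulus big_ord0 mulr0 add0r -mulrDr (mulrC 2) -mulrA ler_pM2l //.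
  by have /andP[_ ?] := pq 0%N; have /andP[_ ?] := pq 1%N; rewrite mulr_natl mulr2n lerD.
have C1le : `|C1| <= a0.
  apply: le_trans q3_small.
  have e1 : `|h * xi / 2| <= h * (L * (1 + P)) / 2.
    by rewrite !normrM normfV (gtr0_norm h0) (ger0_norm (ler0n R 2)) ler_pM2r ?invr_gt0 // ler_pM2l.
  have e2 : `|th * ((wp - wm) + D) / 4| <= L * (4 * h * q3) / 4.
    rewrite !normrM normfV (ger0_norm (ler0n R 4)) ler_pM2r ?invr_gt0 // ler_pM //.
    have -> : 4 * h * q3 = 2 * h * q3 + 2 * h * q3 by ring.
    by apply: le_trans (ler_normD _ _) (lerD _ _).
  have e3 : `|h * th' / 2| <= h * L / 2.
    by rewrite !normrM normfV (gtr0_norm h0) (ger0_norm (ler0n R 2)) ler_pM2r ?invr_gt0 // ler_pM2l.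
  have -> : h * (L * (1 + P / 2 + q3)) =
    h * (L * (1 + P)) / 2 + L * (4 * h * q3) / 4 + h * L / 2 by field.
  rewrite /C1 (le_trans (ler_normD _ _)) // lerD //.
  by rewrite (le_trans (ler_normD _ _)) // lerD.
have Ele : `|E| <= h ^+ 2 * (a0 * psi s).
  apply: le_trans (ler_wpM2l (exprn_ge0 _ (ltW h0)) (psi_quad s0)).
  have nD : `|D| = 2 * h * s.
    by rewrite DE normrM sg1 mulr1 ger0_norm.
  have e1 : `|(h * xi) * D / 2| <= h ^+ 2 * (L * (1 + P)) * s.
    have -> : h ^+ 2 * (L * (1 + P)) * s = (h * (L * (1 + P))) * (2 * h * s) / 2 by field.
    rewrite !normrM nD normfV (gtr0_norm h0) (ger0_norm (ler0n R 2)) ler_pM2r ?invr_gt0 //.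
    by rewrite ler_wpM2r // ler_pM2l.
  have e2 : `|th * D ^+ 2 / 4| <= h ^+ 2 * L * s ^+ 2.
    have -> : h ^+ 2 * L * s ^+ 2 = L * (2 * h * s) ^+ 2 / 4 by field.
    rewrite normrM normfV (ger0_norm (ler0n R 4)) ler_pM2r ?invr_gt0 //.
    by rewrite normrM normrX nD ler_wpM2r // exprn_ge0.
  have e3 : `|h ^+ 2 * xi'| <= h ^+ 2 * (L * (1 + P)).
    by rewrite normrM normrX (gtr0_norm h0) ler_pM2l // exprn_gt0.
  have e4 : `|h * th' * D / 2| <= h ^+ 2 * L * s.
    have -> : h ^+ 2 * L * s = (h * L) * (2 * h * s) / 2 by field.
    rewrite !normrM nD normfV (gtr0_norm h0) (ger0_norm (ler0n R 2)) ler_pM2r ?invr_gt0 //.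
    by rewrite ler_wpM2r // ler_pM2l.
  have -> : h ^+ 2 * (L * (s ^+ 2 + (2 + P) * s + (1 + P))) =
    h ^+ 2 * (L * (1 + P)) * s + h ^+ 2 * L * s ^+ 2 + h ^+ 2 * (L * (1 + P))
    + h ^+ 2 * L * s by ring.
  by do 3![apply: le_trans (ler_normD _ _) _; apply: lerD => //].
move: C1le; rewrite ler_norml => /andP[c1 c2].
have Am0 : 0 <= Am by apply: le_trans aAm; apply: ltW.
exists ((Am + C1) / h ^+ 2), ((Am - C1) / h ^+ 2), ((E - C1 * D) / h ^+ 2); split.
- by rewrite divr_ge0 ?exprn_ge0 ?(ltW h0) // -lerBlDl sub0r (le_trans _ c1) // lerN2.
- by rewrite divr_ge0 ?exprn_ge0 ?(ltW h0) // subr_ge0 (le_trans c2).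
- rewrite [X in 2 * tau * X](_ : _ = 2 * Am / h ^+ 2) ?(stencil_cfl gok) //; by field.
- have i1N : (0 < i.+1 < N)%N by nlia.
  have iiN : (0 < i < N)%N by nlia.
  rewrite {1}/diff1 (rI _ i1N) (rI _ iiN) /= -/wp -/wm -/w.
  have -> : F i.+1 = F i + (h * xi' + th' * ((wp - wm) / 2)) by rewrite -FE /F; ring.
  rewrite /C1 /E /Am.
  have -> : A i.+1 = A i + (h * xi + th * ((wp - wm) / 2)) by rewrite -AE /A; ring.
  by field.
- rewrite !modulusS /=.
  have -> : (E - C1 * D) / h ^+ 2 + sg * (((Am + C1) / h ^+ 2 - (Am - C1) / h ^+ 2) *
     ((modulus p k + h * p k + h * p k.+1 - modulus p k) / 2)) = E / h ^+ 2.
    by rewrite DE /s; field.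
  have -> : - (((Am + C1) / h ^+ 2 + (Am - C1) / h ^+ 2) *
   ((modulus p k + h * p k + h * p k.+1 + modulus p k
     - 2 * (modulus p k + h * p k)) / 2)) = Am * ((p k - p k.+1) / h) by field.
  rewrite normrM normfV (gtr0_norm (exprn_gt0 2 h0)) ler_pdivrMr ?exprn_gt0 //.
  apply: le_trans Ele _; rewrite mulrC ler_pM2r ?exprn_gt0 //.
  have ps0 : 0 <= psi s.
    rewrite -(pmulr_rge0 _ a00); apply: le_trans (psi_quad s0).
    by rewrite mulr_ge0 ?addr_ge0 ?exprn_ge0 // mulr_ge0 // addr_ge0.
  by rewrite ler_pM ?(ltW a00) // ler_pdivlMr // mulrC.
Qed.

Variable p : nat -> R.
Hypothesis p_ok : slopes_ok psi h q2 q3 (2 * P) p.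
Hypothesis grid_Z : forall n i, n%:R * tau <= T -> (i <= N)%N -> `|grid n i| <= Z.
Hypothesis grid_P : forall n i, n%:R * tau <= T -> (i < N)%N ->
  `|diff1 h (grid n) i| <= P.
Hypothesis u0_curv : forall i j, (j < i < N)%N ->
  `|diff1 h u0 i - diff1 h u0 j| <= q2 * ((i - j)%:R * h).

(** Doubling is applied to the slopes, which live on cells [0] to [N.-1] and whose oscillation is at
    most [2 * P]. *)
Lemma grid_diff1_lip n : n%:R * tau <= T -> forall i j, (j < i < N)%N ->
  `|diff1 h (grid n) i - diff1 h (grid n) j| <= modulus p (i - j).
Proof.
have N1 := N_gt1 gok.
elim: n => [|n IH] nT i j ijN.
  by apply: le_trans (u0_curv ijN) _; apply: (modulus_ge gok p_ok).
have nT' : n%:R * tau <= T.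
  by apply: le_trans nT; rewrite ler_wpM2r // ler_nat.
have tT : 0 <= n%:R * tau <= T by rewrite nT' mulr_ge0.
have /andP[ji iN] := ijN.
have kE : (i - j)%N = (i - j).-1.+1 by nlia.
have [osc|slope] := p_ok.2 (i - j).-1.
  rewrite -kE in osc; apply: le_trans osc.
  apply: le_trans (ler_normB _ _) _.
  have := grid_P nT iN; have := grid_P nT (ltn_trans ji iN); lra.
rewrite /= !diff1S.
have zZ m : (m <= N)%N -> `|grid n m| <= Z by exact: grid_Z.
have pP m : (m < N)%N -> `|diff1 h (grid n) m| <= P by exact: grid_P.
apply: (@doubling_step _ N.-1 tau (diff1 h (grid n)) (diff1 h (rate (n%:R * tau) (grid n))) (modulus p)) => //.
- by rewrite /slope_modulus big_ord0 mulr0.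
- by move=> i' j' ij'; apply: IH => //; nlia.
- by nlia.
- by move=> sg sg1; rewrite kE; apply: curvature_node => //; [exact: p_ok.1|exact: IH].
- move=> sg sg1; rewrite kE; apply: curvature_node => //; [exact: p_ok.1|exact: IH|].
  by apply: ltn_trans iN.
Qed.

Lemma grid_diff2_bound n i : n%:R * tau <= T -> (0 < i < N)%N ->
  `|diff2 h (grid n) i| <= q3.
Proof.
move=> nT /andP[i0 iN]; rewrite (diff2E gok) //.
have := grid_diff1_lip nT (i := i) (j := i.-1).
have -> : (i.-1 < i < N)%N by nlia.
have -> : (i - i.-1)%N = 1%N by nlia.
move=> /(_ isT); rewrite modulusS /slope_modulus big_ord0 mulr0 add0r => w1.
rewrite normrM normfV (gtr0_norm h0) ler_pdivrMr // (le_trans w1) // mulrC.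
by rewrite ler_pM2r //; have /andP[] := p_ok.1 0%N.
Qed.

End Curvature.

(** * Hölder bounds for the time differences *)

Section TimeDerivative.
Variables (R : realFieldType) (T l Z P a0 a1 b0 L : R).
Variables (a f : R -> R -> R -> R -> R) (br bl gr gl : R -> R -> R).
Hypothesis box : box_bounds T l Z P a0 a1 b0 L a f br bl gr gl.
Variables (N : nat) (h tau : R) (u0 : nat -> R).
Hypothesis gok : grid_ok l a0 a1 L N h tau.

Notation rate := (scheme_rate l a f br bl gr gl N h).
Notation grid := (scheme l a f br bl gr gl N h tau u0).
Notation node := (grid_node l h).
Notation modulus := (slope_modulus h).

Let h0 : 0 < h := h_gt0 gok.
Let tau0 : 0 < tau := tau_gt0 gok.
Let hn0 : h != 0 := lt0r_neq0 h0.
Let taun0 : tau != 0 := lt0r_neq0 tau0.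

Variables (q3 : R).
Hypothesis grid_Z : forall n i, n%:R * tau <= T -> (i <= N)%N -> `|grid n i| <= Z.
Hypothesis grid_P : forall n i, n%:R * tau <= T -> (i < N)%N ->
  `|diff1 h (grid n) i| <= P.
Hypothesis grid_q3 : forall n i, n%:R * tau <= T -> (0 < i < N)%N ->
  `|diff2 h (grid n) i| <= q3.

Definition velocity n := rate (n%:R * tau) (grid n).

Lemma gridS n i : grid n.+1 i = grid n i + tau * velocity n i.
Proof. by []. Qed.

Definition speed_bound := a1 * q3 + 2 * L + L * P.
(** Bounds both drift and source of the linear scheme for the velocity: the coefficients change in
    time at rate at most [L * (1 + speed_bound)] apart from their slope dependence, and this
    multiplies second differences in the interior and slopes at the ends. *)
Definition drift_bound := L * (1 + speed_bound) * (1 + P + q3).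

Lemma velocity_bound n i : n%:R * tau <= T -> (i <= N)%N ->
  `|velocity n i| <= speed_bound.
Proof.
move=> nT iN; have tT := tau_in gok nT.
have bL := box_L box; have bP := box_P box; have N1 := N_gt1 gok.
have zZ m : (m <= N)%N -> `|grid n m| <= Z by exact: grid_Z.
have pP m : (m < N)%N -> `|diff1 h (grid n) m| <= P by exact: grid_P.
have q30 : 0 <= q3.
  apply: le_trans (grid_q3 (i := 1) nT _); rewrite ?normr_ge0 //; nlia.
have a10 : 0 <= a1.
  have /andP[a01 a1a] := box_a box tT (node_in gok (leq0n _)) (zZ 0%N isT) (pP 0%N (ltnW N1)).
  by apply: le_trans a1a; apply: le_trans a01; apply: ltW (box_a0 box).
have aq : 0 <= a1 * q3 by apply: mulr_ge0.
rewrite /speed_bound; have [->|i0] := eqVneq i 0%N.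
  by apply: le_trans (rate_bdryl box gok tT zZ pP) _; lra.
have [->|iN'] := eqVneq i N.
  by apply: le_trans (rate_bdryr box gok tT zZ pP) _; lra.
rewrite /velocity /scheme_rate (negbTE i0) (negbTE iN').
have xin := node_in gok iN.
have iiN : (0 < i < N)%N by nlia.
have d0 : `|diff0 h (grid n) i| <= P by apply: (diff0_le gok).
have /andP[aA Aa] := box_a box tT xin (zZ _ iN) d0.
have fL := box_f box tT xin (zZ _ iN) d0.
have A0 : 0 <= a (n%:R * tau) (node i) (grid n i) (diff0 h (grid n) i).
  by apply: le_trans aA; apply: ltW (box_a0 box).
apply: le_trans (ler_normD _ _) _; rewrite normrM (ger0_norm A0) -addrA lerD //.
  by apply: ler_pM => //; exact: grid_q3.
by apply: le_trans fL _; have := mulr_ge0 bL bP; lra.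
Qed.


Lemma lip4_time F n i : lip4 L T l Z P F -> n.+1%:R * tau <= T -> (0 < i < N)%N ->
  exists xi th, [/\ `|xi| <= L * (1 + speed_bound), `|th| <= L &
    F (n.+1%:R * tau) (node i) (grid n.+1 i) (diff0 h (grid n.+1) i)
    - F (n%:R * tau) (node i) (grid n i) (diff0 h (grid n) i)
    = tau * (xi + th * diff0 h (velocity n) i)].
Proof.
move=> FL nT iiN; have /andP[i0 iN] := iiN.
have nT' : n%:R * tau <= T by apply: le_trans nT; rewrite ler_pM2r // ler_nat.
have tT := tau_in gok nT; have tT' := tau_in gok nT'.
have xin := node_in gok (ltnW iN).
have d0 m : m%:R * tau <= T -> `|diff0 h (grid m) i| <= P.
  by move=> mT; apply: (diff0_le gok) => // j jN; exact: grid_P.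
have := FL _ _ _ _ _ _ _ _ tT tT' xin xin (grid_Z nT (ltnW iN)) (grid_Z nT' (ltnW iN))
  (d0 _ nT) (d0 _ nT').
have -> : n.+1%:R * tau - n%:R * tau = tau by rewrite -natr1; ring.
rewrite subrr normr0 addr0 (gtr0_norm tau0).
have -> : grid n.+1 i - grid n i = tau * velocity n i by rewrite gridS; ring.
have -> : diff0 h (grid n.+1) i - diff0 h (grid n) i = tau * diff0 h (velocity n) i.
  by rewrite /diff0 !gridS; field.
rewrite normrM (gtr0_norm tau0) => /(lin_decomp (box_L box)).
have hw : 0 <= tau + tau * `|velocity n i|.
  by rewrite addr_ge0 ?mulr_ge0 ?(ltW tau0).
move=> /(_ hw) [xi [th [xiL thL ->]]]; exists (xi * (1 + `|velocity n i|)), th.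
split => //; last by ring.
rewrite normrM ler_pM // ger0_norm ?addr_ge0 // lerD2l.
by apply: velocity_bound => //; exact: ltnW.
Qed.

Lemma lip2_time F n i : lip2 L T Z F -> n.+1%:R * tau <= T -> (i <= N)%N ->
  `|F (n.+1%:R * tau) (grid n.+1 i) - F (n%:R * tau) (grid n i)|
  <= tau * (L * (1 + speed_bound)).
Proof.
move=> FL nT iN.
have nT' : n%:R * tau <= T by apply: le_trans nT; rewrite ler_pM2r // ler_nat.
have tT := tau_in gok nT; have tT' := tau_in gok nT'.
have := FL _ _ _ _ tT tT' (grid_Z nT iN) (grid_Z nT' iN).
have -> : n.+1%:R * tau - n%:R * tau = tau by rewrite -natr1; ring.
have -> : grid n.+1 i - grid n i = tau * velocity n i by rewrite gridS; ring.
rewrite (gtr0_norm tau0) normrM (gtr0_norm tau0) => /le_trans; apply.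
rewrite mulrCA ler_wpM2l ?(box_L box) // mulrDr mulr1 lerD2l ler_pM2l //.
exact: velocity_bound.
Qed.

Hypothesis small4 : h * drift_bound <= 2 * a0.

(** Discrete product rule: the new coefficient multiplies the second difference of the velocity, its
    increment multiplies the old second difference, which [q3] bounds. So the velocity solves a
    linear scheme with drift [c] and source [e]. *)
Lemma velocity_interior n i : n.+1%:R * tau <= T -> (0 < i < N)%N ->
  exists A c e, [/\ a0 <= A <= a1, `|c| <= drift_bound, `|e| <= drift_bound &
    velocity n.+1 i = velocity n i + tau *
     ((A / h ^+ 2 + c / (2 * h)) * (velocity n i.+1 - velocity n i)
      + (A / h ^+ 2 - c / (2 * h)) * (velocity n i.-1 - velocity n i) + e)].
Proof.
move=> nT iiN; have /andP[i0 iN] := iiN.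
have nT' : n%:R * tau <= T by apply: le_trans nT; rewrite ler_pM2r // ler_nat.
have tT := tau_in gok nT; have tT' := tau_in gok nT'.
have bL := box_L box; have bP := box_P box.
have xin := node_in gok (ltnW iN).
have [xi [th [xiL thL AE]]] := lip4_time (box_alip box) nT iiN.
have [xi' [th' [xiL' thL' FE]]] := lip4_time (box_flip box) nT iiN.
have d0 : `|diff0 h (grid n.+1) i| <= P.
  by apply: (diff0_le gok) => // j jN; exact: grid_P.
have Ab := box_a box tT xin (grid_Z nT (ltnW iN)) d0.
have d2 := grid_q3 nT' iiN.
set A := a _ _ _ _ in Ab AE.
have s0 : 0 <= speed_bound.
  by apply: le_trans (velocity_bound nT' (ltnW iN)).
have q30 : 0 <= q3 by apply: le_trans d2.
exists A, (th * diff2 h (grid n) i + th'), (xi * diff2 h (grid n) i + xi'); split=> //.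
- apply: (@le_trans _ _ (L * (q3 + 1))).
    rewrite mulrDr mulr1 (le_trans (ler_normD _ _)) // lerD // normrM.
    by apply: ler_pM.
  rewrite /drift_bound -mulrA ler_wpM2l //.
  by have := mulr_ge0 s0 q30; have := mulr_ge0 s0 bP; lra.
- apply: (@le_trans _ _ (L * (1 + speed_bound) * (q3 + 1))).
    rewrite mulrDr mulr1 (le_trans (ler_normD _ _)) // lerD // normrM.
    by apply: ler_pM.
  rewrite /drift_bound; apply: ler_wpM2l; last by lra.
  by apply: mulr_ge0 => //; apply: addr_ge0.
- have iE m : velocity m i = a (m%:R * tau) (node i) (grid m i) (diff0 h (grid m) i)
     * diff2 h (grid m) i + f (m%:R * tau) (node i) (grid m i) (diff0 h (grid m) i).
    by rewrite /velocity /scheme_rate; have [-> ->] : (i == 0%N) = false /\ (i == N) = false by nlia.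
  rewrite (iE n.+1) -/A.
  have dE : diff2 h (grid n.+1) i = diff2 h (grid n) i + tau * diff2 h (velocity n) i.
    by rewrite /diff2 !gridS; field.
  rewrite dE.
  have -> : A * (diff2 h (grid n) i + tau * diff2 h (velocity n) i) +
     f (n.+1%:R * tau) (node i) (grid n.+1 i) (diff0 h (grid n.+1) i) =
     velocity n i +
     (tau * (A * diff2 h (velocity n) i)
     + (tau * (xi + th * diff0 h (velocity n) i)) * diff2 h (grid n) i
     + tau * (xi' + th' * diff0 h (velocity n) i)).
    by rewrite (iE n) -AE -FE; ring.
  rewrite /diff0 /diff2; by field.
Qed.

Lemma velocity_bdryr n : n.+1%:R * tau <= T ->
  exists b e, [/\ b0 <= b <= L, `|e| <= drift_bound &
    velocity n.+1 N = velocity n N + tau *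
     (b / h * (velocity n N.-1 - velocity n N) + e)].
Proof.
move=> nT; have N1 := N_gt1 gok.
have nT' : n%:R * tau <= T by apply: le_trans nT; rewrite ler_pM2r // ler_nat.
have tT := tau_in gok nT.
have NN : (N.-1 < N)%N by nlia.
have vE m : velocity m N = gr (m%:R * tau) (grid m N)
    - br (m%:R * tau) (grid m N) * diff1 h (grid m) N.-1.
  rewrite /velocity /scheme_rate eqxx; by have -> : (N == 0%N) = false by nlia.
have bL := box_L box; have bP := box_P box.
have s0 : 0 <= speed_bound.
  by apply: le_trans (velocity_bound nT' (leqnn _)).
have q30 : 0 <= q3.
  apply: le_trans (grid_q3 (i := 1) nT' _); rewrite ?normr_ge0 //; nlia.
have gL := lip2_time (box_grlip box) nT (leqnn _).
have bL' := lip2_time (box_brlip box) nT (leqnn _).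
set b := br (n.+1%:R * tau) (grid n.+1 N) in bL' *.
exists b, ((gr (n.+1%:R * tau) (grid n.+1 N) - gr (n%:R * tau) (grid n N)
   - (b - br (n%:R * tau) (grid n N)) * diff1 h (grid n) N.-1) / tau); split.
- exact: (box_br box tT (grid_Z nT (leqnn _))).
- rewrite normrM normfV (gtr0_norm tau0) ler_pdivrMr //.
  apply: (@le_trans _ _ (tau * (L * (1 + speed_bound)) * (1 + P))).
    rewrite mulrDr mulr1 (le_trans (ler_normB _ _)) // lerD // normrM.
    by apply: ler_pM => //; exact: grid_P.
  rewrite /drift_bound mulrC mulrCA [X in _ <= X]mulrC ler_pM2l //.
  by rewrite mulrC; apply: ler_wpM2l; [apply: mulr_ge0 => //; apply: addr_ge0|lra].
- rewrite !vE -/b.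
  have -> : diff1 h (grid n.+1) N.-1 = diff1 h (grid n) N.-1
     + tau * ((velocity n N - velocity n N.-1) / h).
    rewrite /diff1 !gridS prednK; last by nlia.
    by field.
  by rewrite (vE n); field; rewrite hn0 taun0.
Qed.

Lemma velocity_bdryl n : n.+1%:R * tau <= T ->
  exists b e, [/\ b0 <= b <= L, `|e| <= drift_bound &
    velocity n.+1 0%N = velocity n 0%N + tau *
     (b / h * (velocity n 1%N - velocity n 0%N) + e)].
Proof.
move=> nT; have N1 := N_gt1 gok.
have nT' : n%:R * tau <= T by apply: le_trans nT; rewrite ler_pM2r // ler_nat.
have tT := tau_in gok nT.
have NN : (0 < N)%N by nlia.
have vE m : velocity m 0%N = gl (m%:R * tau) (grid m 0%N)
    + bl (m%:R * tau) (grid m 0%N) * diff1 h (grid m) 0%N by [].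
have bL := box_L box; have bP := box_P box.
have s0 : 0 <= speed_bound.
  by apply: le_trans (velocity_bound nT' (leqnn _)).
have q30 : 0 <= q3.
  apply: le_trans (grid_q3 (i := 1) nT' _); rewrite ?normr_ge0 //; nlia.
have gL := lip2_time (box_gllip box) nT (leq0n _).
have bL' := lip2_time (box_bllip box) nT (leq0n _).
set b := bl (n.+1%:R * tau) (grid n.+1 0%N) in bL' *.
exists b, ((gl (n.+1%:R * tau) (grid n.+1 0%N) - gl (n%:R * tau) (grid n 0%N)
   + (b - bl (n%:R * tau) (grid n 0%N)) * diff1 h (grid n) 0%N) / tau); split.
- exact: (box_bl box tT (grid_Z nT (leq0n _))).
- rewrite normrM normfV (gtr0_norm tau0) ler_pdivrMr //.
  apply: (@le_trans _ _ (tau * (L * (1 + speed_bound)) * (1 + P))).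
    rewrite mulrDr mulr1 (le_trans (ler_normD _ _)) // lerD // normrM.
    by apply: ler_pM => //; exact: grid_P.
  rewrite /drift_bound mulrC mulrCA [X in _ <= X]mulrC ler_pM2l //.
  by rewrite mulrC; apply: ler_wpM2l; [apply: mulr_ge0 => //; apply: addr_ge0|lra].
- rewrite !vE -/b.
  have -> : diff1 h (grid n.+1) 0 = diff1 h (grid n) 0
     + tau * ((velocity n 1%N - velocity n 0%N) / h).
    by rewrite /diff1 !gridS; field.
  by rewrite (vE n); field; rewrite hn0 taun0.
Qed.

Lemma drift_weights A c : a0 <= A -> `|c| <= drift_bound ->
  0 <= A / h ^+ 2 + c / (2 * h) /\ 0 <= A / h ^+ 2 - c / (2 * h).
Proof.
move=> aA cC.
have : `|c / (2 * h)| <= A / h ^+ 2.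
  rewrite normrM normfV (gtr0_norm (_ : 0 < 2 * h)) ?mulr_gt0 //.
  rewrite ler_pdivrMr ?mulr_gt0 // (le_trans cC) //.
  have -> : A / h ^+ 2 * (2 * h) = 2 * A / h by field.
  rewrite ler_pdivlMr // mulrC; apply: le_trans small4 _.
  by rewrite ler_pM2l.
by rewrite ler_norml => /andP[? ?]; split; lra.
Qed.

Lemma drift_cfl A c : A <= a1 ->
  2 * tau * (A / h ^+ 2 + c / (2 * h) + (A / h ^+ 2 - c / (2 * h))) <= 1.
Proof.
move=> Aa; rewrite [X in 2 * tau * X](_ : _ = 2 * A / h ^+ 2) ?(stencil_cfl gok) //.
by field.
Qed.

(** * Modulus of continuity of the velocity in space *)

Section SpaceHolder.
Variable H : nat -> R.
Hypotheses (H0 : H 0%N = 0) (H_nd : forall k, H k <= H k.+1).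
Hypothesis H_ok : forall k, (0 < k)%N -> 2 * speed_bound <= H k \/
   (drift_bound * (1 + (H k.+1 - H k.-1) / (2 * h))
     <= a0 * ((2 * H k - H k.+1 - H k.-1) / h ^+ 2)
   /\ drift_bound * h <= b0 * (H k - H k.-1)).
Hypothesis velocity0 : forall i j, (j < i <= N)%N ->
  `|velocity 0 i - velocity 0 j| <= H (i - j)%N.

Lemma velocity_node n i k sg : n.+1%:R * tau <= T -> (i <= N)%N -> (0 < k)%N ->
  `|sg| = 1 ->
  drift_bound * (1 + (H k.+1 - H k.-1) / (2 * h))
     <= a0 * ((2 * H k - H k.+1 - H k.-1) / h ^+ 2) ->
  drift_bound * h <= b0 * (H k - H k.-1) ->
  node_ok N tau (velocity n) (fun i => (velocity n.+1 i - velocity n i) / tau) H i k sg.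
Proof.
move=> nT iN k0 sg1 Hi Hb.
have bb0 := box_b0 box.
have Hk : 0 <= H k - H k.-1 by rewrite subr_ge0 -{2}(prednK k0).
have bdry b e : b0 <= b -> `|e| <= drift_bound -> `|e| <= b / h * (H k - H k.-1).
  move=> bb eC; apply: le_trans eC _; rewrite mulrAC ler_pdivlMr //.
  by apply: le_trans Hb _; rewrite ler_wpM2r.
have tauK X Y : ((X + tau * Y) - X) / tau = Y by field.
rewrite /node_ok; have [->|i0] := eqVneq i 0%N.
  have [b [e [/andP[bb bL] eC ->]]] := velocity_bdryl nT.
  have b00 : 0 <= b by apply: le_trans bb; apply: ltW.
  exists (b / h), 0, e; split => //.
  - by rewrite divr_ge0 // ltW.
  - by rewrite addr0 (bdry_cfl gok) ?b00.
  - by rewrite tauK mul0r addr0.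
  - by split=> //; apply: bdry.
have [->|iN'] := eqVneq i N.
  have [b [e [/andP[bb bL] eC ->]]] := velocity_bdryr nT.
  have b00 : 0 <= b by apply: le_trans bb; apply: ltW.
  exists 0, (b / h), e; split => //.
  - by rewrite divr_ge0 // ltW.
  - by rewrite add0r (bdry_cfl gok) ?b00.
  - by rewrite tauK mul0r add0r.
  - by split=> //; apply: bdry.
have iiN : (0 < i < N)%N by nlia.
have [A [c [e [/andP[aA Aa] cC eC ->]]]] := velocity_interior nT iiN.
have [ap am] := drift_weights aA cC.
exists (A / h ^+ 2 + c / (2 * h)), (A / h ^+ 2 - c / (2 * h)), e; split => //.
- exact: drift_cfl.
- have -> : - ((A / h ^+ 2 + c / (2 * h) + (A / h ^+ 2 - c / (2 * h))) *
    ((H k.+1 + H k.-1 - 2 * H k) / 2)) = A * ((2 * H k - H k.+1 - H k.-1) / h ^+ 2).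
    by field.
  have -> : e + sg * ((A / h ^+ 2 + c / (2 * h) - (A / h ^+ 2 - c / (2 * h))) *
       ((H k.+1 - H k.-1) / 2)) = e + sg * c * ((H k.+1 - H k.-1) / (2 * h)).
    by field.
  have dH : 0 <= (H k.+1 - H k.-1) / (2 * h).
    rewrite divr_ge0 ?mulr_ge0 ?(ltW h0) // subr_ge0.
    by apply: le_trans (H_nd k); rewrite -{2}(prednK k0).
  apply: (@le_trans _ _ (drift_bound * (1 + (H k.+1 - H k.-1) / (2 * h)))).
    rewrite (le_trans (ler_normD _ _)) // mulrDr mulr1 lerD // normrM.
    by rewrite (ger0_norm dH) ler_wpM2r // normrM sg1 mul1r.
  apply: le_trans (Hi) _; rewrite ler_wpM2r //.
  rewrite -(pmulr_rge0 _ (box_a0 box)); apply: le_trans Hi.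
  by rewrite mulr_ge0 ?addr_ge0 // (le_trans _ cC).
Qed.

Lemma velocity_holder n : n%:R * tau <= T -> forall i j, (j < i <= N)%N ->
  `|velocity n i - velocity n j| <= H (i - j)%N.
Proof.
elim: n => [|n IH] nT i j ijN; first exact: velocity0.
have nT' : n%:R * tau <= T by apply: le_trans nT; rewrite ler_pM2r // ler_nat.
have /andP[ji iN] := ijN.
have k0 : (0 < i - j)%N by rewrite subn_gt0.
have [osc|[Hi Hb]] := H_ok k0.
  apply: le_trans osc; apply: le_trans (ler_normB _ _) _.
  have := velocity_bound nT iN.
  by have := velocity_bound nT (ltnW (leq_trans ji iN)); lra.
have vE m : velocity n.+1 m = velocity n m + tau * ((velocity n.+1 m - velocity n m) / tau).
  by field.
rewrite (vE i) (vE j).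
(* Here the rate of the abstract scheme is the time difference quotient of the velocity itself. *)
apply: (@doubling_step _ N tau (velocity n)
  (fun i => (velocity n.+1 i - velocity n i) / tau) H) => //.
- exact: ltW.
- exact: IH.
- by move=> sg sg1; apply: velocity_node.
- by move=> sg sg1; apply: velocity_node => //; apply: ltnW; apply: leq_trans iN.
Qed.
End SpaceHolder.

(** * Modulus of continuity of the velocity in time, by a quadratic barrier *)

Section TimeHolder.
Variables (n0 i0 : nat) (Q S : R).
Hypotheses (Q_ge1 : 1 <= Q) (i0N : (i0 <= N)%N) (n0T : n0%:R * tau <= T).
Hypothesis start : forall i, (i <= N)%N ->
  `|velocity n0 i - velocity n0 i0| <= S + Q * (node i - node i0) ^+ 2.

(** The speed at which the parabola [(x - x0) ^ 2] must rise: [2 * a1] for diffusion,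
    [4 * l * drift_bound] for a drift at distance at most [2 * l], one [drift_bound] for the source
    and [2] for the boundary rows. *)
Definition barrier_speed := 2 * a1 + (4 * l + 1) * drift_bound + 2.

Lemma velocity_time m i : (n0 + m)%:R * tau <= T -> (i <= N)%N ->
  `|velocity (n0 + m) i - velocity n0 i0|
  <= S + Q * ((node i - node i0) ^+ 2 + barrier_speed * (m%:R * tau)).
Proof.
have N1 := N_gt1 gok; have l0 := box_l box.
elim: m i => [|m IH] i mT iN.
  by rewrite addn0 mul0r mulr0 addr0; exact: start.
have mT' : (n0 + m)%:R * tau <= T.
  by apply: le_trans mT; rewrite ler_pM2r // ler_nat leq_add2l.
rewrite addnS in mT.
pose B j := S + Q * ((node j - node i0) ^+ 2 + barrier_speed * (m%:R * tau)).
have Q0 : 0 <= Q by apply: le_trans Q_ge1.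
(* Common step for interior and end nodes. The alternatives with zero weight avoid reading the
   velocity outside the grid. *)
have key ap am e : 0 <= ap -> 0 <= am -> 2 * tau * (ap + am) <= 1 ->
    `|e| + (ap * (B i.+1 - B i) + am * (B i.-1 - B i)) <= Q * barrier_speed ->
    (ap = 0 \/ (i < N)%N) -> (am = 0 \/ (0 < i)%N) ->
    velocity (n0 + m).+1 i = velocity (n0 + m) i + tau *
      (ap * (velocity (n0 + m) i.+1 - velocity (n0 + m) i)
       + am * (velocity (n0 + m) i.-1 - velocity (n0 + m) i) + e) ->
    `|velocity (n0 + m).+1 i - velocity n0 i0| <=
      S + Q * ((node i - node i0) ^+ 2 + barrier_speed * (m.+1%:R * tau)).
  move=> ap0 am0 cfl eB iN' i0' ->.
  have bound sg : `|sg| = 1 -> sg * (velocity (n0 + m) i + tau *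
      (ap * (velocity (n0 + m) i.+1 - velocity (n0 + m) i)
       + am * (velocity (n0 + m) i.-1 - velocity (n0 + m) i) + e) - velocity n0 i0)
      <= S + Q * ((node i - node i0) ^+ 2 + barrier_speed * (m.+1%:R * tau)).
    move=> sg1.
    have vB j : (j <= N)%N -> sg * (velocity (n0 + m) j - velocity n0 i0) <= B j.
      move=> jN; apply: le_trans (ler_norm _) _; rewrite normrM sg1 mul1r.
      exact: IH.
    have vBi := vB i iN.
    have vBp : ap * (sg * (velocity (n0 + m) i.+1 - velocity n0 i0) - B i.+1) <= 0.
      case: iN' => [->|iN']; first by rewrite mul0r.
      by rewrite mulr_ge0_le0 // subr_le0 vB.
    have vBm : am * (sg * (velocity (n0 + m) i.-1 - velocity n0 i0) - B i.-1) <= 0.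
      case: i0' => [->|i0']; first by rewrite mul0r.
      by rewrite mulr_ge0_le0 // subr_le0 vB //; nlia.
    have vi0 : 0 <= (1 - tau * (ap + am)) *
       (B i - sg * (velocity (n0 + m) i - velocity n0 i0)).
      have tp : 0 <= tau * (ap + am) by rewrite mulr_ge0 ?addr_ge0 // ltW.
      by rewrite mulr_ge0 ?subr_ge0 //; lra.
    have := ler_wpM2l (ltW tau0) vBp; have := ler_wpM2l (ltW tau0) vBm.
    have := ler_wpM2l (ltW tau0) eB.
    have se : tau * (sg * e) <= tau * `|e|.
      rewrite ler_pM2l //; apply: le_trans (ler_norm _) _.
      by rewrite normrM sg1 mul1r.
    have -> : S + Q * ((node i - node i0) ^+ 2 + barrier_speed * (m.+1%:R * tau)) =
      B i + tau * (Q * barrier_speed).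
      by rewrite /B -natr1; ring.
    move: vi0 se; rewrite !mulr0; lra.
  rewrite ler_norml; have := bound 1 (normr1 _); have := bound (-1) (normrN1 _).
  by rewrite mul1r mulN1r lerNl => -> ->.
have hsq : (node i.+1 - node i0) ^+ 2 - (node i - node i0) ^+ 2 =
    h * (2 * (node i - node i0) + h).
  by rewrite /grid_node -natr1; ring.
have hsq' : (0 < i)%N -> (node i.-1 - node i0) ^+ 2 - (node i - node i0) ^+ 2 =
    h * (h - 2 * (node i - node i0)).
  by move=> ip; rewrite /grid_node -{2 3}(prednK ip) -natr1; ring.
have BE j : B j - B i = Q * ((node j - node i0) ^+ 2 - (node i - node i0) ^+ 2).
  by rewrite /B; ring.
rewrite addnS.
have bL := box_L box; have hL := cfl_drift gok.
have /andP[x1 x2] := node_in gok iN; have /andP[y1 y2] := node_in gok i0N.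
have a00 := box_a0 box.
have C0 : 0 <= drift_bound.
  have [b [e [_ eC _]]] := velocity_bdryr mT; exact: le_trans eC.
have lC : 0 <= l * drift_bound by rewrite mulr_ge0 // ltW.
have a10 : 0 <= a1.
  have iiN : (0 < 1 < N)%N by nlia.
  have [A [c [e [/andP[aA Aa] _ _ _]]]] := velocity_interior mT iiN; lra.
(* The inward neighbour is nearer to [x0] or at most one cell beyond it, so the parabola grows by at
   most [h * h] there and [h * L <= 2] bounds the effect. [Q_ge1] lets the source be charged to
   [Q]. *)
have bdry b e s : 0 <= b <= L -> `|e| <= drift_bound -> s <= h ->
    `|e| + b / h * (Q * (h * s)) <= Q * barrier_speed.
  move=> /andP[b00 bL'] eC sh.
  have -> : b / h * (Q * (h * s)) = Q * (b * s) by field.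
  have bs : b * s <= 2.
    apply: le_trans (ler_wpM2l b00 sh) _; apply: le_trans hL.
    by rewrite mulrC ler_pM2l.
  have eQ : `|e| <= Q * drift_bound.
    by apply: le_trans eC _; rewrite ler_peMl.
  apply: (@le_trans _ _ (Q * (drift_bound + 2))).
    by rewrite mulrDr lerD // ler_wpM2l.
  by rewrite ler_wpM2l // /barrier_speed; lra.
have [iE|i1] := eqVneq i 0%N.
  subst i.
  have [b [e [/andP[bb bL'] eC vE]]] := velocity_bdryl mT.
  have b00 : 0 <= b by apply: le_trans bb; apply: ltW (box_b0 box).
  apply: (key (b / h) 0 e) => //.
  - by rewrite divr_ge0 // ltW.
  - by rewrite addr0 (bdry_cfl gok) ?b00.
  - rewrite mul0r addr0 BE hsq; apply: bdry; rewrite ?b00 //.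
    by move: y1 x2; rewrite /grid_node mul0r addr0; lra.
  - by right; nlia.
  - by left.
  - by rewrite vE mul0r addr0.
have [iE|iN'] := eqVneq i N.
  have ip : (0 < i)%N by nlia.
  have [b [e [/andP[bb bL'] eC vE]]] := velocity_bdryr mT.
  have b00 : 0 <= b by apply: le_trans bb; apply: ltW (box_b0 box).
  apply: (key 0 (b / h) e) => //.
  - by rewrite divr_ge0 // ltW.
  - by rewrite add0r (bdry_cfl gok) ?b00.
  - rewrite mul0r add0r BE hsq' //; apply: bdry; rewrite ?b00 //.
    have : node N = l by rewrite /grid_node (Nh gok); ring.
    by move: y2; rewrite iE => ? ->; lra.
  - by left.
  - by right.
  - by rewrite iE vE mul0r add0r.
have iiN : (0 < i < N)%N by nlia.
have [A [c [e [/andP[aA Aa] cC eC vE]]]] := velocity_interior mT iiN.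
have [ap am] := drift_weights aA cC.
apply: key vE => //.
- exact: drift_cfl.
- rewrite !BE hsq hsq'; last by nlia.
  have -> : (A / h ^+ 2 + c / (2 * h)) * (Q * (h * (2 * (node i - node i0) + h)))
     + (A / h ^+ 2 - c / (2 * h)) * (Q * (h * (h - 2 * (node i - node i0)))) =
     Q * (2 * A + 2 * c * (node i - node i0)) by field.
  have cx : c * (node i - node i0) <= drift_bound * (2 * l).
    apply: le_trans (ler_norm _) _; rewrite normrM; apply: ler_pM => //.
    have -> : 2 * l = l - - l by ring.
    by apply: between_dist; apply/andP.
  have eQ : `|e| <= Q * drift_bound.
    by apply: le_trans eC _; rewrite ler_peMl.
  apply: (@le_trans _ _ (Q * (drift_bound + (2 * a1 + 4 * l * drift_bound)))).
    by rewrite [X in _ <= X]mulrDr lerD // ler_wpM2l //; lra.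
  by rewrite ler_wpM2l // /barrier_speed; lra.
- by right; nlia.
- by right; nlia.
Qed.
End TimeHolder.

End TimeDerivative.

(** * Comparison functions *)

(** Concavity of [ln]: its tangent inequality at [m = 1 + c * (s - 1)] is used at [s] with weight
    [c] and at [1] with weight [1 - c], and the linear terms cancel. The tangent point degenerates
    only for [c = 1], [s = 0]. *)
Lemma powR_bernoulli (R : realType) (s c : R) : 0 <= s -> 0 < c -> c <= 1 ->
  s `^ c <= 1 + c * (s - 1).
Proof.
move=> s0 c0 c1.
have m0 : 0 < 1 + c * (s - 1) \/ (c = 1 /\ s = 0).
  have [cE|cN] := eqVneq c 1.
    have [sE|sN] := eqVneq s 0; [by right|left].
    have : 0 < s by rewrite lt_def sN.
    by rewrite cE; lra.
  left; have : c < 1 by rewrite lt_def eq_sym cN.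
  have := mulr_ge0 (ltW c0) s0; lra.
case: m0 => [m0|[-> ->]]; last by rewrite powR0 ?oner_neq0 //; lra.
have [sE|sN] := eqVneq s 0.
  by rewrite sE powR0 ?gt_eqF //; lra.
have sp : 0 < s by rewrite lt_def sN.
set m := 1 + _ in m0 *.
have mp : m != 0 by rewrite gt_eqF.
rewrite -[leRHS]lnK ?posrE // -[leLHS]lnK ?posrE ?powR_gt0 // ler_expR.
rewrite ln_powR.
have ln_le (x : R) : 0 < x -> ln x <= x - 1.
  move=> x0; have x1 : -1 < x - 1 by lra.
  by have := le_ln1Dx x1; rewrite addrC subrK.
have h1 := ler_wpM2l (ltW c0) (ln_le (s / m) (divr_gt0 sp m0)).
have h2 : (1 - c) * ln (m^-1) <= (1 - c) * (m^-1 - 1).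
  by rewrite ler_wpM2l ?subr_ge0 // ln_le // invr_gt0.
rewrite lnM ?posrE ?invr_gt0 // in h1; rewrite !lnV ?posrE // in h1 h2.
have : c * (s / m - 1) + (1 - c) * (m^-1 - 1) = 0.
  rewrite /m; field; exact: mp.
lra.
Qed.

Lemma sqrt_1B (R : realType) (r : R) : 0 <= r <= 1 ->
  Num.sqrt (1 - r) <= 1 - r / 2 - r ^+ 2 / 8.
Proof.
move=> /andP[r0 r1].
have q0 : 0 <= 1 - r / 2 - r ^+ 2 / 8 by have : r ^+ 2 <= 1 := exprn_ile1 _ r0 r1; lra.
rewrite -(ler_sqr (sqrtr_ge0 _ : _ \in Num.nneg) (q0 : _ \in Num.nneg)).
rewrite sqr_sqrtr ?subr_ge0 //.
have -> : (1 - r / 2 - r ^+ 2 / 8) ^+ 2 = 1 - r + r ^+ 3 / 8 + r ^+ 4 / 64 by field.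
have := exprn_ge0 3 r0; have := exprn_ge0 4 r0; lra.
Qed.

(** The quadratic gain comes from the square root alone: [(1 - r) ^ al] is rewritten through
    [q = sqrt (1 - r)] with an exponent at most [1], to which the linear Bernoulli bound applies. *)
Lemma powR_1B (R : realType) (al r : R) : 0 < al -> al < 1 -> 0 <= r <= 1 ->
  (1 - r) `^ al <= 1 - al * r - (Num.min al (1 - al) / 4) * r ^+ 2.
Proof.
move=> al0 al1 r01; have /andP[r0 r1] := r01.
have sq := sqrt_1B r01.
have r20 := exprn_ge0 2 r0.
have y0 : 0 <= 1 - r by rewrite subr_ge0.
set q := Num.sqrt (1 - r) in sq.
have q0 : 0 <= q := sqrtr_ge0 _.
have yq : 1 - r = q ^+ 2 by rewrite sqr_sqrtr.
have [al2|al2] := leP (2 * al) 1.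
  have -> : (1 - r) `^ al = q `^ (2 * al).
    by rewrite yq -powR_mulrn // -powRrM.
  have := powR_bernoulli q0 (_ : 0 < 2 * al) al2; rewrite mulr_gt0 // => /(_ isT).
  have := ler_wpM2l (ltW al0) sq.
  have -> : Num.min al (1 - al) = al by apply/min_idPl; lra.
  lra.
have -> : Num.min al (1 - al) = 1 - al by apply/min_idPr; lra.
have [r1E|r1N] := eqVneq r 1.
  by rewrite r1E subrr powR0 ?gt_eqF //; lra.
have qp : 0 < q by rewrite sqrtr_gt0 subr_gt0 lt_def eq_sym r1N.
have qn0 : q != 0 by rewrite gt_eqF.
(* For [al > 1 / 2] the exponent [2 * al] exceeds [1], so Bernoulli is used on [q^-1] with exponent
   [2 * (1 - al)] instead. *)
have -> : (1 - r) `^ al = q ^+ 2 * (q^-1) `^ (2 * (1 - al)).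
  rewrite yq -[q^-1]powR_inv1 // -!powR_mulrn // -!powRrM -powRD ?qn0 ?implybT //.
  by congr (_ `^ _); ring.
have qi : 0 <= q^-1 by rewrite invr_ge0.
have b0 : 0 < 2 * (1 - al) by lra.
have b1 : 2 * (1 - al) <= 1 by lra.
have := ler_wpM2l (exprn_ge0 2 q0) (powR_bernoulli qi b0 b1).
have -> : q ^+ 2 * (1 + 2 * (1 - al) * (q^-1 - 1)) =
   (1 - 2 * (1 - al)) * (1 - r) + 2 * (1 - al) * q by rewrite yq; field.
move/le_trans; apply.
have := ler_wpM2l (ltW b0) sq; lra.
Qed.

Lemma powR_ge_id (R : realType) (al x : R) : 0 < al -> al <= 1 -> 0 <= x <= 1 ->
  x <= x `^ al.
Proof.
move=> al0 al1 /andP[x0 x1]; have [->|xN] := eqVneq x 0; first exact: powR_ge0.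
by apply: ger1_powR => //; rewrite lt_def xN x0.
Qed.

(** Converts Lipschitz bounds into Hölder bounds on a bounded range, by rescaling to the unit
    interval. *)
Lemma le_powR_bounded (R : realType) (e be d : R) : 0 < be -> be <= 1 -> 1 <= e ->
  0 <= d <= e -> d <= e * d `^ be.
Proof.
move=> be0 be1 e1 /andP[d0 de].
have ep : 0 < e by apply: lt_le_trans e1.
have d01 : 0 <= d / e <= 1 by rewrite divr_ge0 ?(ltW ep) //= ler_pdivrMr // mul1r.
rewrite -ler_pdivrMl // mulrC; apply: le_trans (powR_ge_id be0 be1 d01) _.
apply: ge0_ler_powR; rewrite ?nnegrE ?(ltW be0) //; first by have /andP[] := d01.
by rewrite ler_pdivrMr // ler_peMr.
Qed.

Section HolderModulus.
Variables (R : realType) (al : R).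
Hypotheses (al0 : 0 < al) (al1 : al < 1).

(* With [x = k h] and [r = 1 / k]: the discrete second difference of [x ^ al]
   is of order [- x ^ (al - 2) h ^ 2] and its first difference of order
   [x ^ (al - 1) h]. *)
Lemma powR_differences (h : R) (k : nat) : 0 < h -> (0 < k)%N ->
  let H k := (k%:R * h) `^ al in
  [/\ (H k.+1 - H k.-1) / (2 * h) <= H k / (k%:R * h),
      Num.min al (1 - al) / 4 * (H k / (k%:R * h) ^+ 2)
      <= (2 * H k - H k.+1 - H k.-1) / h ^+ 2 &
      al * (H k / (k%:R * h)) * h <= H k - H k.-1].
Proof.
move=> h0 k0 H.
have kp : (0 : R) < k%:R by rewrite ltr0n.
have kn : (k%:R : R) != 0 by rewrite gt_eqF.
have hn : h != 0 by rewrite gt_eqF.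
pose r : R := k%:R^-1.
have r01 : 0 <= r <= 1 by rewrite /r invr_ge0 ltW //= invf_le1 // ler1n.
have /andP[r0 r1] := r01.
have x0 : 0 <= k%:R * h by rewrite mulr_ge0 // ltW.
have Hp : H k.+1 = H k * (1 + r) `^ al.
  rewrite /H -powRM //; last lra.
  by congr (_ `^ _); rewrite /r -natr1; field.
have Hm : H k.-1 = H k * (1 - r) `^ al.
  rewrite /H -powRM //; last lra.
  congr (_ `^ _); rewrite /r -subn1 natrB //; by field.
have Hk : 0 <= H k by exact: powR_ge0.
have B1 : (1 + r) `^ al <= 1 + al * r.
  apply: le_trans (powR_bernoulli _ al0 (ltW al1)) _; [lra|].
  by rewrite addrAC subrr add0r.
have B2 := powR_1B al0 al1 r01.
have B3 : 1 - r <= (1 - r) `^ al by apply: powR_ge_id => //; [exact: ltW|lra].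
have c0 : 0 <= Num.min al (1 - al) / 4 * r ^+ 2.
  by rewrite mulr_ge0 ?exprn_ge0 // divr_ge0 // le_min (ltW al0) subr_ge0 ltW.
have ar : al * r <= r by rewrite ler_piMl // ltW.
split.
- have -> : H k / (k%:R * h) = (H k * (2 * r)) / (2 * h) by rewrite /r; field; rewrite kn hn.
  rewrite ler_pM2r ?invr_gt0 ?mulr_gt0 // Hp Hm -mulrBr ler_wpM2l //; lra.
- have -> : Num.min al (1 - al) / 4 * (H k / (k%:R * h) ^+ 2) =
    H k * (Num.min al (1 - al) / 4 * r ^+ 2) / h ^+ 2 by rewrite /r; field; rewrite kn hn.
  rewrite ler_pM2r ?invr_gt0 ?exprn_gt0 // Hp Hm.
  have -> : 2 * H k - H k * (1 + r) `^ al - H k * (1 - r) `^ al =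
     H k * (2 - (1 + r) `^ al - (1 - r) `^ al) by ring.
  by rewrite ler_wpM2l //; lra.
- have -> : al * (H k / (k%:R * h)) * h = H k * (al * r) by rewrite /r; field; rewrite kn hn.
  rewrite Hm -{2}[H k]mulr1 -mulrBr ler_wpM2l //; lra.
Qed.

(** At short distance the second difference, of order [x ^ (al - 2)], beats drift and source; at
    long distance a large factor [K] makes the modulus exceed the oscillation [V]. *)
Lemma holder_modulus (C a0 b0 V : R) : 0 <= C -> 0 < a0 -> 0 < b0 -> 0 <= V ->
  exists K0 : R, 1 <= K0 /\ forall K, K0 <= K -> forall (h : R) (k : nat), 0 < h -> (0 < k)%N ->
  let H k := K * (k%:R * h) `^ al in
  V <= H k \/
   (C * (1 + (H k.+1 - H k.-1) / (2 * h))
     <= a0 * ((2 * H k - H k.+1 - H k.-1) / h ^+ 2)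
   /\ C * h <= b0 * (H k - H k.-1)).
Proof.
move=> C0 a00 b00 V0.
set c := Num.min al (1 - al) / 4.
have c0 : 0 < c by rewrite divr_gt0 // lt_min al0 subr_gt0.
(* Up to distance [x0] diffusion wins: [2 * C * x0 <= a0 * c]. *)
pose x0 := Num.min 1 (a0 * c / (2 * C + 1)).
have C1 : 0 < 2 * C + 1 by lra.
have x00 : 0 < x0 by rewrite lt_min ltr01 divr_gt0 // mulr_gt0.
have x0C : 2 * C * x0 <= a0 * c.
  have : x0 <= a0 * c / (2 * C + 1) by rewrite ge_min lexx orbT.
  rewrite ler_pdivlMr // => h1; apply: le_trans h1.
  by rewrite mulrC ler_pM2l //; lra.
have X0 : 0 < x0 `^ al by rewrite powR_gt0.
(* The summands serve, in order, [K >= 1], the boundary inequality, and [V <= H k] beyond [x0]. *)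
exists (1 + C / (b0 * al) + V / x0 `^ al).
have t1 : 0 <= C / (b0 * al) by rewrite divr_ge0 // mulr_ge0 // ltW.
have t2 : 0 <= V / x0 `^ al by rewrite divr_ge0 // ltW.
split; first by lra.
move=> K KK h k h0 k0 H.
have K1 : 1 <= K by lra.
have xp : 0 < k%:R * h by rewrite mulr_gt0 // ltr0n.
have [xx|xx] := leP (k%:R * h) x0; last first.
  left; rewrite /H; apply: (@le_trans _ _ (K * x0 `^ al)).
    by rewrite -ler_pdivrMr //; lra.
  rewrite ler_wpM2l //; first lra.
  by apply: ge0_ler_powR; rewrite ?nnegrE ?ltW.
right.
have x1 : k%:R * h <= 1 by apply: le_trans xx _; rewrite ge_min lexx.
have [d1 d2 d3] := powR_differences h0 k0.
rewrite -/c in d2.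
set x := k%:R * h in xp xx x1 d1 d2 d3.
set X := x `^ al in d1 d2 d3.
have xX : x <= X by apply: powR_ge_id => //; [exact: ltW|rewrite ltW].
have xn : x != 0 by rewrite gt_eqF.
have Kp : 0 < K by lra.
split.
- have -> : (2 * H k - H k.+1 - H k.-1) / h ^+ 2 =
    K * ((2 * X - (k.+1%:R * h) `^ al - (k.-1%:R * h) `^ al) / h ^+ 2).
    by rewrite /H -/x -/X; field; rewrite gt_eqF.
  have -> : (H k.+1 - H k.-1) / (2 * h) =
    K * (((k.+1%:R * h) `^ al - (k.-1%:R * h) `^ al) / (2 * h)).
    by rewrite /H; field; rewrite gt_eqF.
  apply: (@le_trans _ _ (a0 * (K * (c * (X / x ^+ 2))))); last first.
    by rewrite ler_pM2l // ler_pM2l.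
  apply: (@le_trans _ _ (C * (1 + K * (X / x)))).
    by rewrite ler_wpM2l // lerD2l ler_pM2l.
  have -> : a0 * (K * (c * (X / x ^+ 2))) = (a0 * c) * K * X / x ^+ 2 by ring.
  rewrite ler_pdivlMr ?exprn_gt0 //.
  have -> : C * (1 + K * (X / x)) * x ^+ 2 = C * x * (x + K * X) by field.
  apply: (@le_trans _ _ (2 * C * x0 * (K * X))); last first.
    by rewrite -[leRHS]mulrA ler_wpM2r // mulr_ge0 ?ltW // powR_gt0.
  have -> : 2 * C * x0 * (K * X) = C * x0 * (K * X + K * X) by ring.
  have XK : X <= K * X by rewrite ler_peMl // powR_ge0.
  have x0' := ltW xp; have KX0 : 0 <= K * X by lra.
  apply: ler_pM; [exact: mulr_ge0|exact: addr_ge0|exact: ler_wpM2l|lra].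
- have -> : H k - H k.-1 = K * (X - (k.-1%:R * h) `^ al) by rewrite /H -/x -/X; ring.
  apply: (@le_trans _ _ (b0 * (K * (al * (X / x) * h)))); last first.
    by rewrite ler_pM2l // ler_pM2l.
  have -> : b0 * (K * (al * (X / x) * h)) = (b0 * al * K) * (X / x) * h by ring.
  rewrite ler_pM2r //.
  have bK : C <= b0 * al * K.
    rewrite mulrC -ler_pdivrMr ?mulr_gt0 //; lra.
  apply: le_trans bK _; rewrite ler_peMr //; last by rewrite ler_pdivlMr // mul1r.
  by apply: mulr_ge0; [apply: mulr_ge0|]; apply: ltW.
Qed.

End HolderModulus.

(* Explicit Euler for the slope equation [p' = - psi(p)]: the sum of the slopes
   is a Riemann sum of [rho / psi rho], whose integral [G] exceeds [osc]. *)
Lemma nagumo_slopes (R : realType) (q0 q1 Lp osc : R) (psi G : R -> R) :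
  0 <= q0 -> q0 < q1 -> 0 <= Lp -> 0 <= osc ->
  (forall x, q0 <= x <= q1 -> 1 <= psi x) ->
  (forall x y, q0 <= x <= q1 -> q0 <= y <= q1 ->
     `|psi x - psi y| <= Lp * `|x - y|) ->
  (forall x y c, q0 <= x -> x <= y -> y <= q1 ->
     (forall z, x <= z <= y -> z / psi z <= c) -> G y - G x <= (y - x) * c) ->
  osc < G q1 - G q0 ->
  exists2 h0 : R, 0 < h0 & forall h, 0 < h -> h <= h0 ->
    exists p, slopes_ok psi h q0 q1 osc p.
Proof.
move=> q00 q01 Lp0 osc0 psi1 psiL GI oscG.
set gap := G q1 - G q0 in oscG.
(* Half-open margin in the integral condition. Lowering the slopes at speed [psi + eta] absorbs the
   variation of [psi] over one step, at the price of a factor [1 + 2 * eta] that the gap can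
   afford. *)
pose eta := Num.min 1 ((gap - osc) / (2 * osc + 1)).
have o1 : 0 < 2 * osc + 1 by lra.
have eta0 : 0 < eta by rewrite lt_min ltr01 divr_gt0 // subr_gt0.
have etag : (1 + 2 * eta) * osc <= gap.
  have : eta <= (gap - osc) / (2 * osc + 1) by rewrite ge_min lexx orbT.
  rewrite ler_pdivlMr // => h1.
  by have := mulr_ge0 (ltW eta0) osc0; lra.
pose Pm := psi q0 + Lp * (q1 - q0) + 1.
have Pm1 : 1 <= Pm.
  have := psi1 q0; rewrite lexx ltW // => /(_ isT).
  by have : 0 <= Lp * (q1 - q0) by [rewrite mulr_ge0 // subr_ge0 ltW]; rewrite /Pm; lra.
have psiP x : q0 <= x <= q1 -> psi x + eta <= Pm.
  move=> /[dup] xq /andP[x0 x1].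
  have q0q : q0 <= q0 <= q1 by rewrite lexx ltW.
  have := le_trans (ler_norm _) (psiL _ _ xq q0q).
  have : `|x - q0| <= q1 - q0 by rewrite ger0_norm; lra.
  move/(ler_wpM2l Lp0).
  have : eta <= 1 by rewrite ge_min lexx.
  by rewrite /Pm; lra.
exists (eta / (Lp * Pm + 1)).
  by rewrite divr_gt0 // ltr_pwDr // mulr_ge0 //; lra.
move=> h h0; rewrite ler_pdivlMr; last by rewrite ltr_pwDr // mulr_ge0 //; lra.
move=> hs.
have hLP : Lp * (h * Pm) <= eta by lra.
(* Euler steps start at the largest slope [q1] and are cut off at [q0], so all slopes stay in the
   range where [psi] is controlled. *)
pose nxt x := Num.max q0 (x - h * (psi x + eta)).
pose p k := iter k nxt q1.
have pS k : p k.+1 = nxt (p k) by [].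
have pq k : q0 <= p k <= q1.
  elim: k => [|k /andP[IH0 IH1]]; first by rewrite /p /= lexx ltW.
  rewrite pS /nxt le_max lexx /= ge_max (ltW q01) /=.
  have := psi1 (p k); rewrite IH0 IH1 => /(_ isT) ps.
  by apply: le_trans IH1; rewrite gerBl mulr_ge0 ?ltW //; lra.
have sumS k : h * \sum_(m < k.+1) p m = h * \sum_(m < k) p m + h * p k.
  by rewrite big_ord_recr /= mulrDr.
have dp k : 0 <= p k - p k.+1 <= h * (psi (p k) + eta).
  have /andP[IH0 IH1] := pq k.
  have := psi1 (p k); rewrite IH0 IH1 => /(_ isT) ps.
  have hp : 0 <= h * (psi (p k) + eta) by rewrite mulr_ge0 ?ltW //; lra.
  rewrite pS /nxt; case: (leP q0) => ?; apply/andP; split; lra.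
have key k : G (p k) - G (p k.+1) <= (1 + 2 * eta) * (h * p k).
  have /andP[k0 k1] := pq k; have /andP[k0' k1'] := pq k.+1.
  have /andP[d0 d1] := dp k.
  have ps : 1 <= psi (p k) by apply: psi1; rewrite k0.
  apply: (@le_trans _ _ ((p k - p k.+1) * ((1 + 2 * eta) * p k / (psi (p k) + eta)))).
    apply: GI => //; first lra.
    move=> z /andP[z0 z1].
    have zq : q0 <= z <= q1 by rewrite (le_trans k0' z0) (le_trans z1 k1).
    have pz := psi1 _ zq.
    have pkq : q0 <= p k <= q1 by rewrite k0.
    have := le_trans (ler_norm _) (psiL _ _ pkq zq).
    have : `|p k - z| <= h * Pm.
      rewrite ger0_norm; last lra.
      have := ler_wpM2l (ltW h0) (psiP _ pkq); lra.
    move=> /(ler_wpM2l Lp0) zz psz.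
    have psz0 : 0 < psi z by exact: lt_le_trans pz.
    have psk0 : 0 < psi (p k) + eta by rewrite addr_gt0 // (lt_le_trans ltr01).
    rewrite ler_pdivrMr // mulrAC ler_pdivlMr //.
    have zp0 : 0 <= p k by exact: le_trans k0.
    have pe : psi (p k) + eta <= (1 + 2 * eta) * psi z.
      have := ler_wpM2l (ltW eta0) pz; lra.
    apply: (@le_trans _ _ (p k * (psi (p k) + eta))).
      by rewrite ler_wpM2r //; lra.
    have -> : (1 + 2 * eta) * p k * psi z = p k * ((1 + 2 * eta) * psi z) by ring.
    by rewrite ler_wpM2l.
  rewrite [leLHS]mulrA ler_pdivrMr; last lra.
  have -> : (1 + 2 * eta) * (h * p k) * (psi (p k) + eta) =
     h * (psi (p k) + eta) * ((1 + 2 * eta) * p k) by ring.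
  by rewrite ler_wpM2r // mulr_ge0 //; lra.
have inv k : osc <= h * \sum_(m < k) p m \/
    G q1 - G (p k) <= (1 + 2 * eta) * (h * \sum_(m < k) p m).
  elim: k => [|k [IH|IH]].
  - by right; rewrite big_ord0 /p /= subrr !mulr0.
  - left; rewrite sumS; apply: le_trans IH _; rewrite lerDl.
    by apply: mulr_ge0; [exact: ltW|have /andP[] := pq k; lra].
  - by right; rewrite sumS mulrDr; have := key k; lra.
exists p; split=> // k.
have hpk : 0 <= h * p k.
  by apply: mulr_ge0; [exact: ltW|have /andP[k0 _] := pq k; exact: le_trans k0].
have [A|B] := inv k; first by left; rewrite sumS; lra.
have /andP[k0 k1] := pq k.
have pkq : q0 <= p k <= q1 by rewrite k0.
(* A cut-off means that the whole range from [q1] to [q0] has been used, so the summed slopes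
   already exceed [osc]. *)
have := pS k; rewrite /nxt; case: (leP q0) => [untr pkS|trunc pkS]; last first.
  left; rewrite sumS.
  have := key k; rewrite pkS => kk.
  have e1 : 0 < 1 + 2 * eta by lra.
  rewrite -(ler_pM2l e1); apply: le_trans etag _; rewrite /gap; lra.
right; have /andP[d0 d1] := dp k.
have -> : p k - p k.+1 = h * (psi (p k) + eta) by rewrite pkS; ring.
rewrite ler_pM2l //.
have /andP[k0' k1'] := pq k.+1.
have mq : q0 <= (p k + p k.+1) / 2 <= q1 by exact: midpoint_between.
have := le_trans (ler_norm _) (psiL _ _ mq pkq).
have -> : (p k + p k.+1) / 2 - p k = - ((p k - p k.+1) / 2) by field.
rewrite normrN ger0_norm; last lra.
have : (p k - p k.+1) / 2 <= h * Pm.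
  have := ler_wpM2l (ltW h0) (psiP _ pkq); lra.
move=> /(ler_wpM2l Lp0); lra.
Qed.

(* For [x >= 1] the integrand [rho / (C (1 + rho ^ 2))] is at least the
   derivative of [ln x / (2 C)], so quadratic growth satisfies Nagumo's
   condition. *)
Lemma quadratic_slopes (R : realType) (q C osc : R) : 1 <= q -> 1 <= C -> 0 <= osc ->
  exists q' h0 : R, [/\ q < q', 0 < h0 & forall h, 0 < h -> h <= h0 ->
    exists p, slopes_ok (fun s => C * (1 + s ^+ 2)) h q q' osc p].
Proof.
move=> q1 C1 osc0.
pose G (x : R) : R := ln x / (2 * C).
have C0 : 0 < C by lra.
have q0 : 0 < q by lra.
(* With [q' = q * e] the increment of [G] is exactly [osc + 1]. *)
pose e := expR (2 * C * (osc + 1)).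
have e1 : 1 < e by rewrite expR_gt1 mulr_gt0 //; lra.
have qq : q < q * e by rewrite ltr_pMr.
have Gq : osc < G (q * e) - G q.
  rewrite /G lnM ?posrE ?expR_gt0 // expRK.
  have -> : (ln q + 2 * C * (osc + 1)) / (2 * C) - ln q / (2 * C) = osc + 1.
    by field; rewrite gt_eqF.
  by rewrite ltrDl.
exists (q * e).
have [||||h0 h00 hh] := @nagumo_slopes R q (q * e) (C * (2 * (q * e))) osc
    (fun s => C * (1 + s ^+ 2)) G (ltW q0) qq _ osc0 _ _ _ Gq.
- by rewrite !mulr_ge0 //; lra.
- move=> x _; rewrite -[leLHS]mulr1; apply: ler_pM => //.
  by rewrite lerDl sqr_ge0.
- move=> x y /andP[x0 x1] /andP[y0 y1].
  have -> : C * (1 + x ^+ 2) - C * (1 + y ^+ 2) = C * ((x + y) * (x - y)) by ring.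
  rewrite !normrM (gtr0_norm C0) -mulrA ler_pM2l // ler_wpM2r //.
  by rewrite ger0_norm; lra.
- move=> x y c x0 xy yq zc.
  have xp : 0 < x by lra.
  have x2 : 0 < 1 + x ^+ 2 by rewrite ltr_pwDl // sqr_ge0.
  apply: (@le_trans _ _ ((y - x) * (x / (C * (1 + x ^+ 2))))); last first.
    by rewrite ler_wpM2l ?subr_ge0 // zc // lexx.
  have ln_le : ln y - ln x <= (y - x) / x.
    have yx : 0 < y / x by rewrite divr_gt0 //; lra.
    have yx1 : -1 < y / x - 1 by lra.
    have := le_ln1Dx yx1; rewrite addrC subrK lnM ?posrE ?invr_gt0 //; last lra.
    rewrite lnV ?posrE // => /le_trans; apply.
    by rewrite mulrBl divff // gt_eqF.
  rewrite /G -mulrBl; apply: (@le_trans _ _ ((y - x) / x / (2 * C))).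
    by rewrite ler_pM2r // invr_gt0 mulr_gt0.
  rewrite -mulrA ler_wpM2l ?subr_ge0 // -invfM ler_pdivlMr ?mulr_gt0 //.
  rewrite mulrC ler_pdivrMr ?mulr_gt0 //.
  have -> : x * (x * (2 * C)) = C * (2 * x ^+ 2) by ring.
  rewrite ler_pM2l //.
  have x1 : 1 <= x by lra.
  have : 1 <= x ^+ 2 by rewrite exprn_ege1.
  lra.
by exists h0.
Qed.

(** * Derivatives relative to a box *)

Lemma is_derive_eps (R : realType) (f : R -> R) (x df : R) :
  (forall e, 0 < e -> exists2 d, 0 < d &
    forall y, `|y - x| < d -> `|f y - f x - df * (y - x)| <= e * `|y - x|) ->
  is_derive x (1 : R) f df.
Proof.
move=> fe.
have cq : h^-1 *: ((f \o shift x) (h *: (1 : R)) - f x) @[h --> (0:R)^'] --> df.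
  apply/cvgrPdist_le => e e0; have [d d0 fd] := fe e e0.
  near=> h.
  have h0 : h != 0 by near: h; exact: nbhs_dnbhs_neq.
  have hd : `|h| < d by near: h; exact: dnbhs0_lt.
  have := fd (h + x); rewrite addrK => /(_ hd).
  rewrite -ler_pdivrMr ?normr_gt0 // -normfV -normrM => fh.
  rewrite distrC; apply: le_trans fh; rewrite /= /GRing.scale /= mulr1.
  by rewrite le_eqVlt; apply/orP; left; apply/eqP; congr (`|_|); field.
apply: DeriveDef; first by apply/cvg_ex; exists df.
exact: cvg_lim.
Unshelve. all: by end_near. Qed.

(** Properness of the restricted filter is what makes [lim] equal to the limit found by convergence;
    it fails when no small increment stays in [D]. *)
Lemma deriv_within_eps (R : realType) (V : normedModType R) (D : set V) (v : V)
    (f : V -> R) (x : V) :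
  ProperFilter (within [set h | D (h *: v + x)] (0 : R)^') ->
  cvg (diff_within D v f x) ->
  forall e, 0 < e -> exists2 d, 0 < d & forall h, `|h| < d -> D (h *: v + x) ->
    `|f (h *: v + x) - f x - deriv_within D v f x * h| <= e * `|h|.
Proof.
move=> PF /cvg_ex[df dfE].
have -> : deriv_within D v f x = df by apply: cvg_lim.
move=> e e0; move/cvgrPdist_le : dfE => /(_ e e0).
rewrite near_withinE => /nbhs_ballP[d /= d0 dP].
exists d => // h hd Dh; have [->|h0] := eqVneq h 0.
  by rewrite scale0r add0r subrr mulr0 subrr normr0 mulr0.
have /dP : ball (0:R) d h by rewrite /ball /= sub0r normrN.
move=> /(_ h0 Dh); rewrite distrC.
rewrite -(ler_pM2r (_ : 0 < `|h|)) ?normr_gt0 // -normrM => fh.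
apply: le_trans fh; rewrite le_eqVlt; apply/orP; left; apply/eqP.
by congr (`|_|); field.
Qed.

(** Strictly inside a segment contained in [D] all small increments are admissible, so the relative
    derivative is the ordinary derivative along the line. *)
Lemma line_is_derive (R : realType) (V : normedModType R) (D : set V) (v y : V)
    (f : V -> R) (s1 s2 : R) :
  (forall s, s1 <= s <= s2 -> D (s *: v + y)) ->
  (forall x, D x -> cvg (diff_within D v f x)) ->
  forall s, s1 < s < s2 ->
  is_derive s (1 : R) (fun s => f (s *: v + y)) (deriv_within D v f (s *: v + y)).
Proof.
move=> Dl fd s /andP[s1s ss2].
have Ds : D (s *: v + y) by apply: Dl; rewrite !ltW.
pose r := Num.min (s - s1) (s2 - s).
have r0 : 0 < r by rewrite lt_min !subr_gt0 s1s.
have shE (h : R) : (h + s) *: v + y = h *: v + (s *: v + y).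
  by rewrite scalerDl addrA.
have near0 h : `|h| < r -> D (h *: v + (s *: v + y)).
  rewrite lt_min => /andP[h1 h2]; rewrite -shE; apply: Dl.
  by move: h1 h2; rewrite !ltr_norml => /andP[? ?] /andP[? ?]; apply/andP; split; lra.
have PF : ProperFilter (within [set h | D (h *: v + (s *: v + y))] (0 : R)^').
  apply: Build_ProperFilter_ex => A FA.
  have /nbhs_ballP[d /= d0 dP] :
    nbhs (0 : R) (fun h => h != 0 -> D (h *: v + (s *: v + y)) -> A h) := FA.
  pose h := Num.min d r / 2.
  have m0 : 0 < Num.min d r by rewrite lt_min d0.
  have h0 : 0 < h by rewrite divr_gt0.
  have hm : h < Num.min d r by rewrite /h; lra.
  exists h; apply: dP.
  - rewrite /ball /= sub0r normrN gtr0_norm //.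
    by apply: lt_le_trans hm _; rewrite ge_min lexx.
  - by rewrite gt_eqF.
  - apply: near0; rewrite gtr0_norm //; apply: lt_le_trans hm _.
    by rewrite ge_min lexx orbT.
apply: is_derive_eps => e e0.
have [d d0 dP] := deriv_within_eps PF (fd _ Ds) e0.
exists (Num.min d r); first by rewrite lt_min d0.
move=> s'; rewrite lt_min => /andP[/dP + /near0 D'] => /(_ D').
by rewrite -shE subrK.
Qed.

Lemma line_MVT (R : realType) (V : normedModType R) (D : set V) (v y : V)
    (f : V -> R) (s1 s2 : R) : s1 < s2 ->
  (forall s, s1 <= s <= s2 -> D (s *: v + y)) ->
  {within D, continuous f} -> (forall x, D x -> cvg (diff_within D v f x)) ->
  exists2 c, s1 < c < s2 & f (s2 *: v + y) - f (s1 *: v + y)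
    = deriv_within D v f (c *: v + y) * (s2 - s1).
Proof.
move=> s12 Dl fc fd.
have [||c cs ->] := @MVT R (fun s => f (s *: v + y))
   (fun s => deriv_within D v f (s *: v + y)) s1 s2 s12; last first.
- by exists c => //; move: cs; rewrite in_itv.
- apply/subspace_continuousP => s; rewrite /= in_itv /= => ss.
  have /subspace_continuousP/(_ _ (Dl s ss)) fcs := fc.
  move=> A /fcs; rewrite /nbhs /= /within /= => nA.
  have cl : s' *: v + y @[s' --> s] --> s *: v + y.
    by apply: cvgD; [apply: cvgZr_tmp; exact: cvg_id|exact: cvg_cst].
  have nA' : \forall s' \near s, D (s' *: v + y) -> A (f (s' *: v + y)) := cl _ nA.
  apply: filterS nA' => s' sA s'i; apply: sA; apply: Dl.
  by move: s'i; rewrite /= in_itv.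
- by move=> s; rewrite in_itv /=; exact: line_is_derive.
Qed.

Lemma continuous_bounded_on (R : realType) (T : topologicalType) (K : set T)
    (g : T -> R) : compact K -> {within K, continuous g} ->
  exists2 C : R, 0 <= C & forall x, K x -> `|g x| <= C.
Proof.
move=> Kc gc; have [K0|/set0P K0] := eqVneq K set0.
  by exists 0 => // x; rewrite K0.
have ngc : {within K, continuous (fun x => `|g x|)}.
  apply/subspace_continuousP => x Kx; apply: cvg_norm.
  by move/subspace_continuousP : gc; apply.
have [c cK cM] := compact_EVT_max K0 Kc ngc.
by exists `|g c| => // x Kx; apply: cM; rewrite inE.
Qed.

(** The derivative relative to [D] is bounded on the compact [K], and the mean value theorem applies
    on segments inside [K]. The constant is chosen before the segment, hence is uniform. *)
Lemma line_lipschitz (R : realType) (V : normedModType R) (D K : set V) (v : V)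
    (f : V -> R) : compact K -> K `<=` D -> {within D, continuous f} ->
  (forall x, D x -> cvg (diff_within D v f x)) ->
  {within D, continuous (deriv_within D v f)} ->
  exists2 C : R, 0 <= C & forall y lo hi s1 s2,
    (forall s, lo <= s <= hi -> K (s *: v + y)) ->
    lo <= s1 <= hi -> lo <= s2 <= hi ->
    `|f (s2 *: v + y) - f (s1 *: v + y)| <= C * `|s2 - s1|.
Proof.
move=> Kc KD fc fd dfc.
have [C C0 CP] := continuous_bounded_on Kc (continuous_subspaceW KD dfc).
exists C => // y lo hi; suff key s1 s2 : (forall s, lo <= s <= hi -> K (s *: v + y)) ->
    lo <= s1 <= hi -> lo <= s2 <= hi -> s1 < s2 ->
    `|f (s2 *: v + y) - f (s1 *: v + y)| <= C * `|s2 - s1|.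
  move=> s1 s2 Kl h1 h2; have [s12|s21|->] := ltgtP s1 s2.
  - exact: key.
  - by rewrite distrC [`|s2 - _|]distrC; exact: key.
  - by rewrite !subrr normr0 mulr0.
move=> Kl /andP[l1 h1] /andP[l2 h2] s12.
have [|c /andP[c1 c2] ->] := @line_MVT R V D v y f s1 s2 s12 _ fc fd.
  by move=> s /andP[? ?]; apply: KD; apply: Kl; apply/andP; split; lra.
rewrite normrM ler_wpM2r //; apply: CP; apply: Kl.
by apply/andP; split; lra.
Qed.

(** * Bounds and Lipschitz constants of the coefficients on compact boxes *)

Definition row4 (R : realType) (t x z p : R) : 'rV[R]_4 :=
  \row_(j < 4) nth 0 [:: t; x; z; p] j.

Definition row2 (R : realType) (t z : R) : 'rV[R]_2 :=
  \row_(j < 2) nth 0 [:: t; z] j.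

Lemma row4E (R : realType) (t x z p : R) :
  [/\ row4 t x z p 0 0 = t, row4 t x z p 0 1 = x, row4 t x z p 0 2%:R = z
    & row4 t x z p 0 3%:R = p].
Proof. by rewrite /row4 !mxE. Qed.

Lemma row2E (R : realType) (t z : R) : row2 t z 0 0 = t /\ row2 t z 0 1 = z.
Proof. by rewrite /row2 !mxE. Qed.

Lemma row4_line (R : realType) (t x z p : R) :
  [/\ row4 t x z p = t *: delta_mx 0 (0 : 'I_4) + row4 0 x z p,
      row4 t x z p = x *: delta_mx 0 (1 : 'I_4) + row4 t 0 z p,
      row4 t x z p = z *: delta_mx 0 (2%:R : 'I_4) + row4 t x 0 p &
      row4 t x z p = p *: delta_mx 0 (3%:R : 'I_4) + row4 t x z 0].
Proof.
split; apply/rowP => -[[|[|[|[|//]]]] j4]; rewrite !mxE //= ?mulr1 ?mulr0 ?addr0 ?add0r //.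
Qed.

Lemma row2_line (R : realType) (t z : R) :
  row2 t z = t *: delta_mx 0 (0 : 'I_2) + row2 0 z /\
  row2 t z = z *: delta_mx 0 (1 : 'I_2) + row2 t 0.
Proof.
split; apply/rowP => -[[|[|//]] j2]; rewrite !mxE //= ?mulr1 ?mulr0 ?addr0 ?add0r //.
Qed.


Definition box4 (R : realType) (T l Z P : R) : set 'rV[R]_4 :=
  [set v | [/\ 0 <= v 0 0 <= T, - l <= v 0 1 <= l, `|v 0 2%:R| <= Z
    & `|v 0 3%:R| <= P]].

Definition box2 (R : realType) (T Z : R) : set 'rV[R]_2 :=
  [set v | 0 <= v 0 0 <= T /\ `|v 0 1| <= Z].

Lemma box4_compact (R : realType) (T l Z P : R) : compact (box4 T l Z P).
Proof.
have -> : box4 T l Z P = [set v : 'rV[R]_4 | forall i : 'I_4,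
    (nth set0 [:: [set` `[0, T]]; [set` `[- l, l]]; [set` `[- Z, Z]]; [set` `[- P, P]]] i : set R) (v ord0 i)].
  apply/seteqP; split=> v.
    move=> [h0 h1 h2 h3] [[|[|[|[|//]]]] j4] /=; rewrite in_itv /=.
    - by have -> : v ord0 (Ordinal j4) = v 0 0 by congr (v _ _); apply/val_inj.
    - by have -> : v ord0 (Ordinal j4) = v 0 1 by congr (v _ _); apply/val_inj.
    - rewrite -ler_norml; by have -> : v ord0 (Ordinal j4) = v 0 2%:R by congr (v _ _); apply/val_inj.
    - rewrite -ler_norml; by have -> : v ord0 (Ordinal j4) = v 0 3%:R by congr (v _ _); apply/val_inj.
  move=> h; split.
  - by have := h 0; rewrite /= in_itv.
  - by have := h 1; rewrite /= in_itv.
  - by have := h 2%:R; rewrite /= in_itv /= -ler_norml.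
  - by have := h 3%:R; rewrite /= in_itv /= -ler_norml.
apply: (@rV_compact R 4 (fun i => nth set0 [:: [set` `[0, T]]; [set` `[- l, l]]; [set` `[- Z, Z]]; [set` `[- P, P]]] i)) => -[[|[|[|[|//]]]] j4] /=; exact: segment_compact.
Qed.

Lemma box2_compact (R : realType) (T Z : R) : compact (box2 T Z).
Proof.
have -> : box2 T Z = [set v : 'rV[R]_2 | forall i : 'I_2,
    (nth set0 [:: [set` `[0, T]]; [set` `[- Z, Z]]] i : set R) (v ord0 i)].
  apply/seteqP; split=> v.
    move=> [h0 h1] [[|[|//]] j2] /=; rewrite in_itv /=.
    - by have -> : v ord0 (Ordinal j2) = v 0 0 by congr (v _ _); apply/val_inj.
    - rewrite -ler_norml; by have -> : v ord0 (Ordinal j2) = v 0 1 by congr (v _ _); apply/val_inj.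
  move=> h; split.
  - by have := h 0; rewrite /= in_itv.
  - by have := h 1; rewrite /= in_itv /= -ler_norml.
apply: (@rV_compact R 2 (fun i => nth set0 [:: [set` `[0, T]]; [set` `[- Z, Z]]] i)) => -[[|[|//]] j2] /=; exact: segment_compact.
Qed.

Lemma le_sum5 (R : realDomainType) (a b c d e : R) :
  0 <= a -> 0 <= b -> 0 <= c -> 0 <= d -> 0 <= e ->
  let S := a + b + c + d + e in [/\ a <= S, b <= S, c <= S, d <= S & e <= S].
Proof. by move=> ? ? ? ? ? /=; split; lra. Qed.

(** The arguments are changed one at a time; each intermediate point stays in the box because the
    box is a product. *)
Lemma Ck_on4_lip4 (R : realType) (T l : R) (F : R -> R -> R -> R -> R) :
  Ck_on4 `[0, T] `[(- l), l] setT setT 2 F -> forall Z P,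
  exists L, [/\ 0 <= L, lip4 L T l Z P F &
    forall t x z p, 0 <= t <= T -> - l <= x <= l -> `|z| <= Z -> `|p| <= P ->
      `|F t x z p| <= L].
Proof.
rewrite /Ck_on4; set D := [set v : 'rV[R]_4 | _]; set f := fun v : 'rV[R]_4 => _.
move=> [fc fd] Z P.
have fE t x z p : f (row4 t x z p) = F t x z p.
  by rewrite /f; have [-> -> -> ->] := row4E t x z p.
have Kc := @box4_compact R T l Z P; set K := box4 _ _ _ _ in Kc.
have KD : K `<=` D by move=> v [h0 h1 h2 h3]; split; rewrite //= in_itv.
have KE t x z p : 0 <= t <= T -> - l <= x <= l -> `|z| <= Z -> `|p| <= P ->
    K (row4 t x z p).
  by move=> ? ? ? ?; rewrite /K /box4 /=; have [-> -> -> ->] := row4E t x z p.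
have [C0 C00 fC0] := continuous_bounded_on Kc (continuous_subspaceW KD fc).
have lip (i : 'I_4) := line_lipschitz Kc KD fc
  (fd _ (ex_intro2 _ _ i I erefl)).1 (fd _ (ex_intro2 _ _ i I erefl)).2.1.
have [L0 L00 lip0] := lip 0; have [L1 L10 lip1] := lip 1.
have [L2 L20 lip2] := lip 2%:R; have [L3 L30 lip3] := lip 3%:R.
have E0 t x z p := let: And4 h _ _ _ := row4_line t x z p in h.
have E1 t x z p := let: And4 _ h _ _ := row4_line t x z p in h.
have E2 t x z p := let: And4 _ _ h _ := row4_line t x z p in h.
have E3 t x z p := let: And4 _ _ _ h := row4_line t x z p in h.
have [] := le_sum5 C00 L00 L10 L20 L30; set S := _ + L3 => SC S0 S1 S2 S3.
exists S; split; first exact: le_trans SC.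
- move=> t t' x x' z z' p p' tT tT' xl xl' zZ zZ' pP pP'.
  have d0 : `|F t x z p - F t' x z p| <= L0 * `|t - t'|.
    have := lip0 (row4 0 x z p) 0 T t' t; rewrite -!E0 !fE; apply=> // s sT.
    by rewrite -E0; exact: KE.
  have d1 : `|F t' x z p - F t' x' z p| <= L1 * `|x - x'|.
    have := lip1 (row4 t' 0 z p) (- l) l x' x; rewrite -!E1 !fE; apply=> // s sT.
    by rewrite -E1; exact: KE.
  have d2 : `|F t' x' z p - F t' x' z' p| <= L2 * `|z - z'|.
    have := lip2 (row4 t' x' 0 p) (- Z) Z z' z; rewrite -!E2 !fE -!ler_norml; apply=> // s.
    by rewrite -ler_norml => sT; rewrite -E2; exact: KE.
  have d3 : `|F t' x' z' p - F t' x' z' p'| <= L3 * `|p - p'|.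
    have := lip3 (row4 t' x' z' 0) (- P) P p' p; rewrite -!E3 !fE -!ler_norml; apply=> // s.
    by rewrite -ler_norml => sT; rewrite -E3; exact: KE.
  have -> : F t x z p - F t' x' z' p' = (F t x z p - F t' x z p)
    + (F t' x z p - F t' x' z p) + (F t' x' z p - F t' x' z' p)
    + (F t' x' z' p - F t' x' z' p') by ring.
  have e (Li d : R) : 0 <= d -> Li <= S -> Li * d <= S * d by move=> *; rewrite ler_wpM2r.
  rewrite !mulrDr.
  apply: le_trans (ler_normD _ _) _; apply: lerD; last first.
    by apply: le_trans d3 _; exact: e.
  apply: le_trans (ler_normD _ _) _; apply: lerD; last first.
    by apply: le_trans d2 _; exact: e.
  apply: le_trans (ler_normD _ _) _; apply: lerD.
  - by apply: le_trans d0 _; exact: e.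
  - by apply: le_trans d1 _; exact: e.
- move=> t x z p tT xl zZ pP; apply: le_trans SC; rewrite -fE; apply: fC0; exact: KE.
Qed.

Lemma Ck_on2_lip2 (R : realType) (T : R) (F : R -> R -> R) :
  Ck_on2 `[0, T] setT 2 F -> forall Z,
  exists L, [/\ 0 <= L, lip2 L T Z F &
    forall t z, 0 <= t <= T -> `|z| <= Z -> `|F t z| <= L].
Proof.
rewrite /Ck_on2; set D := [set v : 'rV[R]_2 | _]; set f := fun v : 'rV[R]_2 => _.
move=> [fc fd] Z.
have fE t z : f (row2 t z) = F t z by rewrite /f; have [-> ->] := row2E t z.
have Kc := @box2_compact R T Z; set K := box2 _ _ in Kc.
have KD : K `<=` D by move=> v [h0 h1]; split; rewrite //= in_itv.
have KE t z : 0 <= t <= T -> `|z| <= Z -> K (row2 t z).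
  by move=> ? ?; rewrite /K /box2 /=; have [-> ->] := row2E t z.
have [C0 C00 fC0] := continuous_bounded_on Kc (continuous_subspaceW KD fc).
have lip (i : 'I_2) := line_lipschitz Kc KD fc
  (fd _ (ex_intro2 _ _ i I erefl)).1 (fd _ (ex_intro2 _ _ i I erefl)).2.1.
have [L0 L00 lip0] := lip 0; have [L1 L10 lip1] := lip 1.
have E0 t z := (row2_line t z).1; have E1 t z := (row2_line t z).2.
exists (C0 + L0 + L1); split; first by lra.
- move=> t t' z z' tT tT' zZ zZ'.
  have d0 : `|F t z - F t' z| <= L0 * `|t - t'|.
    have := lip0 (row2 0 z) 0 T t' t; rewrite -!E0 !fE; apply=> // s sT.
    by rewrite -E0; exact: KE.
  have d1 : `|F t' z - F t' z'| <= L1 * `|z - z'|.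
    have := lip1 (row2 t' 0) (- Z) Z z' z; rewrite -!E1 !fE -!ler_norml; apply=> // s.
    by rewrite -ler_norml => sT; rewrite -E1; exact: KE.
  have -> : F t z - F t' z' = (F t z - F t' z) + (F t' z - F t' z') by ring.
  have e (Li d : R) : 0 <= d -> Li <= C0 + L0 + L1 ->
    Li * d <= (C0 + L0 + L1) * d by move=> *; rewrite ler_wpM2r.
  rewrite !mulrDr; apply: le_trans (ler_normD _ _) _; apply: lerD.
  - by apply: le_trans d0 _; apply: e => //; lra.
  - by apply: le_trans d1 _; apply: e => //; lra.
- by move=> t z tT zZ; have := fC0 _ (KE _ _ tT zZ); rewrite fE; lra.
Qed.

Lemma Ck_on4_lower (R : realType) (T l : R) (F : R -> R -> R -> R -> R) :
  0 < T -> 0 < l -> Ck_on4 `[0, T] `[(- l), l] setT setT 2 F ->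
  (forall t x z p, 0 <= t <= T -> - l <= x <= l -> 0 < F t x z p) ->
  forall Z P, 0 <= Z -> 0 <= P -> exists2 m, 0 < m &
    forall t x z p, 0 <= t <= T -> - l <= x <= l -> `|z| <= Z -> `|p| <= P ->
      m <= F t x z p.
Proof.
move=> T0 l0; rewrite /Ck_on4; set D := [set v : 'rV[R]_4 | _]; set f := fun v : 'rV[R]_4 => _.
move=> [fc _] Fp Z P Z0 P0.
have fE t x z p : f (row4 t x z p) = F t x z p.
  by rewrite /f; have [-> -> -> ->] := row4E t x z p.
have Kc := @box4_compact R T l Z P; set K := box4 _ _ _ _ in Kc.
have KD : K `<=` D by move=> v [h0 h1 h2 h3]; split; rewrite //= in_itv.
have KE t x z p : 0 <= t <= T -> - l <= x <= l -> `|z| <= Z -> `|p| <= P ->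
    K (row4 t x z p).
  by move=> ? ? ? ?; rewrite /K /box4 /=; have [-> -> -> ->] := row4E t x z p.
have K0 : K !=set0.
  by exists (row4 0 0 0 0); apply: KE; rewrite ?normr0 ?lexx ?oppr_le0 ?(ltW T0) ?(ltW l0).
have [c cK cm] := compact_EVT_min K0 Kc (continuous_subspaceW KD fc).
exists (f c); last by move=> t x z p *; rewrite -fE; apply: cm; rewrite inE; apply: KE.
by move: cK; rewrite inE => -[h0 h1 _ _]; exact: Fp.
Qed.

Lemma Ck_on2_lower (R : realType) (T : R) (F : R -> R -> R) :
  0 < T -> Ck_on2 `[0, T] setT 2 F -> (forall t z, 0 <= t <= T -> 0 < F t z) ->
  forall Z, 0 <= Z -> exists2 m, 0 < m &
    forall t z, 0 <= t <= T -> `|z| <= Z -> m <= F t z.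
Proof.
move=> T0; rewrite /Ck_on2; set D := [set v : 'rV[R]_2 | _]; set f := fun v : 'rV[R]_2 => _.
move=> [fc _] Fp Z Z0.
have fE t z : f (row2 t z) = F t z by rewrite /f; have [-> ->] := row2E t z.
have Kc := @box2_compact R T Z; set K := box2 _ _ in Kc.
have KD : K `<=` D by move=> v [h0 h1]; split; rewrite //= in_itv.
have KE t z : 0 <= t <= T -> `|z| <= Z -> K (row2 t z).
  by move=> ? ?; rewrite /K /box2 /=; have [-> ->] := row2E t z.
have K0 : K !=set0.
  by exists (row2 0 0); apply: KE; rewrite ?normr0 ?lexx ?(ltW T0).
have [c cK cm] := compact_EVT_min K0 Kc (continuous_subspaceW KD fc).
exists (f c); last by move=> t z *; rewrite -fE; apply: cm; rewrite inE; apply: KE.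
by move: cK; rewrite inE => -[h0 _]; exact: Fp.
Qed.

Lemma lip4_quotient (R : realType) (L m T l Z P : R) (F G : R -> R -> R -> R -> R) :
  0 <= L -> 0 < m -> lip4 L T l Z P F -> lip4 L T l Z P G ->
  (forall t x z p, 0 <= t <= T -> - l <= x <= l -> `|z| <= Z -> `|p| <= P ->
      `|F t x z p| <= L /\ m <= G t x z p) ->
  lip4 (L / m + L ^+ 2 / m ^+ 2) T l Z P (fun t x z p => F t x z p / G t x z p).
Proof.
move=> L0 m0 FL GL b t t' x x' z z' p p' tT tT' xl xl' zZ zZ' pP pP'.
have [F1 G1] := b _ _ _ _ tT xl zZ pP; have [F2 G2] := b _ _ _ _ tT' xl' zZ' pP'.
have hF := FL _ _ _ _ _ _ _ _ tT tT' xl xl' zZ zZ' pP pP'.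
have hG := GL _ _ _ _ _ _ _ _ tT tT' xl xl' zZ zZ' pP pP'.
set d := _ + `|p - p'| in hF hG *.
set f1 := F t x z p in F1 hF *; set f2 := F t' x' z' p' in F2 hF *.
set g1 := G t x z p in G1 hG *; set g2 := G t' x' z' p' in G2 hG *.
have g10 : 0 < g1 by lra.
have g20 : 0 < g2 by lra.
have -> : f1 / g1 - f2 / g2 = (f1 - f2) / g1 - f2 * (g1 - g2) / (g1 * g2).
  by field; rewrite !gt_eqF.
have d0 : 0 <= L * d by apply: le_trans hF.
have im : g1^-1 <= m^-1 by rewrite lef_pV2 ?posrE.
have im2 : (g1 * g2)^-1 <= (m ^+ 2)^-1.
  rewrite lef_pV2 ?posrE ?exprn_gt0 ?mulr_gt0 // expr2.
  by apply: ler_pM => //; exact: ltW.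
rewrite [leRHS]mulrDl; apply: le_trans (ler_normB _ _) _; apply: lerD.
  rewrite normrM normfV (gtr0_norm g10) mulrAC.
  by apply: ler_pM => //; rewrite invr_ge0 ltW.
have -> : L ^+ 2 / m ^+ 2 * d = L * (L * d) / m ^+ 2 by ring.
rewrite normrM normfV (gtr0_norm (mulr_gt0 g10 g20)).
apply: ler_pM => //; first by rewrite invr_ge0 ltW // mulr_gt0.
by rewrite normrM; apply: ler_pM.
Qed.

Lemma lip4W (R : realType) (L L' T l Z P : R) F : L <= L' ->
  lip4 L T l Z P F -> lip4 L' T l Z P F.
Proof.
move=> LL FL t t' x x' z z' p p' h1 h2 h3 h4 h5 h6 h7 h8.
by apply: le_trans (FL _ _ _ _ _ _ _ _ h1 h2 h3 h4 h5 h6 h7 h8) _; rewrite ler_wpM2r // !addr_ge0.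
Qed.

Lemma lip2W (R : realType) (L L' T Z : R) F : L <= L' -> lip2 L T Z F -> lip2 L' T Z F.
Proof.
move=> LL FL t t' z z' h1 h2 h3 h4.
by apply: le_trans (FL _ _ _ _ h1 h2 h3 h4) _; rewrite ler_wpM2r // addr_ge0.
Qed.

Lemma box_bounds_exist (R : realType) (T l : R)
    (a f : R -> R -> R -> R -> R) (br bl gr gl : R -> R -> R) :
  0 < T -> 0 < l ->
  Ck_on4 `[0, T] `[(- l), l] setT setT 2 a ->
  Ck_on4 `[0, T] `[(- l), l] setT setT 2 f ->
  Ck_on2 `[0, T] setT 2 br -> Ck_on2 `[0, T] setT 2 bl ->
  Ck_on2 `[0, T] setT 2 gr -> Ck_on2 `[0, T] setT 2 gl ->
  (forall t x z p, 0 <= t <= T -> - l <= x <= l -> 0 < a t x z p) ->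
  (forall t z, 0 <= t <= T -> 0 < br t z /\ 0 < bl t z) ->
  forall Z P, 0 <= Z -> 0 <= P ->
  exists a0 a1 b0 L, box_bounds T l Z P a0 a1 b0 L a f br bl gr gl.
Proof.
move=> T0 l0 aC fC brC blC grC glC ap bp Z P Z0 P0.
have [La [La0 aL aB]] := Ck_on4_lip4 aC Z P.
have [Lf [Lf0 fL fB]] := Ck_on4_lip4 fC Z P.
have [Lr [Lr0 brL brB]] := Ck_on2_lip2 brC Z.
have [Ll [Ll0 blL blB]] := Ck_on2_lip2 blC Z.
have [Mr [Mr0 grL grB]] := Ck_on2_lip2 grC Z.
have [Ml [Ml0 glL glB]] := Ck_on2_lip2 glC Z.
have [m m0 am] := Ck_on4_lower T0 l0 aC ap Z0 P0.
have [br0 br00 brm] := Ck_on2_lower T0 brC (fun t z tT => (bp t z tT).1) Z0.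
have [bl0 bl00 blm] := Ck_on2_lower T0 blC (fun t z tT => (bp t z tT).2) Z0.
pose L1 := La + Lf.
have L10 : 0 <= L1 by exact: addr_ge0.
have aL1 : La <= L1 by rewrite lerDl.
have fL1 : Lf <= L1 by rewrite lerDr.
have := lip4_quotient L10 m0 (lip4W fL1 fL) (lip4W aL1 aL).
set Lq := L1 / m + _ => qL.
have Lq0 : 0 <= Lq.
  by rewrite addr_ge0 ?divr_ge0 ?exprn_ge0 // ltW.
have [] := le_sum5 (addr_ge0 L10 Lq0) Lr0 Ll0 Mr0 Ml0.
set S := _ + Ml => S1q Sr Sl Smr Sml.
have S1 : L1 <= S by apply: le_trans S1q; rewrite lerDl.
have Sq : Lq <= S by apply: le_trans S1q; rewrite lerDr.
exists m, La, (Num.min br0 bl0), S.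
split => //.
- by rewrite lt_min br00.
- exact: le_trans S1.
- move=> t x z p *; rewrite am //=; apply: le_trans (ler_norm _) _; exact: aB.
- by move=> t x z p tT xl zZ pP; exact: le_trans (fB _ _ _ _ tT xl zZ pP) (le_trans fL1 S1).
- move=> t z tT zZ; apply/andP; split.
    by rewrite (le_trans _ (brm _ _ tT zZ)) // ge_min lexx.
  exact: le_trans (le_trans (ler_norm _) (brB _ _ tT zZ)) Sr.
- move=> t z tT zZ; apply/andP; split.
    by rewrite (le_trans _ (blm _ _ tT zZ)) // ge_min lexx orbT.
  exact: le_trans (le_trans (ler_norm _) (blB _ _ tT zZ)) Sl.
- by move=> t z tT zZ; exact: le_trans (grB _ _ tT zZ) Smr.
- by move=> t z tT zZ; exact: le_trans (glB _ _ tT zZ) Sml.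
- exact: lip4W (le_trans aL1 S1) aL.
- exact: lip4W (le_trans fL1 S1) fL.
- apply: lip4W (qL _); first exact: Sq.
  move=> t x z p tT xl zZ pP; split; last exact: am.
  exact: le_trans (fB _ _ _ _ tT xl zZ pP) fL1.
- exact: lip2W Sr brL.
- exact: lip2W Sl blL.
- exact: lip2W Smr grL.
- exact: lip2W Sml glL.
Qed.

(** * The functions phi and psi *)

Section Primitive.
Variables (R : realType) (a : R) (f : R -> R).
Notation mu := (@lebesgue_measure R).
Hypotheses (fm : measurable_fun `[a, +oo[ f) (f0 : forall x, a <= x -> 0 <= f x).
Hypothesis fb : forall b, exists C, forall x, a <= x <= b -> f x <= C.

Definition primitive (x : R) : R := Rintegral mu `[a, x] f.

Lemma integrable_segment x : mu.-integrable `[a, x] (EFin \o f).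
Proof.
have [C CP] := fb x.
apply: measurable_bounded_integrable => //.
- rewrite /= lebesgue_measure_itv /=; case: ifP => // _.
  by rewrite -EFinB ltry.
- by apply: measurable_funS fm => // y; rewrite /= !in_itv /= andbT => /andP[].
- exists C; split; first exact: num_real.
  move=> M CM y; rewrite /= in_itv /= => yx.
  have /andP[ay _] := yx.
  by rewrite ger0_norm ?f0 // (le_trans (CP _ yx)) // ltW.
Qed.

Lemma primitive_base : primitive a = 0.
Proof. by rewrite /primitive set_itv1 Rintegral_set1. Qed.

Lemma primitive_increment x y : a <= x -> x <= y ->
  primitive y - primitive x = Rintegral mu `]x, y] f.
Proof.
by move=> ax xy; rewrite /primitive Rintegral_itvB ?bnd_simp //; exact: integrable_segment.
Qed.

Lemma primitive_bounds x y c C : a <= x -> x <= y ->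
  (forall z, x <= z <= y -> c <= f z <= C) ->
  (y - x) * c <= primitive y - primitive x <= (y - x) * C.
Proof.
move=> ax xy cC; rewrite primitive_increment //.
have I : mu.-integrable `]x, y] (EFin \o f).
  apply: integrableS (integrable_segment y) => //.
  by move=> z; rewrite /= !in_itv /= => /andP[xz ->]; rewrite (le_trans ax) // ltW.
have muE : fine (mu `]x, y]) = y - x.
  rewrite lebesgue_measure_itv /= lte_fin; move: (xy).
  by rewrite le_eqVlt => /predU1P[->|->//]; rewrite ltxx subrr.
have cst r : mu.-integrable `]x, y] (EFin \o cst r).
  apply: measurable_bounded_integrable => //.
  - by rewrite /= lebesgue_measure_itv /=; case: ifP => // _; rewrite -EFinB ltry.
  - exists `|r|; split; first exact: num_real.
    by move=> M rM z _; exact: ltW.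
apply/andP; split.
- rewrite -muE mulrC -Rintegral_cst //.
  apply: le_Rintegral => [//|||z]; [exact: cst|exact: I|].
  rewrite /= in_itv /= => /andP[xz zy]; have xzy : x <= z <= y by rewrite ltW.
  by have /andP[] := cC z xzy.
- rewrite -muE mulrC -Rintegral_cst //.
  apply: le_Rintegral => [//|||z]; [exact: I|exact: cst|].
  rewrite /= in_itv /= => /andP[xz zy]; have xzy : x <= z <= y by rewrite ltW.
  by have /andP[] := cC z xzy.
Qed.

(** Monotone convergence along [[a, a + n]]: an integral over the half-line above [m] is above [m]
    already on some bounded interval. *)
Lemma primitive_exceeds m : (m%:E < \int[mu]_(x in `[a, +oo[) (f x)%:E)%E ->
  exists2 b, a <= b & m < primitive b.
Proof.
move=> mI; pose F (n : nat) : set R := [set` `[a, a + n%:R]].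
have FE : \bigcup_n F n = `[a, +oo[%classic.
  apply/seteqP; split => x /=.
    by move=> [n _]; rewrite /F /= !in_itv /= andbT => /andP[].
  rewrite in_itv /= andbT => ax; exists (Num.truncn (x - a)).+1 => //.
  by rewrite /F /= in_itv /= ax -lerBlDl ltW // truncnS_gt.
have mF i : measurable (F i) by exact: measurable_itv.
have sub n : F n `<=` `[a, +oo[%classic by rewrite -FE; exact: bigcup_sup.
have nd : nondecreasing_seq F.
  move=> i j ij; rewrite subsetEset /F => x; rewrite /= !in_itv /= => /andP[-> xi].
  by rewrite (le_trans xi) // lerD2l ler_nat.
have cv : (\int[mu]_(x in F i) (f x)%:E)%E @[i --> \oo] -->
    (\int[mu]_(x in \bigcup_i F i) (f x)%:E)%E.
  apply: ge0_nondecreasing_set_cvg_integral => // [i|i x].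
    by apply/measurable_EFinP; exact: measurable_funS fm.
  by move=> /sub; rewrite /= in_itv /= andbT lee_fin; exact: f0.
rewrite FE in cv.
have [n mn] : exists n, (m%:E < \int[mu]_(x in F n) (f x)%:E)%E.
  have [n _ /(_ n (leqnn n)) mn] := cv _ (open_ereal_gt' mI).
  by exists n.
exists (a + n%:R); first by rewrite lerDl.
have I := integrable_segment (a + n%:R).
rewrite /primitive /Rintegral -lte_fin fineK //.
exact: integrable_fin_num.
Qed.
End Primitive.

(** [G] in [nagumo_slopes] is taken as the primitive of [rho / psi rho]. The strict inequality on
    the half-line yields a finite [q1], and [psi] is Lipschitz on [[q0, q1]] because it is of class
    C^1. *)
Lemma psi_slopes (R : realType) (psi : R -> R) (q0 osc : R) :
  Ck_on1 `[0, +oo[ 1 psi -> (forall r, 0 <= r -> 1 <= psi r) -> 0 <= q0 ->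
  0 <= osc ->
  (osc%:E < \int[@lebesgue_measure R]_(rho in `[q0, +oo[) (rho / psi rho)%:E)%E ->
  exists q1 h0 : R, [/\ q0 < q1, 0 < h0 & forall h, 0 < h -> h <= h0 ->
    exists p, slopes_ok psi h q0 q1 osc p].
Proof.
move=> [psic psid] psi1 q00 osc0 Iosc.
pose f (r : R) := r / psi r.
have psip x : q0 <= x -> 0 < psi x.
  by move=> qx; apply: (lt_le_trans ltr01); apply: psi1; lra.
have f0 x : q0 <= x -> 0 <= f x.
  by move=> qx; apply: divr_ge0; [lra|apply/ltW/psip].
have sub : `[q0, +oo[%classic `<=` (`[0, +oo[%classic : set R).
  by move=> x; rewrite /= !in_itv /= !andbT; lra.
have fm : measurable_fun `[q0, +oo[ f.
  apply: subspace_continuous_measurable_fun => //.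
  apply/subspace_continuousP => x; rewrite /= in_itv /= andbT => qx.
  apply: cvgM; first exact: cvg_within.
  apply: cvgV; first by rewrite gt_eqF ?psip.
  have /subspace_continuousP := continuous_subspaceW sub psic.
  by apply; rewrite /= in_itv /= andbT.
have fb b : exists C, forall x, q0 <= x <= b -> f x <= C.
  exists b => x /andP[qx xb]; apply: le_trans xb.
  rewrite ler_pdivrMr ?psip // ler_peMr ?psi1 //; lra.
have [q1 q01 q1I] := primitive_exceeds fm f0 fb Iosc.
have q01' : q0 < q1.
  rewrite lt_def q01 andbT; apply: contraTneq q1I => ->.
  by rewrite (primitive_base q0 f) -leNgt.
have [Lp Lp0 psiL] := @line_lipschitz R R^o `[0, +oo[ `[q0, q1] 1 psi
   (@segment_compact R q0 q1) (subset_trans (@subset_itvl _ _ (BLeft q0) (BRight q1) +oo%O isT) sub)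
   psic (psid _ erefl).1 (psid _ erefl).2.1.
have [||||h0 h00 hh] := @nagumo_slopes R q0 q1 Lp osc psi (primitive q0 f) q00 q01' Lp0 osc0.
- by move=> x /andP[qx _]; apply: psi1; lra.
- move=> x y xq yq; have := psiL 0 q0 q1 y x; rewrite !addr0 ![_ *: 1]mulr1; apply => //.
  by move=> s sq; rewrite addr0 [_ *: 1]mulr1 /= in_itv.
- move=> x y c qx xy _ zc.
  suff /andP[] : (y - x) * 0 <= primitive q0 f y - primitive q0 f x <= (y - x) * c by [].
  apply: primitive_bounds => // z xzy; rewrite zc // f0 //.
  by move: xzy => /andP[]; lra.
- by rewrite (primitive_base q0 f) subr0.
by exists q1, h0.
Qed.

(** * Spatially constant supersolutions built from [Phi] *)

Section Supersolution.
Variables (R : realType) (Phi : R -> R).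
Hypothesis Phi_nd : forall r s, 0 <= r -> r <= s -> Phi r <= Phi s.
Hypothesis Phi_gt0 : forall r, 0 <= r -> 0 < Phi r.
Hypothesis Phi_int :
  (\int[@lebesgue_measure R]_(r in `[0%R, +oo[) ((Phi r)^-1)%:E = +oo)%E.

Let iPhi (r : R) := (Phi r)^-1.

Let iPhi_measurable : measurable_fun (`[(0 : R), +oo[ : set R) iPhi.
Proof.
(* Clamping the argument at [0] makes the function monotone on the whole line, hence measurable. *)
have : measurable_fun (`[(0 : R), +oo[ : set R) (fun r : R => (Phi (Num.max 0 r))^-1); last first.
  apply: eq_measurable_fun.
  move=> r; rewrite inE /= in_itv /= andbT => r0.
  by rewrite /iPhi (max_idPr r0).
apply: nonincreasing_measurable => // r s rs.
have m0 (x : R) : 0 <= Num.max 0 x by rewrite le_max lexx.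
rewrite lef_pV2 ?posrE ?Phi_gt0 // Phi_nd // ge_max m0 /=.
by rewrite le_max rs orbT.
Qed.

Let iPhi_ge0 x : 0 <= x -> 0 <= iPhi x.
Proof. by move=> x0; rewrite invr_ge0 ltW ?Phi_gt0. Qed.

Let iPhi_le x y : 0 <= x -> x <= y -> iPhi y <= iPhi x.
Proof.
move=> x0 xy; rewrite lef_pV2 ?posrE ?Phi_gt0 ?Phi_nd //.
exact: le_trans xy.
Qed.

Let iPhi_bounded b : exists C, forall x, 0 <= x <= b -> iPhi x <= C.
Proof. by exists (iPhi 0) => x /andP[x0 _]; exact: iPhi_le. Qed.

Lemma int_inv0 : int_inv Phi 0 = 0.
Proof. exact: (primitive_base 0 iPhi). Qed.

Lemma int_inv_bounds x y : 0 <= x -> x <= y ->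
  (y - x) / Phi y <= int_inv Phi y - int_inv Phi x <= (y - x) / Phi x.
Proof.
move=> x0 xy.
apply: (primitive_bounds iPhi_measurable iPhi_ge0 iPhi_bounded) => // z /andP[xz zy].
by rewrite !iPhi_le //; exact: le_trans xz.
Qed.

Lemma int_inv_reflect x y : 0 <= x -> 0 <= y -> int_inv Phi x <= int_inv Phi y -> x <= y.
Proof.
move=> x0 y0 I; rewrite leNgt; apply/negP => yx.
have /andP[+ _] := int_inv_bounds y0 (ltW yx).
have : 0 < (x - y) / Phi x by rewrite divr_gt0 ?subr_gt0 ?Phi_gt0.
lra.
Qed.

(** Divergence of the integral of [1 / Phi] lets it exceed [ln xi]; the intermediate value theorem
    then provides a witness, so [xget] does not return its default. *)
Lemma phiP xi : 1 <= xi -> 0 <= phi Phi xi /\ int_inv Phi (phi Phi xi) = ln xi.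
Proof.
move=> xi1; have ln0 : 0 <= ln xi by rewrite ln_ge0.
suff ex : exists s, 0 <= s /\ int_inv Phi s = ln xi.
  exact: (xgetPex 0 (P := [set s | 0 <= s /\ int_inv Phi s = ln xi]) ex).
have [b b0 bI] : exists2 b, 0 <= b & ln xi < int_inv Phi b.
  apply: (primitive_exceeds iPhi_measurable iPhi_ge0 iPhi_bounded).
  by rewrite Phi_int ltry.
have [||s sb sI] := @IVT R (int_inv Phi) 0 b (ln xi) b0.
- apply/subspace_continuousP => x; rewrite /= in_itv /= => /andP[x0 xb].
  apply/cvgrPdist_le => e e0; rewrite near_withinE.
  have P0 := Phi_gt0 (lexx 0).
  have d0 : 0 < e * Phi 0 by rewrite mulr_gt0.
  near=> y => yb; move: yb; rewrite /= in_itv /= => /andP[y0 yb].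
  have xy : `|x - y| <= e * Phi 0 by near: y; exact: cvgr_dist_le.
  have key u v : 0 <= u -> u <= v -> `|int_inv Phi u - int_inv Phi v| <= `|u - v| / Phi 0.
    move=> u0 uv; rewrite [leLHS]distrC [`|u - v|]distrC.
    have /andP[i1 i2] := int_inv_bounds u0 uv.
    have uv0 : 0 <= v - u by rewrite subr_ge0.
    rewrite (ger0_norm uv0) ger0_norm; last first.
      by apply: le_trans i1; rewrite divr_ge0 // ltW // Phi_gt0 // (le_trans u0).
    by apply: le_trans i2 _; rewrite ler_wpM2l //; exact: iPhi_le.
  have : `|int_inv Phi x - int_inv Phi y| <= `|x - y| / Phi 0.
    by case: (leP x y) => [|/ltW] h; [exact: key|rewrite distrC [`|x - y|]distrC; exact: key].
  by move/le_trans; apply; rewrite ler_pdivrMr.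
- rewrite int_inv0; have m : 0 <= int_inv Phi b by exact: le_trans (ltW bI).
  by rewrite (min_idPl m) (max_idPr m) ln0 ltW.
- by exists s; split=> //; move: sb; rewrite in_itv /= => /andP[].
Unshelve. all: by end_near. Qed.

(** [S t = phi (exp (lam * t) * m)] solves [S' = lam * Phi(S)]. Since
    [S >= B / ((lam - 1) * Phi 0)], the constant [B] is at most [(lam - 1) * Phi(S) * S], so
    [lam * Phi(S)] dominates the reaction. The discrete inequality follows because [Phi] is smallest
    at the left end of the step. *)
Lemma supersolutions (T B N : R) : 0 < T -> 0 < B -> 0 <= N ->
  forall eps, 0 < eps -> exists S : R -> R,
  [/\ N <= S 0, forall t, 0 <= t <= T -> 0 <= S t <= Mbound Phi T B N + eps &
    forall t tau sg F, 0 <= t -> 0 <= tau -> t + tau <= T -> `|sg| = 1 ->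
      (forall z, z * F z <= Phi `|z| * `|z| + B) ->
      S t + tau * (sg * F (sg * S t)) <= S (t + tau)].
Proof.
move=> T0 B0 N0 eps eps0.
pose m (lam : R) := Num.max 1 (Num.max (phi_inv Phi (B / ((lam - 1) * Phi 0))) (phi_inv Phi N)).
have m1 lam : 1 <= m lam by rewrite le_max lexx.
have xi1 lam t : 1 < lam -> 0 <= t -> 1 <= expR (lam * t) * m lam.
  move=> l1 t0; rewrite -[leLHS]mulr1; apply: ler_pM => //.
  by rewrite -expR0 ler_expR mulr_ge0 //; lra.
pose E := [set phi Phi (expR (lam * T) * m lam) | lam in [set lam : R | 1 < lam]].
have Einf : has_inf E.
  split; first by exists (phi Phi (expR (2 * T) * m 2)); exists 2 => //=; lra.
  exists 0 => _ [lam /= l1 <-]; exact: (phiP (xi1 _ _ l1 (ltW T0))).1.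
(* [lam] almost realises the infimum that defines [Mbound]. *)
have [_ [lam /= l1 <-] lamE] := inf_adherent eps0 Einf.
pose S t := phi Phi (expR (lam * t) * m lam).
have Sp t : 0 <= t -> 0 <= S t /\ int_inv Phi (S t) = lam * t + ln (m lam).
  move=> t0; have [? ->] := phiP (xi1 _ _ l1 t0); split=> //.
  by rewrite lnM ?posrE ?expR_gt0 ?expRK // (lt_le_trans ltr01).
have ST : S T <= Mbound Phi T B N + eps := ltW lamE.
clearbody S; clear lamE Einf.
have Snd t s : 0 <= t -> t <= s -> S t <= S s.
  move=> t0 ts; have [St It] := Sp _ t0; have [Ss Is] := Sp _ (le_trans t0 ts).
  apply: int_inv_reflect => //; rewrite It Is lerD2r ler_wpM2l //.
  exact: le_trans ler01 (ltW l1).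
pose beta := B / ((lam - 1) * Phi 0).
have P0 := Phi_gt0 (lexx 0).
have l10 : 0 < lam - 1 by lra.
have beta0 : 0 < beta by rewrite divr_gt0 // mulr_gt0.
have low x : 0 <= x -> phi_inv Phi x <= m lam -> x <= S 0.
  move=> x0 xm; have [S0 I0] := Sp 0 (lexx _).
  apply: int_inv_reflect => //; rewrite I0 mulr0 add0r -[leLHS]expRK.
  by rewrite ler_ln ?posrE ?expR_gt0 // (lt_le_trans ltr01).
have NS : N <= S 0.
  apply: low => //; rewrite le_max; apply/orP; right.
  by rewrite le_max; apply/orP; right; exact: lexx.
have bS : beta <= S 0.
  apply: low; [exact: ltW|rewrite le_max; apply/orP; right].
  by rewrite le_max; apply/orP; left; exact: lexx.
exists S; split => //.
  move=> t /andP[t0 tT]; rewrite (Sp t t0).1 /=.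
  by apply: le_trans ST; exact: Snd.
move=> t tau sg F t0 tau0 ttT sg1 FB.
have [St It] := Sp _ t0; have [St' It'] := Sp _ (addr_ge0 t0 tau0).
have Sb : beta <= S t by apply: le_trans bS _; exact: Snd.
have Spos : 0 < S t by exact: lt_le_trans Sb.
have PS := Phi_gt0 St.
have FS : sg * F (sg * S t) <= lam * Phi (S t).
  have := FB (sg * S t); rewrite normrM sg1 mul1r (ger0_norm St) => FBS.
  rewrite -(ler_pM2l Spos); apply: (@le_trans _ _ (Phi (S t) * S t + B)).
    by apply: le_trans FBS; rewrite mulrA [S t * sg]mulrC.
  have : B <= (lam - 1) * Phi 0 * S t.
    by rewrite mulrC -ler_pdivrMr ?mulr_gt0.
  have : (lam - 1) * Phi 0 * S t <= (lam - 1) * Phi (S t) * S t.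
    by rewrite ler_pM2r // ler_pM2l // Phi_nd.
  lra.
have ttau : t <= t + tau by rewrite lerDl.
have /andP[_ i2] := int_inv_bounds St (Snd _ _ t0 ttau).
have := i2; rewrite It It' => {}i2.
have : lam * tau * Phi (S t) <= S (t + tau) - S t.
  rewrite -ler_pdivlMr //; apply: le_trans i2.
  by rewrite le_eqVlt; apply/orP; left; apply/eqP; ring.
have := ler_wpM2l tau0 FS; lra.
Qed.

End Supersolution.

(** * The initial datum on the grid *)

Lemma is_derive_quadratic (R : realType) (x c1 c2 s : R) :
  is_derive s (1 : R) (fun s => c1 * (s - x) + c2 * (s - x) ^+ 2)
    (c1 + 2 * c2 * (s - x)).
Proof.
apply: is_derive_eps => e e0; have c20 : 0 < `|c2| + 1 by rewrite ltr_pwDr.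
exists (e / (`|c2| + 1)); first by rewrite divr_gt0.
move=> y ye.
have -> : c1 * (y - x) + c2 * (y - x) ^+ 2 - (c1 * (s - x) + c2 * (s - x) ^+ 2) -
   (c1 + 2 * c2 * (s - x)) * (y - s) = (c2 * (y - s)) * (y - s) by ring.
rewrite normrM ler_wpM2r // normrM.
rewrite ltr_pdivlMr // in ye; apply: le_trans (ltW ye); rewrite mulrC ler_wpM2l //.
by rewrite lerDl.
Qed.

(** Mean value theorem for [f] minus a quadratic; no second derivative of [f] is mentioned, only a
    first-order estimate of [f'] about [x]. The points [x] and [y] may come in either order. *)
Lemma taylor_remainder (R : realType) (f f' : R -> R) (x y c C : R) : x != y ->
  (forall s, Num.min x y < s < Num.max x y -> is_derive s (1 : R) f (f' s)) ->
  {within `[Num.min x y, Num.max x y], continuous f} ->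
  (forall s, Num.min x y < s < Num.max x y ->
    `|f' s - f' x - c * (s - x)| <= C) ->
  `|f y - f x - f' x * (y - x) - c / 2 * (y - x) ^+ 2| <= C * `|y - x|.
Proof.
move=> xy fd fc fC.
set m := Num.min x y in fd fc fC; set M := Num.max x y in fd fc fC.
have mM : m < M by rewrite /m /M; case: (ltgtP x y) xy.
pose q s := f' x * (s - x) + c / 2 * (s - x) ^+ 2.
have qd s : is_derive s (1 : R) q (f' x + 2 * (c / 2) * (s - x)).
  exact: is_derive_quadratic.
have [||z zm E] := @MVT R (f - q) (fun s => f' s - (f' x + 2 * (c / 2) * (s - x))) m M mM.
- by move=> s; rewrite in_itv /= => sm; apply: is_deriveB; exact: fd.
- apply/subspace_continuousP => s sm; apply: cvgB.
    by move/subspace_continuousP : fc; apply.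
  have : {within `[m, M], continuous q}.
    by apply: derivable_within_continuous => t _; case: (qd t).
  by move/subspace_continuousP; apply.
have {}E : (f y - q y) - (f x - q x) = (f' z - f' x - c * (z - x)) * (y - x).
  have cE : f' z - f' x - c * (z - x) = f' z - (f' x + 2 * (c / 2) * (z - x)) by field.
  rewrite cE; move: E; rewrite /m /M; case: (ltgtP x y) xy => // _ _; rewrite /= !fctE => E.
  have -> : f y - q y - (f x - q x) = - (f x - q x - (f y - q y)) by ring.
  by rewrite E; ring.
have -> : f y - f x - f' x * (y - x) - c / 2 * (y - x) ^+ 2 = (f y - q y) - (f x - q x).
  by rewrite /q; ring.
rewrite E normrM ler_wpM2r //; apply: fC.
by move: zm; rewrite in_itv.
Qed.

Section InitialDatum.
Variables (R : realType) (l alpha : R) (u0 : R -> R).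
Hypotheses (l0 : 0 < l) (al0 : 0 < alpha) (al1 : alpha < 1).
Hypothesis u0C : C2alpha `[(- l), l] alpha u0.

Let D : set R := `[(- l), l].
Let p := derivI D u0.
Let r := derivI D p.

Let lineE (s : R) : s *: (1 : R^o) + 0 = s.
Proof. by rewrite addr0 [_ *: _]mulr1. Qed.

Let u0c : {within D, continuous u0}. Proof. by case: u0C => -[]. Qed.

Let u0d : forall x, D x -> cvg (@diff_within R R^o D 1 u0 x).
Proof. by case: u0C => -[_ h] _; have [] := h 1 erefl. Qed.

Let pc : {within D, continuous p}.
Proof. by case: u0C => -[_ h] _; have [_ []] := h 1 erefl. Qed.

Let pd : forall x, D x -> cvg (@diff_within R R^o D 1 p x).
Proof. by case: u0C => -[_ h] _; have [_ [_ h']] := h 1 erefl; have [] := h' 1 erefl. Qed.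

Let rc : {within D, continuous r}.
Proof. by case: u0C => -[_ h] _; have [_ [_ h']] := h 1 erefl; have [_ []] := h' 1 erefl. Qed.

Let mvt (f : R -> R) x y : {within D, continuous f} ->
  (forall x, D x -> cvg (@diff_within R R^o D 1 f x)) ->
  - l <= x -> x < y -> y <= l ->
  exists2 c, x < c < y & f y - f x = derivI D f c * (y - x).
Proof.
move=> fc fd lx xy yl.
have [|c cxy] := @line_MVT R R^o D 1 0 f x y xy _ fc fd.
  by move=> s /andP[xs sy]; rewrite lineE /D /= in_itv /=; apply/andP; split; lra.
by rewrite !lineE; exists c.
Qed.

Let derive_in (f : R -> R) s : (forall x, D x -> cvg (@diff_within R R^o D 1 f x)) ->
  - l < s < l -> is_derive s (1 : R) f (derivI D f s).
Proof.
move=> fd sl.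
have := @line_is_derive R R^o D 1 0 f (- l) l _ fd s sl; rewrite lineE.
have -> : (fun s : R => f (s *: (1 : R^o) + 0)) = f by apply/funext => t; rewrite lineE.
by apply => t tl; rewrite lineE /D /= in_itv.
Qed.

Let lip (f : R -> R) C x y : {within D, continuous f} ->
  (forall x, D x -> cvg (@diff_within R R^o D 1 f x)) ->
  (forall x, - l <= x <= l -> `|derivI D f x| <= C) ->
  - l <= x <= l -> - l <= y <= l -> `|f x - f y| <= C * `|x - y|.
Proof.
move=> fc fd fC; wlog xy : x y / x < y.
  move=> H xl yl; have [xy|yx|->] := ltgtP x y.
  - exact: H.
  - by rewrite distrC [`|x - y|]distrC; exact: H.
  - by rewrite !subrr !normr0 mulr0.
move=> /andP[x1 x2] /andP[y1 y2]; rewrite distrC [`|x - y|]distrC.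
have [c /andP[c1 c2] ->] := mvt fc fd x1 xy y2.
by rewrite normrM ler_wpM2r //; apply: fC; apply/andP; split; lra.
Qed.

Lemma datum_bounds : exists Z P Cr Hc : R,
  [/\ [/\ 0 <= Z, 0 <= P, 0 <= Cr & 0 <= Hc],
      forall x, - l <= x <= l -> [/\ `|u0 x| <= Z, `|p x| <= P & `|r x| <= Cr] &
      forall x y, - l <= x <= l -> - l <= y <= l ->
        `|r x - r y| <= Hc * `|x - y| `^ alpha].
Proof.
have Dc : compact D by exact: segment_compact.
have [Z Z0 ZP] := continuous_bounded_on Dc u0c.
have [P P0 PP] := continuous_bounded_on Dc pc.
have [C C0 CP] := continuous_bounded_on Dc rc.
have DE x : - l <= x <= l -> D x by rewrite /D /= in_itv.
case: u0C => _; rewrite -/D -/p -/r.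
set S := holder_semi _ _ _ => Sy.
(* One pair of points shows that the supremum is nonnegative; with [Sy] it is finite, so [fine S] is
   meaningful. *)
have S0 : (0 <= S)%E.
  apply: (@le_trans _ _ (`|r l - r (- l)| / `|l - - l| `^ alpha)%:E).
    by rewrite lee_fin divr_ge0 // powR_ge0.
  apply: ereal_sup_ubound; exists (l, - l) => //=; split => //=.
  - by rewrite /D /= in_itv /=; apply/andP; split; have := l0; lra.
  - by rewrite /D /= in_itv /=; apply/andP; split; have := l0; lra.
  - by rewrite -subr_eq0 gt_eqF //; have := l0; lra.
have Sfin : S \is a fin_num by rewrite ge0_fin_numE.
exists Z, P, C, (fine S); split; first by split=> //; exact: fine_ge0.
  by move=> x /DE xD; split; [exact: ZP|exact: PP|exact: CP].
move=> x y xl yl; have [->|xy] := eqVneq x y.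
  by rewrite !subrr !normr0 mulr_ge0 ?fine_ge0 // powR_ge0.
rewrite -ler_pdivrMr ?powR_gt0 ?normr_gt0 ?subr_eq0 //.
rewrite -lee_fin fineK //; apply: ereal_sup_ubound.
by exists (x, y) => //; split => //=; exact: DE.
Qed.

Section Constants.
Variables (Z P Cr Hc : R).
Hypotheses (Z0 : 0 <= Z) (P0 : 0 <= P) (Cr0 : 0 <= Cr) (Hc0 : 0 <= Hc).
Hypothesis bd : forall x, - l <= x <= l -> [/\ `|u0 x| <= Z, `|p x| <= P & `|r x| <= Cr].
Hypothesis rH : forall x y, - l <= x <= l -> - l <= y <= l ->
        `|r x - r y| <= Hc * `|x - y| `^ alpha.

Let p_lip x y : - l <= x <= l -> - l <= y <= l -> `|p x - p y| <= Cr * `|x - y|.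
Proof. by apply: (lip pc pd) => z zl; have [] := bd zl. Qed.

Let u0_lip x y : - l <= x <= l -> - l <= y <= l -> `|u0 x - u0 y| <= P * `|x - y|.
Proof. by apply: (lip u0c u0d) => z zl; have [] := bd zl. Qed.

Lemma datum_taylor x h : 0 < `|h| -> - l <= x <= l -> - l <= x + h <= l ->
  `|u0 (x + h) - u0 x - p x * h - r x / 2 * h ^+ 2| <= Hc * `|h| `^ alpha * `|h| ^+ 2.
Proof.
move=> h0 xl yl.
have hE : x + h - x = h by rewrite addrC addKr.
have -> : h ^+ 2 = (x + h - x) ^+ 2 by rewrite hE.
have -> : p x * h = p x * (x + h - x) by rewrite hE.
have -> : Hc * `|h| `^ alpha * `|h| ^+ 2 = (Hc * `|h| `^ alpha * `|h|) * `|x + h - x|.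
  by rewrite hE; ring.
have xh : x != x + h by rewrite -subr_eq0 opprD addrA subrr sub0r oppr_eq0 -normr_gt0.
have inD s : Num.min x (x + h) <= s <= Num.max x (x + h) -> - l <= s <= l.
  rewrite ge_min le_max; move: xl yl => /andP[? ?] /andP[? ?].
  by move=> /andP[/orP[?|?] /orP[?|?]]; apply/andP; split; lra.
have inD' s : Num.min x (x + h) < s < Num.max x (x + h) -> - l < s < l.
  rewrite gt_min lt_max; move: xl yl => /andP[? ?] /andP[? ?].
  by move=> /andP[/orP[?|?] /orP[?|?]]; apply/andP; split; lra.
have near s : Num.min x (x + h) < s < Num.max x (x + h) -> `|s - x| <= `|h|.
  rewrite gt_min lt_max => /andP[/orP[?|?] /orP[?|?]]; rewrite ler_norml;
   have := ler_norm h; have := ler_norm (- h); rewrite normrN => ? ?;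
   apply/andP; split; lra.
apply: (taylor_remainder (f' := p)) => //.
- by move=> s sm; apply: derive_in => //; exact: inD'.
- apply: continuous_subspaceW u0c => s; rewrite /= in_itv /= => /inD.
  by rewrite /D /= in_itv.
- move=> s sm.
  have /andP[s1 s2] := sm.
  have sl : - l <= s <= l by apply: inD; rewrite !ltW.
  have [sx|xs|->] := ltgtP s x; last by rewrite !subrr mulr0 subr0 normr0 !mulr_ge0 ?powR_ge0.
  + have /andP[sl1 sl2] := sl; have /andP[xl1 xl2] := xl.
    have [c /andP[c1 c2] E] := mvt pc pd sl1 sx xl2.
    have cl : - l <= c <= l by rewrite !ltW ?(le_lt_trans sl1) ?(lt_le_trans c2).
    have -> : p s - p x - r x * (s - x) = (r c - r x) * (s - x).
      by rewrite -[p s - p x]opprB E -/r; ring.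
    rewrite normrM; apply: ler_pM => //; last exact: near.
    apply: le_trans (rH cl xl) _; rewrite ler_wpM2l //.
    apply: ge0_ler_powR; rewrite ?nnegrE //; first exact: ltW.
    apply: le_trans (near s sm).
    by rewrite !ltr0_norm ?subr_lt0 // lerN2 lerD2r ltW.
  + have /andP[sl1 sl2] := sl; have /andP[xl1 xl2] := xl.
    have [c /andP[c1 c2] E] := mvt pc pd xl1 xs sl2.
    have cl : - l <= c <= l by rewrite !ltW ?(le_lt_trans xl1) ?(lt_le_trans c2).
    have -> : p s - p x - r x * (s - x) = (r c - r x) * (s - x).
      by rewrite E -/r; ring.
    rewrite normrM; apply: ler_pM => //; last exact: near.
    apply: le_trans (rH cl xl) _; rewrite ler_wpM2l //.
    apply: ge0_ler_powR; rewrite ?nnegrE //; first exact: ltW.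
    apply: le_trans (near s sm).
    by rewrite !gtr0_norm ?subr_gt0 // lerD2r ltW.
Qed.

Section OnGrid.
Variables (T Zb Pb a0 a1 b0 L : R).
Variables (a f : R -> R -> R -> R -> R) (br bl gr gl : R -> R -> R).
Hypothesis box : box_bounds T l Zb Pb a0 a1 b0 L a f br bl gr gl.
Variables (N : nat) (h tau : R).
Hypothesis gok : grid_ok l a0 a1 L N h tau.
Hypotheses (ZZ : Z <= Zb) (PP : P <= Pb) (h1 : h <= 1).
Hypothesis compat_r :
  - (br 0 (u0 l) * p l) + gr 0 (u0 l) = a 0 l (u0 l) (p l) * r l + f 0 l (u0 l) (p l).
Hypothesis compat_l :
  bl 0 (u0 (- l)) * p (- l) + gl 0 (u0 (- l))
  = a 0 (- l) (u0 (- l)) (p (- l)) * r (- l) + f 0 (- l) (u0 (- l)) (p (- l)).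

Notation node := (grid_node l h).
Notation rate := (scheme_rate l a f br bl gr gl N h).
Definition grid_datum i := u0 (node i).
Let h0 : 0 < h := h_gt0 gok.
Let hn0 : h != 0 := lt0r_neq0 h0.
Let t0T : 0 <= (0 : R) <= T. Proof. by rewrite lexx ltW // (box_T box). Qed.
Let ha : h <= h `^ alpha. Proof. by apply: powR_ge_id; rewrite ?(ltW h0) ?(ltW al1). Qed.

(** Each slope equals the derivative at some point of its cell. Two such points are at distance at
    most [(i - j)%:R * h + h], which costs the factor [2]. *)
Lemma grid_datum_diff1 i j : (j < i < N)%N ->
  `|diff1 h grid_datum i - diff1 h grid_datum j| <= 2 * Cr * ((i - j)%:R * h).
Proof.
move=> /andP[ji iN].
have mv k : (k < N)%N -> exists2 c, node k < c < node k + h & diff1 h grid_datum k = p c.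
  move=> kN; have /andP[k1 k2] := node_in gok (ltnW kN); have /andP[k3 k4] := node_in gok kN.
  have kS : node k.+1 = node k + h by rewrite /grid_node -natr1; ring.
  have kk : node k < node k.+1 by rewrite kS ltrDl.
  have [c + E] := mvt u0c u0d k1 kk k4; rewrite kS => cc; exists c => //.
  by rewrite /diff1 /grid_datum E kS addrC addKr mulfK.
have [c /andP[c1 c2] ->] := mv i iN; have [d /andP[d1 d2] ->] := mv j (ltn_trans ji iN).
have /andP[k1 k2] := node_in gok (ltnW iN); have /andP[k3 k4] := node_in gok (ltnW (ltn_trans ji iN)).
have /andP[k5 k6] := node_in gok iN.
have iS : node i.+1 = node i + h by rewrite /grid_node -natr1; ring.
have ijE : node i = node j + (i - j)%:R * h.
  by rewrite /grid_node natrB ?(ltnW ji) //; ring.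
have kh : h <= (i - j)%:R * h by rewrite ler_peMl ?(ltW h0) // ler1n subn_gt0.
have cl : - l <= c <= l by rewrite iS in k6; apply/andP; split; lra.
have dl : - l <= d <= l by rewrite iS in k6; apply/andP; split; lra.
apply: le_trans (p_lip cl dl) _; rewrite [2 * Cr]mulrC -mulrA ler_wpM2l //.
by rewrite ler_norml; apply/andP; split; lra.
Qed.

(** The initial time derivative dictated by the interior equation; the compatibility conditions say
    that the boundary equations dictate the same value at the end points. *)
Definition exact_velocity x := a 0 x (u0 x) (p x) * r x + f 0 x (u0 x) (p x).

Let inbox x : - l <= x <= l -> [/\ `|u0 x| <= Zb, `|p x| <= Pb & `|r x| <= Cr].
Proof.
by move=> xl; have [uZ pP rC] := bd xl; split=> //; [exact: le_trans ZZ|exact: le_trans PP].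
Qed.

Let a10 : 0 <= a1.
Proof.
have ll : - l <= l <= l by rewrite lexx andbT; have := l0; lra.
have [uZ pP _] := inbox ll.
have /andP[aa ab] := box_a box t0T ll uZ pP.
by apply: le_trans ab; apply: le_trans aa; apply: ltW (box_a0 box).
Qed.

Lemma exact_velocity_holder x y : - l <= x <= l -> - l <= y <= l ->
  `|exact_velocity x - exact_velocity y|
  <= (a1 * Hc + L * (1 + P + Cr) * (Cr + 1) * (1 + 2 * l)) * `|x - y| `^ alpha.
Proof.
move=> xl yl.
have [uZ pP rC] := inbox xl; have [uZ' pP' rC'] := inbox yl.
have L0 := box_L box.
have dd F : lip4 L T l Zb Pb F ->
    `|F 0 x (u0 x) (p x) - F 0 y (u0 y) (p y)| <= L * (1 + P + Cr) * `|x - y|.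
  move=> FL; apply: le_trans (FL _ _ _ _ _ _ _ _ t0T t0T xl yl uZ uZ' pP pP') _.
  rewrite subrr normr0 add0r -mulrA ler_wpM2l // !mulrDl mul1r.
  by apply: lerD; [apply: lerD => //; exact: u0_lip|exact: p_lip].
have da := dd _ (box_alip box); have df := dd _ (box_flip box).
have xy : `|x - y| <= (1 + 2 * l) * `|x - y| `^ alpha.
  apply: le_powR_bounded => //; [exact: ltW|by rewrite lerDl mulr_ge0 // ltW|].
  rewrite normr_ge0; apply: le_trans (between_dist xl yl) _.
  by rewrite opprK -mulr2n mulr_natl lerDr.
have /andP[aa ab] := box_a box t0T xl uZ pP.
have ax0 : 0 <= a 0 x (u0 x) (p x) by apply: le_trans aa; apply: ltW (box_a0 box).
have -> : exact_velocity x - exact_velocity y =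
   a 0 x (u0 x) (p x) * (r x - r y)
   + (a 0 x (u0 x) (p x) - a 0 y (u0 y) (p y)) * r y
   + (f 0 x (u0 x) (p x) - f 0 y (u0 y) (p y)) by rewrite /exact_velocity; ring.
have K0 : 0 <= L * (1 + P + Cr) by rewrite mulr_ge0 // !addr_ge0.
have e1 : `|a 0 x (u0 x) (p x) * (r x - r y)| <= a1 * (Hc * `|x - y| `^ alpha).
  by rewrite normrM (ger0_norm ax0); apply: ler_pM => //; exact: rH.
have e2 : `|(a 0 x (u0 x) (p x) - a 0 y (u0 y) (p y)) * r y|
    <= L * (1 + P + Cr) * `|x - y| * Cr by rewrite normrM; apply: ler_pM.
have e3 : L * (1 + P + Cr) * `|x - y| * (Cr + 1) <=
   L * (1 + P + Cr) * ((1 + 2 * l) * `|x - y| `^ alpha) * (Cr + 1).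
  by rewrite ler_wpM2r ?addr_ge0 // ler_wpM2l.
apply: le_trans (ler_normD _ _) _.
have := ler_normD (a 0 x (u0 x) (p x) * (r x - r y))
  ((a 0 x (u0 x) (p x) - a 0 y (u0 y) (p y)) * r y).
lra.
Qed.

Definition consistency := 2 * a1 * Hc + L * Hc * Cr + L * Hc + L * (Cr + Hc).

(** The sign [s] treats the forward quotient at the left end and the backward quotient at the right
    end together. *)
Lemma datum_diff1_bdry s x : `|s| = 1 -> - l <= x <= l -> - l <= x + s * h <= l ->
  `|(u0 (x + s * h) - u0 x) / (s * h) - p x| <= (Cr + Hc) * h `^ alpha.
Proof.
move=> s1 xl yl; have shE : `|s * h| = h by rewrite normrM s1 mul1r gtr0_norm.
have sn0 : s * h != 0 by rewrite -normr_gt0 shE.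
have [_ _ rC] := inbox xl.
have sh0 : 0 < `|s * h| by rewrite shE.
have := datum_taylor sh0 xl yl; rewrite shE => tl.
have -> : (u0 (x + s * h) - u0 x) / (s * h) - p x =
   (u0 (x + s * h) - u0 x - p x * (s * h) - r x / 2 * (s * h) ^+ 2) / (s * h)
   + r x / 2 * (s * h) by field; rewrite hn0 -normr_gt0 s1 ltr01.
apply: le_trans (ler_normD _ _) _; rewrite [leLHS]addrC [leRHS]mulrDl; apply: lerD.
  rewrite normrM shE; apply: ler_pM => //; first exact: ltW.
  rewrite normrM normfV (ger0_norm (ler0n R 2)); have := normr_ge0 (r x); lra.
rewrite normrM normfV shE ler_pdivrMr //; apply: le_trans tl _.
rewrite expr2 mulrA ler_pM2r // ler_piMr //; apply: mulr_ge0 => //; exact: powR_ge0.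
Qed.

(** Inside, the Hölder second derivative gives Taylor errors of order [h ^ alpha]. At the ends [g]
    drops out by compatibility, leaving [b] times the error of a one-sided quotient. Without
    compatibility the initial velocity would jump there. *)
Lemma rate_consistent i : (i <= N)%N ->
  `|rate 0 grid_datum i - exact_velocity (node i)| <= consistency * h `^ alpha.
Proof.
move=> iN; have L0 := box_L box; have N1 := N_gt1 gok.
have hal : 0 <= h `^ alpha by exact: powR_ge0.
have HL : 0 <= L * Hc by rewrite mulr_ge0.
have LC : 0 <= L * Cr by rewrite mulr_ge0.
have HLC : 0 <= L * Hc * Cr by rewrite mulr_ge0.
have aH : 0 <= a1 * Hc by rewrite mulr_ge0.
have xl := node_in gok iN.
have nS k : node k.+1 = node k + 1 * h by rewrite /grid_node -natr1; ring.
have nP k : (0 < k)%N -> node k.-1 = node k + (-1) * h.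
  by move=> k0; rewrite /grid_node -{2}(prednK k0) -natr1; ring.
have nl : node 0 = - l by rewrite /grid_node; ring.
have nr : node N = l by rewrite /grid_node (Nh gok); ring.
have [uZ pP rC] := inbox xl.
rewrite /scheme_rate; have [iE|i0] := eqVneq i 0%N.
  rewrite iE in xl *.
  rewrite /exact_velocity nl -compat_l /diff1 /grid_datum nS nl.
  have ll : - l <= - l <= l by rewrite nl in xl.
  have ll' : - l <= - l + 1 * h <= l by have := node_in gok (ltnW N1); rewrite nS nl.
  have := datum_diff1_bdry (normr1 _) ll ll'; rewrite mul1r => dd.
  have [uZl _ _] := inbox ll.
  have /andP[bp bL] := bl_ge0 box t0T uZl.
  have -> : gl 0 (u0 (- l)) + bl 0 (u0 (- l)) * ((u0 (- l + h) - u0 (- l)) / h) -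
    (bl 0 (u0 (- l)) * p (- l) + gl 0 (u0 (- l))) =
    bl 0 (u0 (- l)) * ((u0 (- l + h) - u0 (- l)) / h - p (- l)) by ring.
  rewrite normrM (ger0_norm bp).
  apply: (@le_trans _ _ (L * ((Cr + Hc) * h `^ alpha))).
    by apply: ler_pM.
  by rewrite mulrA ler_wpM2r // /consistency; lra.
have [iE|iN'] := eqVneq i N.
  rewrite iE in xl *.
  rewrite /exact_velocity nr -compat_r /diff1 /grid_datum prednK; last by nlia.
  rewrite nP; last by nlia.
  rewrite nr.
  have ll : - l <= l <= l by rewrite nr in xl.
  have ll' : - l <= l + (-1) * h <= l.
    have := node_in gok (leq_pred N); rewrite nP; last by nlia.
    by rewrite nr.
  have := datum_diff1_bdry (normrN1 _) ll ll' => dd.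
  have [uZl _ _] := inbox ll.
  have /andP[bp bL] := br_ge0 box t0T uZl.
  have -> : gr 0 (u0 l) - br 0 (u0 l) * ((u0 l - u0 (l + (-1) * h)) / h) -
    (- (br 0 (u0 l) * p l) + gr 0 (u0 l)) =
    - (br 0 (u0 l) * ((u0 (l + (-1) * h) - u0 l) / ((-1) * h) - p l)) by field.
  rewrite normrN normrM (ger0_norm bp).
  apply: (@le_trans _ _ (L * ((Cr + Hc) * h `^ alpha))).
    by apply: ler_pM.
  by rewrite mulrA ler_wpM2r // /consistency; lra.
have i0' : (0 < i)%N by nlia.
set x := node i in xl uZ pP rC *.
have gp : grid_datum i.+1 = u0 (x + h) by rewrite /grid_datum nS mul1r.
have gm : grid_datum i.-1 = u0 (x - h) by rewrite /grid_datum nP // mulN1r.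
have xlp : - l <= x + h <= l.
  by rewrite -[h]mul1r -nS; apply: (node_in gok); nlia.
have xlm : - l <= x + - h <= l.
  by have := node_in gok (leq_trans (leq_pred i) iN); rewrite nP // -/x mulN1r.
have hp : 0 < `|h| by rewrite gtr0_norm.
have hm : 0 < `|- h| by rewrite normrN gtr0_norm.
have tp := datum_taylor hp xl xlp; have tm := datum_taylor hm xl xlm.
rewrite normrN in tm; rewrite !(gtr0_norm h0) in tp tm.
set ep := u0 (x + h) - _ - _ - _ in tp; set em := u0 (x - h) - _ - _ - _ in tm.
have d0E : diff0 h grid_datum i = p x + (ep - em) / (2 * h).
  by rewrite /diff0 gp gm /ep /em; field.
have d2E : diff2 h grid_datum i = r x + (ep + em) / h ^+ 2.
  by rewrite /diff2 gp gm /ep /em /grid_datum -/x; field.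
have d0P : `|diff0 h grid_datum i| <= Pb.
  rewrite /diff0 gp gm normrM normfV (gtr0_norm (_ : 0 < 2 * h)) ?mulr_gt0 //.
  rewrite ler_pdivrMr ?mulr_gt0 //; apply: le_trans (u0_lip xlp xlm) _.
  have -> : x + h - (x - h) = 2 * h by ring.
  by rewrite gtr0_norm ?mulr_gt0 // ler_wpM2r // mulr_ge0 // ltW.
have d0d : `|diff0 h grid_datum i - p x| <= Hc * h `^ alpha.
  rewrite d0E addrC addKr normrM normfV (gtr0_norm (_ : 0 < 2 * h)) ?mulr_gt0 //.
  rewrite ler_pdivrMr ?mulr_gt0 //; apply: le_trans (ler_normB _ _) _.
  apply: le_trans (lerD tp tm) _; rewrite expr2.
  have -> : Hc * h `^ alpha * (h * h) + Hc * h `^ alpha * (h * h) =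
    Hc * h `^ alpha * (2 * h) * h by ring.
  by rewrite ler_piMr // !mulr_ge0 // ltW.
have d2d : `|diff2 h grid_datum i - r x| <= 2 * Hc * h `^ alpha.
  rewrite d2E addrC addKr normrM normfV normrX (gtr0_norm h0) ler_pdivrMr ?exprn_gt0 //.
  apply: le_trans (ler_normD _ _) _; apply: le_trans (lerD tp tm) _.
  by rewrite le_eqVlt; apply/orP; left; apply/eqP; ring.
have dd F : lip4 L T l Zb Pb F ->
    `|F 0 x (u0 x) (diff0 h grid_datum i) - F 0 x (u0 x) (p x)| <= L * (Hc * h `^ alpha).
  move=> FL; apply: le_trans (FL _ _ _ _ _ _ _ _ t0T t0T xl xl uZ uZ d0P pP) _.
  by rewrite !subrr !normr0 !add0r ler_wpM2l.
have da := dd _ (box_alip box); have df := dd _ (box_flip box).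
have /andP[aa ab] := box_a box t0T xl uZ d0P.
have ax0 : 0 <= a 0 x (u0 x) (diff0 h grid_datum i).
  by apply: le_trans aa; apply: ltW (box_a0 box).
have -> : a 0 x (grid_datum i) (diff0 h grid_datum i) * diff2 h grid_datum i +
   f 0 x (grid_datum i) (diff0 h grid_datum i) - exact_velocity x =
   a 0 x (u0 x) (diff0 h grid_datum i) * (diff2 h grid_datum i - r x)
   + (a 0 x (u0 x) (diff0 h grid_datum i) - a 0 x (u0 x) (p x)) * r x
   + (f 0 x (u0 x) (diff0 h grid_datum i) - f 0 x (u0 x) (p x)).
  by rewrite /exact_velocity /grid_datum -/x; ring.
have e1 : `|a 0 x (u0 x) (diff0 h grid_datum i) * (diff2 h grid_datum i - r x)|
   <= a1 * (2 * Hc * h `^ alpha) by rewrite normrM (ger0_norm ax0); apply: ler_pM.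
have e2 : `|(a 0 x (u0 x) (diff0 h grid_datum i) - a 0 x (u0 x) (p x)) * r x|
    <= L * (Hc * h `^ alpha) * Cr by rewrite normrM; apply: ler_pM.
apply: (@le_trans _ _ ((2 * a1 * Hc + L * Hc * Cr + L * Hc) * h `^ alpha)); last first.
  by rewrite ler_wpM2r // lerDl mulr_ge0 // addr_ge0.
have -> : (2 * a1 * Hc + L * Hc * Cr + L * Hc) * h `^ alpha =
  a1 * (2 * Hc * h `^ alpha) + L * (Hc * h `^ alpha) * Cr + L * (Hc * h `^ alpha) by ring.
apply: le_trans (ler_normD _ _) _; apply: lerD => //.
by apply: le_trans (ler_normD _ _) _; apply: lerD.
Qed.

Definition velocity_holder_const :=
  a1 * Hc + L * (1 + P + Cr) * (Cr + 1) * (1 + 2 * l) + 2 * consistency.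

Lemma grid_datum_velocity i j : (j < i <= N)%N ->
  `|rate 0 grid_datum i - rate 0 grid_datum j|
  <= velocity_holder_const * ((i - j)%:R * h) `^ alpha.
Proof.
move=> /andP[ji iN]; have jN := ltnW (leq_trans ji iN).
have ijE : node i - node j = (i - j)%:R * h.
  by rewrite /grid_node natrB ?(ltnW ji) //; ring.
have kh : h <= (i - j)%:R * h by rewrite ler_peMl ?(ltW h0) // ler1n subn_gt0.
have k0 : 0 <= (i - j)%:R * h by rewrite mulr_ge0 // ltW.
have := exact_velocity_holder (node_in gok iN) (node_in gok jN).
rewrite ijE (ger0_norm k0) => ev.
(* The consistency error is no larger than the modulus at one cell, so it can be hidden in the
   Hölder bound for distinct nodes. *)
have hk : h `^ alpha <= ((i - j)%:R * h) `^ alpha.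
  by apply: ge0_ler_powR; rewrite ?nnegrE ?(ltW al0) // ltW.
have C0 : 0 <= consistency.
  by rewrite -(pmulr_lge0 _ (powR_gt0 alpha h0)); apply: le_trans (rate_consistent iN).
have ci := le_trans (rate_consistent iN) (ler_wpM2l C0 hk).
have cj := le_trans (rate_consistent jN) (ler_wpM2l C0 hk).
have -> : rate 0 grid_datum i - rate 0 grid_datum j =
  (rate 0 grid_datum i - exact_velocity (node i))
  - (rate 0 grid_datum j - exact_velocity (node j))
  + (exact_velocity (node i) - exact_velocity (node j)) by ring.
apply: le_trans (ler_normD _ _) _.
have := ler_normB (rate 0 grid_datum i - exact_velocity (node i))
   (rate 0 grid_datum j - exact_velocity (node j)).
rewrite /velocity_holder_const; lra.
Qed.

End OnGrid.
End Constants.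
End InitialDatum.

(** * Grid solutions *)

Definition for_small (R : realType) (Q : R -> Prop) : Prop :=
  exists2 h0 : R, 0 < h0 & forall h, 0 < h -> h <= h0 -> Q h.

Lemma for_small_and (R : realType) (Q1 Q2 : R -> Prop) :
  for_small Q1 -> for_small Q2 -> for_small (fun h => Q1 h /\ Q2 h).
Proof.
move=> [h1 h10 H1] [h2 h20 H2]; exists (Num.min h1 h2); first by rewrite lt_min h10.
by move=> h h0; rewrite le_min => /andP[? ?]; split; [exact: H1|exact: H2].
Qed.

Lemma for_small_lin (R : realType) (C c : R) : 0 < c -> for_small (fun h => h * C <= c).
Proof.
move=> c0; exists (c / (`|C| + 1)); first by rewrite divr_gt0 // ltr_pwDr.
move=> h h0; rewrite ler_pdivlMr; last by rewrite ltr_pwDr.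
apply: le_trans; rewrite ler_wpM2l ?(ltW h0) //.
by have := ler_norm C; lra.
Qed.

(* [v] is the forward time difference of [u]; no constant depends on the grid. *)
Record grid_solution (R : realType) (T l al Z P C : R)
    (a f : R -> R -> R -> R -> R) (br bl gr gl : R -> R -> R) (u0 : R -> R)
    (N : nat) (h tau : R) (u v : nat -> nat -> R) : Prop := GridSolution {
  gs_N : (1 < N)%N; gs_h : 0 < h; gs_Nh : N%:R * h = 2 * l; gs_tau : 0 < tau;
  gs_step : forall n i, u n.+1 i = u n i + tau * v n i;
  gs_init : forall i, u 0%N i = u0 (grid_node l h i);
  gs_u : forall n i, n%:R * tau <= T -> (i <= N)%N -> `|u n i| <= Z;
  gs_diff1 : forall n i, n%:R * tau <= T -> (i < N)%N -> `|diff1 h (u n) i| <= P;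
  gs_diff2 : forall n i, n%:R * tau <= T -> (0 < i < N)%N -> `|diff2 h (u n) i| <= C;
  gs_v : forall n i, n%:R * tau <= T -> (i <= N)%N -> `|v n i| <= C;
  gs_vx : forall n i j, n%:R * tau <= T -> (j < i <= N)%N ->
    `|v n i - v n j| <= C * ((i - j)%:R * h) `^ al;
  gs_vt : forall n m i, (n + m)%:R * tau <= T -> (i <= N)%N ->
    `|v (n + m)%N i - v n i| <= C * (m%:R * tau) `^ (al / 2);
  gs_interior : forall n i, n%:R * tau <= T -> (0 < i < N)%N ->
    v n i = a (n%:R * tau) (grid_node l h i) (u n i) (diff0 h (u n) i) * diff2 h (u n) i
      + f (n%:R * tau) (grid_node l h i) (u n i) (diff0 h (u n) i);
  gs_right : forall n, n%:R * tau <= T ->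
    v n N = gr (n%:R * tau) (u n N) - br (n%:R * tau) (u n N) * diff1 h (u n) N.-1;
  gs_left : forall n, n%:R * tau <= T ->
    v n 0%N = gl (n%:R * tau) (u n 0%N) + bl (n%:R * tau) (u n 0%N) * diff1 h (u n) 0%N }.

Lemma quadratic_growth (R : realFieldType) (L P s : R) : 0 <= L -> 0 <= P -> 0 <= s ->
  L * (s ^+ 2 + (2 + P) * s + (1 + P)) <= L * (4 + 2 * P) * (1 + s ^+ 2).
Proof.
move=> L0 P0 s0; rewrite -mulrA ler_wpM2l //.
have ss : s <= 1 + s ^+ 2 by have := sqr_ge0 (s - 1 / 2); lra.
by have := ler_wpM2l P0 ss; have := mulr_ge0 P0 (exprn_ge0 2 s0); lra.
Qed.

(** * Choice of the constants and grid solutions with uniform bounds *)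

Section Assemble.
Variables (R : realType) (T l al : R).
Hypotheses (T0 : 0 < T) (l0 : 0 < l) (al01 : 0 < al < 1).
Variables (a f : R -> R -> R -> R -> R) (br bl gr gl : R -> R -> R).
Hypotheses (aC : Ck_on4 `[0, T] `[(- l), l] setT setT 2 a)
  (fC : Ck_on4 `[0, T] `[(- l), l] setT setT 2 f)
  (brC : Ck_on2 `[0, T] setT 2 br) (blC : Ck_on2 `[0, T] setT 2 bl)
  (grC : Ck_on2 `[0, T] setT 2 gr) (glC : Ck_on2 `[0, T] setT 2 gl).
Hypothesis a_gt0 : forall t x z p, 0 <= t <= T -> - l <= x <= l -> 0 < a t x z p.
Hypothesis b_gt0 : forall t z, 0 <= t <= T -> 0 < br t z /\ 0 < bl t z.

(** The growth condition is assumed in the open cylinder, whereas barriers are tested at the initial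
    time and up to the ends. The point is pulled towards the centre by a factor [s] and the
    Lipschitz bound on [f] controls the change. *)
Lemma growth_closed4 (G : R -> R) :
  (forall t x z, 0 < t < T -> - l < x < l -> z * f t x z 0 <= G z) ->
  forall t x z, 0 <= t <= T -> - l <= x <= l -> z * f t x z 0 <= G z.
Proof.
move=> fG t x z tT xl.
have [L [L0 fL _]] := Ck_on4_lip4 fC `|z| 0.
apply/ler_addgt0Pr => e e0.
have [d d0 dP] := for_small_lin (`|z| * L * (T + l)) e0.
pose s := Num.min d (1 / 2).
have s0 : 0 < s by rewrite lt_min d0 divr_gt0.
have s2 : s <= 1 / 2 by rewrite ge_min lexx orbT.
have se : s * (`|z| * L * (T + l)) <= e by apply: dP; rewrite // ge_min lexx.
have [t1 t2] := andP tT; have [x1 x2] := andP xl.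
have [sT sl] : 0 < s * T /\ 0 < s * l by split; exact: mulr_gt0.
have s1 : 0 <= 1 - s by lra.
have st1 := mulr_ge0 s1 t1.
have st2 := mulr_ge0 s1 (_ : 0 <= T - t); rewrite subr_ge0 in st2; have {}st2 := st2 t2.
have sx1 := mulr_ge0 s1 (_ : 0 <= x + l); have {}sx1 := sx1 ltac:(lra).
have sx2 := mulr_ge0 s1 (_ : 0 <= l - x); have {}sx2 := sx2 ltac:(lra).
pose t' := t + s * (T / 2 - t); pose x' := (1 - s) * x.
have tT' : 0 < t' < T by rewrite /t'; apply/andP; split; lra.
have xl' : - l < x' < l by rewrite /x'; apply/andP; split; lra.
have tc : 0 <= t' <= T by case/andP: tT' => ? ?; rewrite !ltW.
have xc : - l <= x' <= l by case/andP: xl' => ? ?; rewrite !ltW.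
have := fL _ _ _ _ _ _ _ _ tT tc xl xc (lexx `|z|) (lexx `|z|)
  (_ : `|0| <= 0) (_ : `|0| <= 0); rewrite normr0 lexx => /(_ isT isT).
rewrite !subrr !normr0 !addr0 => fd.
have td : `|t - t'| <= s * T.
  rewrite /t' ler_norml; have := mulr_ge0 (ltW s0) t1; have := mulr_ge0 (ltW s0) (_ : 0 <= T - t).
  by rewrite subr_ge0 => /(_ t2) ? ?; apply/andP; split; lra.
have xd : `|x - x'| <= s * l.
  rewrite /x'; have -> : x - (1 - s) * x = s * x by ring.
  rewrite normrM (gtr0_norm s0) ler_pM2l // ler_norml; exact/andP.
have fz : z * f t x z 0 - z * f t' x' z 0 <= e.
  rewrite -mulrBr; apply: le_trans (ler_norm _) _; rewrite normrM.
  apply: le_trans se; have -> : s * (`|z| * L * (T + l)) = `|z| * (L * (s * T + s * l)) by ring.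
  by rewrite ler_wpM2l // (le_trans fd) // ler_wpM2l // lerD.
by have := fG _ _ z tT' xl'; lra.
Qed.

Lemma growth_closed2 (G : R -> R) (g : R -> R -> R) : Ck_on2 `[0, T] setT 2 g ->
  (forall t z, 0 < t < T -> z * g t z <= G z) ->
  forall t z, 0 <= t <= T -> z * g t z <= G z.
Proof.
move=> gC gG t z tT.
have [L [L0 gL _]] := Ck_on2_lip2 gC `|z|.
apply/ler_addgt0Pr => e e0.
have [d d0 dP] := for_small_lin (`|z| * L * T) e0.
pose s := Num.min d (1 / 2).
have s0 : 0 < s by rewrite lt_min d0 divr_gt0.
have s2 : s <= 1 / 2 by rewrite ge_min lexx orbT.
have se : s * (`|z| * L * T) <= e by apply: dP; rewrite // ge_min lexx.
have [t1 t2] := andP tT.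
have sT : 0 < s * T by exact: mulr_gt0.
have s1 : 0 <= 1 - s by lra.
have st1 := mulr_ge0 s1 t1.
have st2 := mulr_ge0 s1 (_ : 0 <= T - t); rewrite subr_ge0 in st2; have {}st2 := st2 t2.
pose t' := t + s * (T / 2 - t).
have tT' : 0 < t' < T by rewrite /t'; apply/andP; split; lra.
have tc : 0 <= t' <= T by case/andP: tT' => ? ?; rewrite !ltW.
have := gL _ _ _ _ tT tc (lexx `|z|) (lexx `|z|); rewrite subrr normr0 addr0 => fd.
have td : `|t - t'| <= s * T.
  rewrite /t' ler_norml; have := mulr_ge0 (ltW s0) t1; have := mulr_ge0 (ltW s0) (_ : 0 <= T - t).
  by rewrite subr_ge0 => /(_ t2) ? ?; apply/andP; split; lra.
have fz : z * g t z - z * g t' z <= e.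
  rewrite -mulrBr; apply: le_trans (ler_norm _) _; rewrite normrM.
  apply: le_trans se; have -> : s * (`|z| * L * T) = `|z| * (L * (s * T)) by ring.
  by rewrite ler_wpM2l // (le_trans fd) // ler_wpM2l.
by have := gG _ z tT'; lra.
Qed.

(** The first step of the scheme uses the boundary data at time [0], which the hypothesis reaches
    only in the limit. *)
Lemma bdry_closed (M q0 : R) (b g : R -> R -> R) :
  Ck_on2 `[0, T] setT 2 b -> Ck_on2 `[0, T] setT 2 g -> 0 <= q0 ->
  (forall t z p, 0 < t <= T -> `|z| <= M -> q0 <= p -> `|g t z| <= b t z * p) ->
  forall t z p, 0 <= t <= T -> `|z| <= M -> q0 <= p -> `|g t z| <= b t z * p.
Proof.
move=> bC gC q00 gb t z p tT zM qp; have [t0|t0] := ltP 0 t.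
  by apply: gb => //; rewrite t0; case/andP: tT.
have -> : t = 0 by apply/eqP; rewrite eq_le t0; case/andP: tT.
have [L [L0 gL _]] := Ck_on2_lip2 gC M; have [L' [L0' bL _]] := Ck_on2_lip2 bC M.
apply/ler_addgt0Pr => e e0.
have [d d0 dP] := for_small_lin (L + L' * p) e0.
pose s := Num.min d T.
have s0 : 0 < s by rewrite lt_min d0.
have sT : s <= T by rewrite ge_min lexx orbT.
have se : s * (L + L' * p) <= e by apply: dP; rewrite // ge_min lexx.
have s0T : 0 <= s <= T by rewrite ltW.
have z0T : 0 <= (0 : R) <= T by rewrite lexx ltW.
have := gb s z p; rewrite s0 sT => /(_ isT zM qp) gs.
have := gL _ _ _ _ z0T s0T zM zM; have := bL _ _ _ _ s0T z0T zM zM.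
rewrite subrr normr0 !addr0 sub0r subr0 normrN (gtr0_norm s0) => bd gd.
have p0 : 0 <= p by lra.
have bs := ler_wpM2r p0 (le_trans (ler_norm _) bd).
have := ler_normD (g s z) (g 0 z - g s z); rewrite addrC subrK; lra.
Qed.

Variable u0 : R -> R.
Hypothesis u0C : C2alpha `[(- l), l] al u0.
Let p0 := derivI `[(- l), l] u0.
Let r0 := derivI `[(- l), l] p0.
Hypothesis compat_r :
  - (br 0 (u0 l) * p0 l) + gr 0 (u0 l) = a 0 l (u0 l) (p0 l) * r0 l + f 0 l (u0 l) (p0 l).
Hypothesis compat_l :
  bl 0 (u0 (- l)) * p0 (- l) + gl 0 (u0 (- l))
  = a 0 (- l) (u0 (- l)) (p0 (- l)) * r0 (- l) + f 0 (- l) (u0 (- l)) (p0 (- l)).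
Variable K : R.
Hypothesis u0_lip : forall x y, - l <= x <= l -> - l <= y <= l ->
    `|u0 x - u0 y| <= K * `|x - y|.
Variables (B : R) (Phi : R -> R).
Hypotheses (B0 : 0 < B)
  (Phi_nd : forall r s, 0 <= r -> r <= s -> Phi r <= Phi s)
  (Phi_gt0 : forall r, 0 <= r -> 0 < Phi r)
  (Phi_int : (\int[@lebesgue_measure R]_(r in `[0%R, +oo[) ((Phi r)^-1)%:E = +oo)%E).
Hypothesis f_growth : forall t x z, 0 < t < T -> - l < x < l ->
    z * f t x z 0 <= Phi `|z| * `|z| + B.
Hypotheses (gr_growth : forall t z, 0 < t < T -> z * gr t z <= Phi `|z| * `|z| + B)
  (gl_growth : forall t z, 0 < t < T -> z * gl t z <= Phi `|z| * `|z| + B).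
Variable M : R.
Hypothesis M_def : M = Mbound Phi T B (fine (sup_norm `[(- l), l] u0)).
Variables (q0 : R) (psi : R -> R).
Hypotheses (q0K : K <= q0) (psiC : Ck_on1 `[0, +oo[ 1 psi)
  (psi1 : forall r, 0 <= r -> 1 <= psi r).
Hypothesis psi_int : ((2 * M)%:E
    < \int[@lebesgue_measure R]_(rho in `[q0, +oo[) (rho / psi rho)%:E)%E.
Hypothesis f_bound : forall t x z p, 0 <= t <= T -> - l <= x <= l -> `|z| <= M ->
    `|f t x z p| <= a t x z p * psi `|p|.
Hypothesis gr_bound : forall t z p, 0 < t <= T -> `|z| <= M -> q0 <= p ->
    `|gr t z| <= br t z * p.
Hypothesis gl_bound : forall t z p, 0 < t <= T -> `|z| <= M -> q0 <= p ->
    `|gl t z| <= bl t z * p.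

Let al0 : 0 < al. Proof. by case/andP: al01. Qed.
Let al1 : al < 1. Proof. by case/andP: al01. Qed.

Let K0 : 0 <= K.
Proof.
have ll : - l <= l <= l by rewrite lexx andbT; have := l0; lra.
have l'l : - l <= - l <= l by rewrite lexx; have := l0; lra.
have := le_trans (normr_ge0 _) (u0_lip ll l'l).
by rewrite pmulr_lge0 // normr_gt0 subr_eq0; have := l0 => l0'; rewrite gt_eqF //; lra.
Qed.

Let Nu := fine (sup_norm `[(- l), l] u0).

Let u0_le x : - l <= x <= l -> `|u0 x| <= Nu.
Proof.
move=> xl; have [Z [Pq [Crq [Hcq [[Z0 _ _ _] bd _]]]]] := datum_bounds l0 u0C.
pose D : set R := [set` `[(- l), l]].
have xD : D x by rewrite /D /= in_itv.
have ub : (`|u0 x|%:E <= sup_norm D u0)%E.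
  by apply: ereal_sup_ubound; exists x.
have lt : (sup_norm D u0 <= Z%:E)%E.
  apply: ge_ereal_sup => _ [y yD <-]; rewrite lee_fin.
  by move: yD; rewrite /D /= in_itv /= => /bd[].
rewrite -lee_fin fineK // -/D; rewrite fin_numElt (lt_le_trans _ ub) ?ltNyr //=.
by rewrite (le_lt_trans lt) ?ltry.
Qed.

Let supers eps : 0 < eps -> exists S : R -> R,
  [/\ Nu <= S 0, forall t, 0 <= t <= T -> 0 <= S t <= M + eps &
    forall t tau sg F, 0 <= t -> 0 <= tau -> t + tau <= T -> `|sg| = 1 ->
      (forall z, z * F z <= Phi `|z| * `|z| + B) ->
      S t + tau * (sg * F (sg * S t)) <= S (t + tau)].
Proof.
move=> eps0; rewrite M_def; apply: supersolutions => //.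
have ll : - l <= l <= l by rewrite lexx andbT; have := l0; lra.
exact: le_trans (u0_le ll).
Qed.

Let M0 : 0 <= M.
Proof.
apply/ler_addgt0Pr => e e0; have [S [_ SM _]] := supers e0.
have t00 : 0 <= (0 : R) <= T by rewrite lexx ltW.
by have /andP[? ?] := SM 0 t00; lra.
Qed.

Lemma grid_solutions_exist : exists Z P C kappa : R, exists N0 : nat,
  [/\ 0 <= Z, 0 <= P, 0 <= C, 0 < kappa &
   (exists a0 a1 b0 L, box_bounds T l Z P a0 a1 b0 L a f br bl gr gl) /\
   forall N, (N0 <= N)%N -> exists u v,
     let h := 2 * l / N%:R in
     grid_solution T l al Z P C a f br bl gr gl u0 N h (kappa * h ^+ 2) u v].
Proof.
have q00 : 0 <= q0 by apply: le_trans q0K.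
have MM : 0 <= 2 * M by rewrite mulr_ge0.
have [q1 [h1 [q01 h10 slopes1]]] := psi_slopes psiC psi1 q00 MM psi_int.
have [Z1 [Pd [Cr [Hc [[Z10 Pd0 Cr0 Hc0] bd1 rH]]]]] := datum_bounds l0 u0C.
(* [Z] leaves room for supersolutions that exceed [M] by at most [1]; [P] covers both the slopes of
   the scheme and the derivative of the datum. *)
pose Z := M + 1; pose P := q1 + Pd.
have Z0 : 0 <= Z by rewrite /Z; have := M0; lra.
have P0 : 0 <= P by rewrite /P; lra.
have NuZ : Nu <= Z.
  have [S [NS SM _]] := supers (ltr01 : 0 < 1 :> R).
  have t00 : 0 <= (0 : R) <= T by rewrite lexx ltW.
  by have /andP[_] := SM 0 t00; exact: le_trans.
have bd x : - l <= x <= l -> [/\ `|u0 x| <= Z, `|p0 x| <= Pd & `|r0 x| <= Cr].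
  by move=> xl; have [_ ? ?] := bd1 x xl; split=> //; exact: le_trans (u0_le xl) NuZ.
have [a0 [a1 [b0 [L box]]]] :=
  box_bounds_exist T0 l0 aC fC brC blC grC glC a_gt0 b_gt0 Z0 P0.
have L0 := box_L box; have a00 := box_a0 box; have b00 := box_b0 box.
have a01 : a0 <= a1.
  have /andP[] := box_a box (t := 0) (x := 0) (z := 0) (p := 0) ltac:(by rewrite lexx ltW)
    ltac:(by rewrite oppr_le0 ltW) ltac:(by rewrite normr0) ltac:(by rewrite normr0).
  exact: le_trans.
have a10 : 0 < a1 by exact: lt_le_trans a01.
(* [2 * Cr] dominates the initial second differences, the fraction meets the end condition
   [q2_bdry], and [1] allows quadratic growth to be handled by the logarithm. *)
pose q2 := 1 + 2 * Cr + (2 * L + L * P) / a0.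
have LP0 : 0 <= (2 * L + L * P) / a0.
  by apply: divr_ge0; [have := mulr_ge0 L0 P0; lra|exact: ltW].
have q21 : 1 <= q2 by rewrite /q2; lra.
have q2_ge0 : 0 <= q2 by lra.
have q2C : 2 * Cr <= q2 by rewrite /q2; lra.
have q2b : 2 * L + L * P <= a0 * q2.
  by rewrite [leRHS]mulrC -ler_pdivrMr // /q2; lra.
pose C3 := 1 + L * (4 + 2 * P) / a0.
have LP4 : 0 <= L * (4 + 2 * P) by rewrite mulr_ge0 //; lra.
have C31 : 1 <= C3 by rewrite lerDl divr_ge0 // ltW.
have PP : 0 <= 2 * P by rewrite mulr_ge0.
have [q3 [h2 [q23 h20 slopes2]]] := quadratic_slopes q21 C31 PP.
have psi_quad s : 0 <= s ->
    L * (s ^+ 2 + (2 + P) * s + (1 + P)) <= a0 * (C3 * (1 + s ^+ 2)).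
  move=> s0; apply: le_trans (quadratic_growth L0 P0 s0) _.
  have -> : a0 * (C3 * (1 + s ^+ 2)) = (a0 + L * (4 + 2 * P)) * (1 + s ^+ 2).
    by rewrite /C3; field; rewrite gt_eqF.
  by rewrite ler_wpM2r ?addr_ge0 ?exprn_ge0 // lerDr ltW.
pose V := speed_bound P a1 L q3.
have q30 : 0 <= q3 by exact: le_trans q2_ge0 (ltW q23).
have V0 : 0 <= V.
  apply: addr_ge0; last exact: mulr_ge0.
  by apply: addr_ge0; apply: mulr_ge0 => //; exact: ltW.
pose dr := drift_bound P a1 L q3.
have dr0 : 0 <= dr.
  by apply: mulr_ge0; [apply: mulr_ge0 => //; exact: addr_ge0|rewrite addr_ge0 // addr_ge0].
have VV : 0 <= 2 * V by rewrite mulr_ge0.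
have [K1 [K11 hold]] := holder_modulus al0 al1 dr0 a00 b00 VV.
pose vh := velocity_holder_const l Pd Cr Hc a1 L.
(* Large enough both to propagate the modulus and to dominate the velocity of the datum. *)
pose Kh := K1 + `|vh|.
have Kh0 : 0 <= Kh by rewrite addr_ge0 // (le_trans ler01).
have KhK : K1 <= Kh by rewrite lerDl.
have Kh1 : 1 <= Kh by exact: le_trans KhK.
have Khv : vh <= Kh.
  by apply: le_trans (ler_norm _) _; rewrite lerDr (le_trans ler01).
pose bs := barrier_speed l P a1 L q3.
have bs0 : 0 <= bs.
  rewrite /bs /barrier_speed -/dr; apply: addr_ge0 => //; apply: addr_ge0.
    by apply: mulr_ge0 => //; exact: ltW.
  by apply: mulr_ge0 => //; apply: addr_ge0 => //; apply: mulr_ge0 => //; exact: ltW.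
pose C := q3 + 2 * V + Kh * (1 + bs).
have Kbs : 0 <= Kh * bs by rewrite mulr_ge0.
have Kbs1 : 0 <= Kh * (1 + bs) by rewrite mulr_ge0 // addr_ge0.
have q3C : q3 <= C by rewrite /C -addrA lerDl addr_ge0.
have C0 : 0 <= C by exact: le_trans q3C.
have VVC : 2 * V <= C by rewrite /C -addrA addrCA lerDl addr_ge0.
have VC : V <= C by apply: le_trans VVC; rewrite mulr_natl mulr2n lerDl.
have KbC : Kh + Kh * bs <= C by rewrite /C [Kh * (1 + _)]mulrDr mulr1 lerDr addr_ge0.
have KhC : Kh <= C by apply: le_trans KbC; rewrite lerDl.
(* The largest ratio [tau / h ^+ 2] allowed by [cfl]. *)
pose kappa := (4 * a1)^-1.
have k0 : 0 < kappa by rewrite invr_gt0 mulr_gt0.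
have small : for_small (fun h => [/\
   [/\ h <= h1, h <= h2 & h <= 1],
   [/\ h * L <= 2, h * L <= 2 * a0, h * (2 * kappa * L) <= 1 & h * (2 * kappa * L) <= 1] &
   h * (L * (1 + P / 2 + q3)) <= a0 /\ h * dr <= 2 * a0]).
  have [d1 d10 D1] := for_small_and (for_small_lin L (ltr0n R 2 : 0 < 2 :> R))
    (for_small_lin L (mulr_gt0 (ltr0n R 2) a00)).
  have [d2 d20 D2] := for_small_and (for_small_lin (2 * kappa * L) (ltr01 : 0 < 1 :> R))
    (for_small_and (for_small_lin (L * (1 + P / 2 + q3)) a00)
      (for_small_lin dr (mulr_gt0 (ltr0n R 2) a00))).
  exists (Num.min (Num.min h1 h2) (Num.min 1 (Num.min d1 d2))).
    by rewrite !lt_min h10 h20 ltr01 d10.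
  move=> h h0; rewrite !le_min => /andP[/andP[hh1 hh2] /and3P[hh3 hd1 hd2]].
  have [e1 e2] := D1 h h0 hd1; have [e3 [e4 e5]] := D2 h h0 hd2.
  by split.
have [hs hs0 smallP] := small.
exists Z, P, C, kappa, (2 + Num.truncn (2 * l / hs)).+1; split => //.
split; first by exists a0, a1, b0, L.
move=> N NN.
have N1 : (1 < N)%N by apply: leq_trans NN; rewrite ltnS leq_addr.
have Np : 0 < N%:R :> R by rewrite ltr0n (ltn_trans _ N1).
pose h := 2 * l / N%:R; pose tau := kappa * h ^+ 2.
have h0 : 0 < h by rewrite divr_gt0 // mulr_gt0.
have hsm : h <= hs.
  rewrite ler_pdivrMr // [leRHS]mulrC -ler_pdivrMr //; apply: ltW.
  apply: lt_le_trans (truncnS_gt _) _; rewrite ler_nat.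
  by apply: leq_trans NN; rewrite ltnS leq_addl.
have [[hh1 hh2 hh3] [c1 c2 c3 _] [c4 c5]] := smallP h h0 hsm.
have tau0 : 0 < tau by rewrite mulr_gt0 // exprn_gt0.
have gok : grid_ok l a0 a1 L N h tau.
  split => //.
  - by rewrite /h mulrC divfK // gt_eqF.
  - rewrite /tau /kappa le_eqVlt; apply/orP; left; apply/eqP; field.
    by rewrite gt_eqF.
  - have -> : 2 * tau * L = h * (h * (2 * kappa * L)) by rewrite /tau; ring.
    by rewrite ler_piMr // ltW.
  - have -> : 2 * tau * L = h * (h * (2 * kappa * L)) by rewrite /tau; ring.
    apply: le_trans c3; rewrite ler_piMl // mulr_ge0 ?(ltW h0) // !mulr_ge0 //.
    exact: ltW.
have [p1 p1ok] := slopes1 h h0 hh1; have [p2 p2ok] := slopes2 h h0 hh2.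
pose ug := grid_datum l u0 h.
have inode i : (i <= N)%N -> - l <= grid_node l h i <= l := node_in gok (i := i).
have nodeB i j : (j <= i)%N -> grid_node l h i - grid_node l h j = (i - j)%:R * h.
  by move=> ji; rewrite /grid_node natrB //; ring.
have ijh i j : 0 <= (i - j)%:R * h by rewrite mulr_ge0 // ltW.
have MZ : M <= Z by rewrite lerDl.
have q1P : q1 <= P by rewrite lerDl.
have gb t z p : 0 <= t <= T -> `|z| <= M -> q0 <= p ->
    `|gr t z| <= br t z * p /\ `|gl t z| <= bl t z * p.
  by move=> tT zM qp; split; [exact: (bdry_closed brC grC q00 gr_bound)
    |exact: (bdry_closed blC glC q00 gl_bound)].
have sup_inf n eps : n%:R * tau <= T -> 0 < eps -> exists S,
    [/\ supersolution T l Z f gr gl tau S,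
        forall i, (i <= N)%N -> `|ug i| <= S 0%N & S n <= M + eps].
  (* Truncating [eps] at [1] keeps the supersolution below [Z = M + 1]. *)
  move=> nT eps0; have m0 : 0 < Num.min eps 1 by rewrite lt_min eps0 ltr01.
  have [S [NS SM SS]] := supers m0.
  have m1 : Num.min eps 1 <= 1 by rewrite ge_min lexx orbT.
  have me : Num.min eps 1 <= eps by rewrite ge_min lexx.
  exists (fun n => S (n%:R * tau)); split.
  - split=> [k kT|k sg kT sg1].
      have /andP[s1 s2] := SM _ (tau_in gok kT); rewrite s1 /=.
      by apply: le_trans s2 _; rewrite lerD2l.
    have kS : k.+1%:R * tau = k%:R * tau + tau by rewrite -natr1; ring.
    rewrite kS in kT *; have kt0 : 0 <= k%:R * tau by rewrite mulr_ge0 // ltW.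
    have ktT : 0 <= k%:R * tau <= T by rewrite kt0 /=; apply: le_trans kT; rewrite lerDl ltW.
    split.
    (* The growth condition is imposed on the reaction frozen at time [k%:R * tau], matching the
       explicit step. *)
    + move=> x xl; apply: (SS _ _ _ (fun z => f (k%:R * tau) x z 0)) => //; first exact: ltW.
      by move=> z; apply: (growth_closed4 (G := fun z => Phi `|z| * `|z| + B)).
    + apply: (SS _ _ _ (gr (k%:R * tau))) => //; first exact: ltW.
      by move=> z; apply: (growth_closed2 (G := fun z => Phi `|z| * `|z| + B) grC).
    + apply: (SS _ _ _ (gl (k%:R * tau))) => //; first exact: ltW.
      by move=> z; apply: (growth_closed2 (G := fun z => Phi `|z| * `|z| + B) glC).
  - by move=> i iN; rewrite mul0r; apply: le_trans NS; apply: u0_le; exact: inode.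
  - have /andP[_ s2] := SM _ (tau_in gok nT).
    by apply: le_trans s2 _; rewrite lerD2l.
have ug_lip i j : (j < i <= N)%N -> `|ug i - ug j| <= q0 * ((i - j)%:R * h).
  move=> /andP[ji iN]; have jN := ltnW (leq_trans ji iN).
  apply: le_trans (u0_lip (inode i iN) (inode j jN)) _.
  by rewrite nodeB ?(ltnW ji) // ger0_norm // ler_wpM2r.
pose u := scheme l a f br bl gr gl N h tau ug.
pose v := velocity l a f br bl gr gl N h tau ug.
have uM n i : n%:R * tau <= T -> (i <= N)%N -> `|u n i| <= M.
  exact: (grid_bound box gok MZ q00 q1P f_bound gb p1ok sup_inf ug_lip).
have uq n i : n%:R * tau <= T -> (i < N)%N -> `|diff1 h (u n) i| <= q1.
  exact: (grid_diff1_bound box gok MZ q00 q1P f_bound gb p1ok sup_inf ug_lip).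
have uZ n i : n%:R * tau <= T -> (i <= N)%N -> `|u n i| <= Z.
  by move=> nT iN; exact: le_trans (uM _ _ nT iN) MZ.
have uP n i : n%:R * tau <= T -> (i < N)%N -> `|diff1 h (u n) i| <= P.
  by move=> nT iN; exact: le_trans (uq _ _ nT iN) q1P.
have PdP : Pd <= P by rewrite lerDr; exact: le_trans q00 (ltW q01).
have ug_curv i j : (j < i < N)%N -> `|diff1 h ug i - diff1 h ug j| <= q2 * ((i - j)%:R * h).
  move=> ij; apply: le_trans (grid_datum_diff1 u0C Cr0 bd gok ij) _.
  by rewrite ler_wpM2r.
have u2 n i : n%:R * tau <= T -> (0 < i < N)%N -> `|diff2 h (u n) i| <= q3.
  exact: (grid_diff2_bound box gok q2_ge0 q2b c4 psi_quad p2ok uZ uP ug_curv).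
have vV n i : n%:R * tau <= T -> (i <= N)%N -> `|v n i| <= V.
  exact: (velocity_bound box gok uZ uP u2).
pose H k := Kh * (k%:R * h) `^ al.
have v0H i j : (j < i <= N)%N -> `|v 0%N i - v 0%N j| <= H (i - j)%N.
  move=> ij; rewrite /v /velocity mul0r.
  apply: le_trans (grid_datum_velocity l0 al0 al1 u0C Pd0 Cr0 Hc0 bd rH box gok (lexx Z) PdP hh3 compat_r compat_l ij) _.
  by rewrite ler_wpM2r // powR_ge0.
have H0 : H 0%N = 0 by rewrite /H mul0r powR0 ?mulr0 // gt_eqF.
have Hnd k : H k <= H k.+1.
  have kk : k%:R * h <= k.+1%:R * h by rewrite ler_pM2r // ler_nat.
  have hk m : 0 <= m%:R * h by rewrite mulr_ge0 // ltW.
  rewrite ler_wpM2l //; apply: ge0_ler_powR => //; first exact: ltW.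
    exact: hk.
  exact: hk.
have vH n i j : n%:R * tau <= T -> (j < i <= N)%N -> `|v n i - v n j| <= H (i - j)%N.
  move=> nT; apply: (velocity_holder box gok uZ uP u2 c5 H0 Hnd _ v0H nT).
  by move=> k k0'; exact: hold.
exists u, v; split => //.
- exact: (Nh gok).
- by move=> n i nT iN; exact: le_trans (u2 n i nT iN) q3C.
- by move=> n i nT iN; exact: le_trans (vV n i nT iN) VC.
- move=> n i j nT ij; apply: le_trans (vH n i j nT ij) _.
  by rewrite ler_wpM2r ?powR_ge0.
- move=> n m i nmT iN.
  have nT : n%:R * tau <= T by apply: le_trans nmT; rewrite ler_pM2r // ler_nat leq_addr.
  pose s := m%:R * tau; have s0 : 0 <= s by rewrite mulr_ge0 // ltW.
  rewrite -/s; have [->|m0] := eqVneq m 0%N.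
    by rewrite addn0 subrr normr0 mulr_ge0 // powR_ge0.
  have sp : 0 < s by rewrite mulr_gt0 // ltr0n lt0n.
  have sa0 : 0 <= s `^ (al / 2) by exact: powR_ge0.
  have [s1|s1] := leP 1 s.
    have sa1 : 1 <= s `^ (al / 2).
      have e1 : 1 `^ (al / 2) = 1 :> R by rewrite powR1.
      by rewrite -[leLHS]e1; apply: ge0_ler_powR; rewrite ?nnegrE ?divr_ge0 ?(ltW al0).
    apply: (@le_trans _ _ (C * 1)); last by rewrite ler_wpM2l.
    rewrite mulr1; apply: le_trans (ler_normB _ _) _.
    apply: le_trans VVC; rewrite mulr_natl mulr2n.
    by apply: lerD; apply: vV.
  (* Parabolic scaling: at [d ^+ 2 = s] the two terms [Kh * s ^ (al / 2)] and [Q * d ^+ 2] balance.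
     The case [s < 1] gives [Q >= 1]; for [s >= 1] the sup bound sufficed. *)
  pose Q := Kh * s `^ (al / 2) / s.
  have Q1 : 1 <= Q.
    rewrite ler_pdivlMr // mul1r; apply: (@le_trans _ _ (s `^ (al / 2))).
      apply: powR_ge_id; rewrite ?divr_gt0 // ?s0 ?(ltW s1) //.
      by rewrite ler_pdivrMr // mul1r; apply: le_trans (ltW al1) _; rewrite ler1n.
    by rewrite ler_peMl.
  have start j : (j <= N)%N -> `|v n j - v n i|
      <= Kh * s `^ (al / 2) + Q * (grid_node l h j - grid_node l h i) ^+ 2.
    move=> jN; set d := grid_node l h j - _.
    have vd : `|v n j - v n i| <= Kh * `|d| `^ al.
      have [ij|ji|->] := ltngtP i j; last first.
      - by rewrite subrr normr0 mulr_ge0 ?powR_ge0.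
      - rewrite [leLHS]distrC /d (distrC (grid_node l h j)) nodeB ?(ltnW ji) // (ger0_norm (ijh _ _)).
        by apply: vH; rewrite // ji.
      - rewrite /d nodeB ?(ltnW ij) // (ger0_norm (ijh _ _)).
        by apply: vH; rewrite // ij.
    have -> : Kh * s `^ (al / 2) + Q * d ^+ 2 = Kh * (s `^ (al / 2) * (1 + d ^+ 2 / s)).
      by rewrite /Q; field; rewrite gt_eqF.
    apply: le_trans vd _; rewrite ler_wpM2l //.
    have -> : `|d| `^ al = (d ^+ 2) `^ (al / 2).
      rewrite -[d ^+ 2]real_normK ?num_real // -powR_mulrn // -powRrM.
      by congr (_ `^ _); field.
    have d20 : 0 <= d ^+ 2 by exact: sqr_ge0.
    (* Within the parabolic radius the constant term dominates [d ^ al]; outside it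
       [x ^ (al / 2) <= x] for [x = d ^+ 2 / s >= 1] hands over to the quadratic term. *)
    have [ds|sd] := leP (d ^+ 2) s.
      apply: (@le_trans _ _ (s `^ (al / 2))).
        by apply: ge0_ler_powR; rewrite ?nnegrE ?divr_ge0 ?(ltW al0).
      by rewrite ler_peMr // lerDl divr_ge0.
    have e : d ^+ 2 = s * (d ^+ 2 / s) by field; rewrite gt_eqF.
    rewrite {1}e powRM ?divr_ge0 // ler_wpM2l //.
    have ds1 : 1 <= d ^+ 2 / s by rewrite ler_pdivlMr // mul1r ltW.
    have al21 : al / 2 <= 1.
      by rewrite ler_pdivrMr // mul1r; apply: le_trans (ltW al1) _; rewrite ler1n.
    apply: (@le_trans _ _ (d ^+ 2 / s)); last by rewrite lerDr.
    exact: ler1_powR.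
  have := velocity_time box gok uZ uP u2 c5 Q1 iN start nmT iN.
  rewrite subrr expr0n /= add0r -/bs -/s => /le_trans; apply.
  have -> : Q * (bs * s) = Kh * bs * s `^ (al / 2) by rewrite /Q; field; rewrite gt_eqF.
  by rewrite -mulrDl ler_wpM2r.
- move=> n i nT /andP[i0 iN]; rewrite /v /velocity /scheme_rate.
  by have [-> ->] : (i == 0%N) = false /\ (i == N) = false by nlia.
- move=> n nT; rewrite /v /velocity /scheme_rate eqxx.
  by have -> : (N == 0%N) = false by nlia.
Qed.

End Assemble.

(** * Discrete Taylor estimates, uniform in the grid *)

Section GridConsequences.
Variables (R : realType) (T l al Z P C a0 a1 b0 L : R).
Variables (a f : R -> R -> R -> R -> R) (br bl gr gl : R -> R -> R) (u0 : R -> R).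
Hypothesis box : box_bounds T l Z P a0 a1 b0 L a f br bl gr gl.
Hypotheses (al0 : 0 < al) (al1 : al < 1) (C0 : 0 <= C).
Variables (N : nat) (h tau : R) (u v : nat -> nat -> R).
Hypothesis gs : grid_solution T l al Z P C a f br bl gr gl u0 N h tau u v.

Let h0 : 0 < h := gs_h gs.
Let hn0 : h != 0 := lt0r_neq0 h0.
Let tau0 : 0 < tau := gs_tau gs.
Let l0 : 0 < l := box_l box.
Let P0 : 0 <= P := box_P box.
Let L0 : 0 <= L := box_L box.
Let a00 : 0 < a0 := box_a0 box.

Lemma gs_time_lip n m i : (n + m)%:R * tau <= T -> (i <= N)%N ->
  `|u (n + m)%N i - u n i| <= C * (m%:R * tau).
Proof.
move=> nmT iN; elim: m nmT => [|m IH] nmT.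
  by rewrite addn0 subrr normr0 mul0r mulr0.
rewrite addnS in nmT *.
have nT : (n + m)%:R * tau <= T by apply: le_trans nmT; rewrite ler_pM2r // ler_nat.
rewrite (gs_step gs) addrAC (le_trans (ler_normD _ _)) //.
rewrite -natr1 mulrDl mul1r mulrDr lerD ?IH // normrM (gtr0_norm tau0) mulrC.
by rewrite ler_wpM2r ?(ltW tau0) // (gs_v gs).
Qed.

(** Summation of the velocities over [m] steps, each of which differs from the first by at most the
    Hölder modulus of the whole interval. *)
Lemma gs_time_taylor n m i : (n + m)%:R * tau <= T -> (i <= N)%N ->
  `|u (n + m)%N i - u n i - m%:R * tau * v n i|
  <= m%:R * tau * (C * (m%:R * tau) `^ (al / 2)).
Proof.
move=> nmT iN; set S := C * _.
suff key k : (k <= m)%N -> `|u (n + k)%N i - u n i - k%:R * tau * v n i| <= k%:R * tau * S.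
  exact: key.
elim: k => [|k IH] km; first by rewrite addn0 subrr mul0r mul0r subr0 normr0 mul0r.
have nkT : (n + k)%:R * tau <= T.
  by apply: le_trans nmT; rewrite ler_pM2r // ler_nat leq_add2l ltnW.
rewrite addnS (gs_step gs).
have -> : u (n + k)%N i + tau * v (n + k)%N i - u n i - k.+1%:R * tau * v n i =
  (u (n + k)%N i - u n i - k%:R * tau * v n i) + tau * (v (n + k)%N i - v n i).
  by rewrite -natr1; ring.
rewrite (le_trans (ler_normD _ _)) // -natr1 mulrDl mul1r mulrDl lerD ?IH 1?ltnW //.
rewrite normrM (gtr0_norm tau0) ler_pM2l // (le_trans (gs_vt gs nkT iN)) //.
rewrite ler_wpM2l //; apply: ge0_ler_powR; rewrite ?nnegrE ?divr_ge0 ?(ltW al0) //.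
- by rewrite mulr_ge0 // ltW.
- by rewrite mulr_ge0 // ltW.
- by rewrite ler_pM2r // ler_nat ltnW.
Qed.

Lemma gs_diff1_step n i : n%:R * tau <= T -> (0 < i < N)%N ->
  diff1 h (u n) i - diff1 h (u n) i.-1 = h * diff2 h (u n) i.
Proof.
move=> nT /andP[i0 iN]; rewrite /diff1 /diff2 prednK //; by field.
Qed.

Lemma gs_diff1_lip n j m : n%:R * tau <= T -> (j + m < N)%N ->
  `|diff1 h (u n) (j + m) - diff1 h (u n) j| <= C * (m%:R * h).
Proof.
move=> nT; elim: m => [|m IH] jN.
  by rewrite addn0 subrr normr0 mul0r mulr0.
have -> : diff1 h (u n) (j + m.+1) - diff1 h (u n) j =
  (diff1 h (u n) (j + m) - diff1 h (u n) j) + h * diff2 h (u n) (j + m.+1).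
  by rewrite -gs_diff1_step ?addnS //=; [ring|nlia].
rewrite (le_trans (ler_normD _ _)) // -natr1 mulrDl mul1r mulrDr lerD ?IH //; first by nlia.
rewrite normrM (gtr0_norm h0) mulrC ler_wpM2r ?(ltW h0) // (gs_diff2 gs) //; nlia.
Qed.

Lemma gs_space_lip n j m : n%:R * tau <= T -> (j + m <= N)%N ->
  `|u n (j + m)%N - u n j| <= P * (m%:R * h).
Proof.
move=> nT; elim: m => [|m IH] jN.
  by rewrite addn0 subrr normr0 mul0r mulr0.
have -> : u n (j + m.+1)%N - u n j = (u n (j + m)%N - u n j) + h * diff1 h (u n) (j + m).
  by rewrite /diff1 addnS; field.
rewrite (le_trans (ler_normD _ _)) // -natr1 mulrDl mul1r mulrDr lerD ?IH //; first by nlia.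
rewrite normrM (gtr0_norm h0) mulrC ler_wpM2r ?(ltW h0) // (gs_diff1 gs) //; nlia.
Qed.

Lemma gs_space_taylor n j m : n%:R * tau <= T -> (j < N)%N -> (j + m <= N)%N ->
  `|u n (j + m)%N - u n j - m%:R * h * diff1 h (u n) j| <= C * (m%:R * h) ^+ 2.
Proof.
move=> nT jN jmN.
suff key k : (k <= m)%N -> `|u n (j + k)%N - u n j - k%:R * h * diff1 h (u n) j|
    <= k%:R * h * (C * (m%:R * h)).
  by apply: le_trans (key m (leqnn _)) _; rewrite expr2 mulrCA.
elim: k => [|k IH] km; first by rewrite addn0 subrr mul0r mul0r subr0 normr0 mul0r.
have -> : u n (j + k.+1)%N - u n j - k.+1%:R * h * diff1 h (u n) j =
  (u n (j + k)%N - u n j - k%:R * h * diff1 h (u n) j)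
  + h * (diff1 h (u n) (j + k) - diff1 h (u n) j).
  by rewrite -natr1 {3}/diff1 addnS; field.
rewrite (le_trans (ler_normD _ _)) // -natr1 mulrDl mul1r mulrDl lerD ?IH 1?ltnW //.
rewrite normrM (gtr0_norm h0) ler_pM2l // (le_trans (gs_diff1_lip nT _)) //; first by nlia.
by rewrite ler_wpM2l // ler_pM2r // ler_nat ltnW.
Qed.

Definition curvature_const : R :=
  (C + L * (1 + P + C) * (1 + 2 * l) * (1 + C)) / a0.

(** The equation is solved for the second difference: all other terms have a modulus of continuity
    in space and the coefficient is at least [a0]. *)
Lemma gs_diff2_holder n j m : n%:R * tau <= T -> (0 < j)%N -> (j + m < N)%N ->
  `|diff2 h (u n) (j + m) - diff2 h (u n) j| <= curvature_const * (m%:R * h) `^ al.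
Proof.
move=> nT j0; have [->|m0] := eqVneq m 0%N.
  rewrite addn0 subrr normr0 mul0r powR0 ?mulr0 // gt_eqF //.
move=> jN; have [i iE] : exists i, i = (j + m)%N by exists (j + m)%N.
rewrite -iE in jN *; set d := m%:R * h.
have d0 : 0 <= d by rewrite mulr_ge0 // ltW.
have tT : 0 <= n%:R * tau <= T by rewrite nT mulr_ge0 // ltW.
have iN : (0 < i < N)%N by nlia.
have jjN : (0 < j < N)%N by nlia.
have xin k : (k <= N)%N -> - l <= grid_node l h k <= l.
  move=> kN; rewrite /grid_node lerDl mulr_ge0 ?(ltW h0) //=.
  have : k%:R * h <= N%:R * h by rewrite ler_pM2r // ler_nat.
  by rewrite (gs_Nh gs); lra.
have d0E k : (0 < k)%N -> diff0 h (u n) k = (diff1 h (u n) k + diff1 h (u n) k.-1) / 2.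
  by move=> k0; rewrite /diff0 /diff1 prednK //; field.
have d0P k : (0 < k < N)%N -> `|diff0 h (u n) k| <= P.
  move=> /andP[k0 kN]; rewrite d0E //.
  by apply: normr_avg_le; apply: (gs_diff1 gs) => //; nlia.
have uZ k : (k < N)%N -> `|u n k| <= Z by move=> kN; apply: (gs_u gs) => //; exact: ltnW.
have iN' := andP iN; have jN' := andP jjN.
have vd : `|v n i - v n j| <= C * d `^ al.
  have := gs_vx gs (n := n) (i := i) (j := j) nT; rewrite /d.
  have -> : (j < i <= N)%N by nlia.
  by have -> : (i - j)%N = m by [nlia]; apply.
have dd : `|diff0 h (u n) i - diff0 h (u n) j| <= C * d.
  rewrite !d0E //; last by case: iN'.
  have -> : (diff1 h (u n) i + diff1 h (u n) i.-1) / 2 - (diff1 h (u n) j + diff1 h (u n) j.-1) / 2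
    = ((diff1 h (u n) i - diff1 h (u n) j) + (diff1 h (u n) i.-1 - diff1 h (u n) j.-1)) / 2 by field.
  apply: normr_avg_le; first by rewrite iE; apply: gs_diff1_lip; rewrite -?iE.
  have -> : i.-1 = (j.-1 + m)%N by nlia.
  by apply: gs_diff1_lip => //; nlia.
have FL F : lip4 L T l Z P F ->
    `|F (n%:R * tau) (grid_node l h i) (u n i) (diff0 h (u n) i)
     - F (n%:R * tau) (grid_node l h j) (u n j) (diff0 h (u n) j)| <= L * (1 + P + C) * d.
  move=> FL; apply: le_trans (FL _ _ _ _ _ _ _ _ tT tT (xin _ _) (xin _ _) (uZ _ _) (uZ _ _)
     (d0P _ iN) (d0P _ jjN)) _; rewrite ?(ltnW iN'.2) ?(ltnW jN'.2) ?iN'.2 ?jN'.2 //.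
  rewrite subrr normr0 add0r -mulrA ler_wpM2l // !mulrDl mul1r lerD // lerD //.
    have -> : grid_node l h i - grid_node l h j = d.
      by rewrite /grid_node iE /d natrD; ring.
    by rewrite ger0_norm.
  by rewrite iE; apply: gs_space_lip; rewrite -?iE // ltnW.
have aL := FL _ (box_alip box); have fL := FL _ (box_flip box).
have := gs_interior gs nT iN; have := gs_interior gs nT jjN.
set Ai := a _ _ (u n i) _ in aL *; set Aj := a _ _ (u n j) _ in aL *.
set Fi := f _ _ (u n i) _ in fL *; set Fj := f _ _ (u n j) _ in fL *.
set Qi := diff2 h (u n) i; set Qj := diff2 h (u n) j => vj vi.
have /andP[aA _] : a0 <= Ai <= a1.
  by apply: (box_a box) => //; [apply: xin; exact: (ltnW iN'.2)|exact: (uZ _ iN'.2)|exact: d0P].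
have dl : d <= (1 + 2 * l) * d `^ al.
  apply: le_powR_bounded; rewrite ?(ltW al1) //; first by have := l0; lra.
  rewrite d0 /=; apply: (@le_trans _ _ (N%:R * h)).
    by rewrite ler_pM2r // ler_nat; nlia.
  by rewrite (gs_Nh gs); lra.
have QE : Ai * (Qi - Qj) = (v n i - v n j) - (Fi - Fj) - (Ai - Aj) * Qj.
  by rewrite vi vj; ring.
have LPC : 0 <= L * (1 + P + C) by rewrite mulr_ge0 // addr_ge0 // addr_ge0.
have Qb : Ai * `|Qi - Qj| <= C * d `^ al + L * (1 + P + C) * d + L * (1 + P + C) * d * C.
  have Ai0 : 0 <= Ai by apply: le_trans aA; exact: ltW.
  rewrite -{1}(ger0_norm Ai0) -normrM QE (le_trans (ler_normB _ _)) // lerD //.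
    by rewrite (le_trans (ler_normB _ _)) // lerD.
  by rewrite normrM; apply: ler_pM => //; apply: (gs_diff2 gs).
rewrite /curvature_const mulrAC ler_pdivlMr // mulrC.
apply: (@le_trans _ _ (Ai * `|Qi - Qj|)); first by rewrite ler_wpM2r.
apply: le_trans Qb _.
have := ler_wpM2l LPC dl; move=> e1.
have := ler_wpM2r C0 e1.
have -> : (C + L * (1 + P + C) * (1 + 2 * l) * (1 + C)) * d `^ al =
  C * d `^ al + L * (1 + P + C) * ((1 + 2 * l) * d `^ al)
  + L * (1 + P + C) * ((1 + 2 * l) * d `^ al) * C by ring.
by move=> e2; rewrite lerD // lerD.
Qed.

Lemma curvature_const_ge0 : 0 <= curvature_const.
Proof.
apply: divr_ge0; last exact: ltW.
apply: addr_ge0 => //; do !apply: mulr_ge0 => //; rewrite ?addr_ge0 // mulr_ge0 //.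
exact: ltW.
Qed.

Lemma gs_diff1_taylor n j m : n%:R * tau <= T -> (0 < j)%N -> (j + m < N)%N ->
  `|diff1 h (u n) (j + m) - diff1 h (u n) j - m%:R * h * diff2 h (u n) j|
  <= m%:R * h * (curvature_const * (m%:R * h) `^ al).
Proof.
move=> nT j0 jmN.
suff key k : (k <= m)%N -> `|diff1 h (u n) (j + k) - diff1 h (u n) j - k%:R * h * diff2 h (u n) j|
    <= k%:R * h * (curvature_const * (m%:R * h) `^ al).
  exact: key.
elim: k => [|k IH] km; first by rewrite addn0 subrr mul0r mul0r subr0 normr0 mul0r.
have jkN : (j + k.+1 < N)%N by nlia.
have -> : diff1 h (u n) (j + k.+1) - diff1 h (u n) j - k.+1%:R * h * diff2 h (u n) j =
  (diff1 h (u n) (j + k) - diff1 h (u n) j - k%:R * h * diff2 h (u n) j)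
  + h * (diff2 h (u n) (j + k.+1) - diff2 h (u n) j).
  have := gs_diff1_step (n := n) (i := (j + k.+1)%N) nT.
  have -> : (0 < j + k.+1 < N)%N by nlia.
  have -> : (j + k.+1).-1 = (j + k)%N by nlia.
  by move=> /(_ isT) E; rewrite mulrBr -E -natr1; ring.
rewrite (le_trans (ler_normD _ _)) // -natr1 mulrDl mul1r mulrDl lerD ?IH 1?ltnW //.
rewrite normrM (gtr0_norm h0) ler_pM2l // (le_trans (gs_diff2_holder nT j0 jkN)) //.
rewrite ler_wpM2l ?curvature_const_ge0 //.
apply: ge0_ler_powR; rewrite ?nnegrE ?(ltW al0) //.
- by rewrite mulr_ge0 // ltW.
- by rewrite mulr_ge0 // ltW.
- by rewrite ler_pM2r // ler_nat.
Qed.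

End GridConsequences.

(** * The limit along an ultrafilter *)

Lemma fmap_ultra (S : Type) (V : topologicalType) (s : S -> V) (F : set_system S) :
  UltraFilter F -> UltraFilter (s @ F).
Proof.
move=> FU; split=> [|G GF sG]; first exact: fmap_proper_filter.
apply/seteqP; split=> A GA; last exact: sG.
have [//|FnA] := in_ultra_setVsetC (s @^-1` A) FU.
have GnA : G (~` A) by apply: sG.
by have [x []] := filter_ex (filterI GA GnA).
Qed.

(** The image of an ultrafilter is an ultrafilter, and an ultrafilter on a compact segment
    converges. *)
Lemma ultra_bounded_cvg (R : realType) (F : set_system nat) (s : nat -> R) (C : R) :
  UltraFilter F -> (\forall k \near F, `|s k| <= C) -> cvg (s @ F).
Proof.
move=> FU sC; have := @segment_compact R (- C) C; rewrite compact_ultra.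
move=> /(_ (s @ F) (fmap_ultra s FU)).
case=> [|a [_ sa]]; last by apply/cvg_ex; exists a.
by apply: filterS sC => k /=; rewrite in_itv /= ler_norml.
Qed.

Lemma cvg_norm_le (R : realType) (F : set_system nat) (FF : ProperFilter F)
    (s : nat -> R) (a B : R) :
  s @ F --> a -> (\forall k \near F, `|s k| <= B) -> `|a| <= B.
Proof.
move=> sa sB; apply/ler_addgt0Pr => e e0.
have sae : \forall k \near F, `|a - s k| <= e by move/cvgrPdist_le : sa; apply.
have [k [ke kB]] := filter_ex (filterI sae sB).
have := ler_normD (a - s k) (s k); rewrite subrK; lra.
Qed.

Lemma cvg_dist_squeeze (R : realType) (F : set_system nat) (FF : Filter F)
    (s e : nat -> R) (a : R) :
  e @ F --> 0 -> (\forall k \near F, `|s k - a| <= e k) -> s @ F --> a.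
Proof.
move=> e0 se; apply/cvgrPdist_le => d d0.
have ed : \forall k \near F, `|0 - e k| <= d by move/cvgrPdist_le : e0; apply.
apply: filterS2 ed se => k; rewrite sub0r normrN distrC => ed es.
by apply: le_trans es (le_trans (ler_norm _) ed).
Qed.

Lemma powR_double (R : realType) (be d : R) : 0 < be -> be <= 1 -> 0 <= d ->
  (2 * d) `^ be <= 2 * d `^ be.
Proof.
move=> be0 be1 d0; rewrite powRM // ler_wpM2r ?powR_ge0 //.
by apply: ler1_powR => //; rewrite ler1n.
Qed.

Lemma modulus_sym (R : realType) (I : set R) (G w : R -> R) (c : R) :
  0 <= c -> (forall d, 0 <= d -> 0 <= w d) ->
  (forall s t, I s -> I t -> s < t -> `|G t - G s| <= c * w (t - s)) ->
  forall s t, I s -> I t -> `|G t - G s| <= c * w `|t - s|.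
Proof.
move=> c0 w0 Gw s t Is It; case: (ltgtP s t) => [st|ts|<-].
- by rewrite [`|t - s|]gtr0_norm ?subr_gt0 //; exact: Gw.
- by rewrite distrC [`|t - s|]distrC [`|s - t|]gtr0_norm ?subr_gt0 //; exact: Gw.
- by rewrite subrr normr0 mulr_ge0 // w0.
Qed.

(** The estimates on the grid run forward only. Expanding about the later point is reduced to
    expanding about the earlier one, at the price of the modulus of [D]. *)
Lemma taylor_sym (R : realType) (I : set R) (G D w : R -> R) (c1 c2 : R) :
  0 <= c1 -> 0 <= c2 -> (forall d, 0 <= d -> 0 <= w d) ->
  (forall s t, I s -> I t -> s < t ->
     `|G t - G s - (t - s) * D s| <= c1 * ((t - s) * w (t - s))) ->
  (forall s t, I s -> I t -> s < t -> `|D t - D s| <= c2 * w (t - s)) ->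
  forall s t, I s -> I t ->
     `|G t - G s - (t - s) * D s| <= (c1 + c2) * (`|t - s| * w `|t - s|).
Proof.
move=> c10 c20 w0 Gw Dw s t Is It; case: (ltgtP s t) => [st|ts|<-]; last first.
- by rewrite !subrr mul0r subrr normr0 mul0r mulr0.
- rewrite [`|t - s|]distrC [`|s - t|]gtr0_norm ?subr_gt0 //.
  have -> : G t - G s - (t - s) * D s =
    - (G s - G t - (s - t) * D t) + (s - t) * (D s - D t) by ring.
  apply: le_trans (ler_normD _ _) _; rewrite normrN [leRHS]mulrDl lerD ?Gw //.
  have st0 : 0 <= s - t by rewrite subr_ge0 ltW.
  by rewrite normrM (ger0_norm st0) mulrCA ler_wpM2l // Dw.
- rewrite [`|t - s|]gtr0_norm ?subr_gt0 // [leRHS]mulrDl.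
  have st0 : 0 <= t - s by rewrite subr_ge0 ltW.
  by apply: le_trans (Gw s t Is It st) _; rewrite lerDl mulr_ge0 ?mulr_ge0 ?w0.
Qed.

(* V, W, Q stand for the derivatives u_t, u_x, u_xx of U. *)
Record strip_profile (R : realType) (T l al A : R) (U V W Q : R -> R -> R) : Prop := {
  sp_A : 0 <= A;
  sp_U : forall t x, 0 <= t <= T -> - l <= x <= l -> `|U t x| <= A;
  sp_V : forall t x, 0 <= t <= T -> - l <= x <= l -> `|V t x| <= A;
  sp_W : forall t x, 0 <= t <= T -> - l <= x <= l -> `|W t x| <= A;
  sp_Q : forall t x, 0 <= t <= T -> - l < x < l -> `|Q t x| <= A;
  sp_Ut : forall s t x, 0 <= s <= T -> 0 <= t <= T -> - l <= x <= l ->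
    `|U t x - U s x - (t - s) * V s x| <= A * (`|t - s| * `|t - s| `^ (al / 2));
  sp_Ux : forall t x y, 0 <= t <= T -> - l <= x <= l -> - l <= y <= l ->
    `|U t y - U t x - (y - x) * W t x| <= A * (`|y - x| * `|y - x|);
  sp_Wx : forall t x y, 0 <= t <= T -> - l < x -> x < y -> y < l ->
    `|W t y - W t x - (y - x) * Q t x| <= A * ((y - x) * (y - x) `^ al);
  sp_Utd : forall s t x, 0 <= s <= T -> 0 <= t <= T -> - l <= x <= l ->
    `|U t x - U s x| <= A * `|t - s|;
  sp_Vtd : forall s t x, 0 <= s <= T -> 0 <= t <= T -> - l <= x <= l ->
    `|V t x - V s x| <= A * `|t - s| `^ (al / 2);
  sp_Vxd : forall t x y, 0 <= t <= T -> - l <= x <= l -> - l <= y <= l ->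
    `|V t y - V t x| <= A * `|y - x| `^ al;
  sp_Wxd : forall t x y, 0 <= t <= T -> - l <= x <= l -> - l <= y <= l ->
    `|W t y - W t x| <= A * `|y - x| }.

Section Limit.
Variables (R : realType) (T l al Z P C a0 a1 b0 L K : R).
Variables (a f : R -> R -> R -> R -> R) (br bl gr gl : R -> R -> R) (u0 : R -> R).
Hypothesis box : box_bounds T l Z P a0 a1 b0 L a f br bl gr gl.
Hypotheses (al0 : 0 < al) (al1 : al < 1) (C0 : 0 <= C).
Hypothesis u0_lip : forall x y, - l <= x <= l -> - l <= y <= l ->
    `|u0 x - u0 y| <= K * `|x - y|.
Variables (F : set_system nat) (FU : UltraFilter F).
Variables (N : nat -> nat) (h tau : nat -> R) (u v : nat -> nat -> nat -> R).
Hypothesis gs : forall k,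
  grid_solution T l al Z P C a f br bl gr gl u0 (N k) (h k) (tau k) (u k) (v k).
Hypotheses (h_cvg : h @ F --> 0) (tau_cvg : tau @ F --> 0).

Let FF : ProperFilter F := ultra_proper.
Let h0 k : 0 < h k := gs_h (gs k).
Let tau0 k : 0 < tau k := gs_tau (gs k).
Let l0 : 0 < l := box_l box.
Let T0 : 0 < T := box_T box.
Let L0 : 0 <= L := box_L box.
Let alh0 : 0 < al / 2. Proof. by rewrite divr_gt0. Qed.
Let alh1 : al / 2 <= 1. Proof. by have := al1; lra. Qed.

Definition time_index k (t : R) : nat := Num.truncn (t / tau k).
Definition space_index k (x : R) : nat := Num.truncn ((x + l) / h k).

Lemma time_index_le k t : 0 <= t -> (time_index k t)%:R * tau k <= t.
Proof.
by move=> t0; rewrite -ler_pdivlMr // truncn_le // divr_ge0 // ltW.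
Qed.

Lemma time_index_T k t : 0 <= t <= T -> (time_index k t)%:R * tau k <= T.
Proof. by move=> /andP[t0 tT]; apply: le_trans (time_index_le k t0) tT. Qed.

Lemma time_index_cvg t : 0 <= t -> (time_index k t)%:R * tau k @[k --> F] --> t.
Proof.
move=> t0; apply: cvg_dist_squeeze tau_cvg _; apply: nearW => k.
have h1 := time_index_le k t0.
have : t < (time_index k t).+1%:R * tau k by rewrite -ltr_pdivrMr // truncnS_gt.
by rewrite -natr1 mulrDl mul1r => h2; rewrite ler_norml; apply/andP; split; have := tau0 k; lra.
Qed.

Lemma space_index_le k x : - l <= x -> (space_index k x)%:R * h k <= x + l.
Proof.
by move=> xl; rewrite -ler_pdivlMr // truncn_le // divr_ge0 // ?(ltW (h0 k)) //; lra.
Qed.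

Lemma space_index_N k x : - l <= x <= l -> (space_index k x <= N k)%N.
Proof.
move=> /andP[x1 x2]; rewrite -(ler_nat R) -(ler_pM2r (h0 k)) (gs_Nh (gs k)).
by apply: le_trans (space_index_le k x1) _; lra.
Qed.

Lemma space_index_cvg x : - l <= x -> (space_index k x)%:R * h k @[k --> F] --> x + l.
Proof.
move=> xl; apply: cvg_dist_squeeze h_cvg _; apply: nearW => k.
have h1 := space_index_le k xl.
have : x + l < (space_index k x).+1%:R * h k by rewrite -ltr_pdivrMr // truncnS_gt.
by rewrite -natr1 mulrDl mul1r => h2; rewrite ler_norml; apply/andP; split; have := h0 k; lra.
Qed.

Lemma space_index_interior x : - l < x < l ->
  \forall k \near F, (0 < space_index k x < N k)%N.
Proof.
move=> /andP[x1 x2].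
have c1 := space_index_cvg (ltW x1).
have n1 : \forall k \near F, 0 < (space_index k x)%:R * h k.
  by apply: (cvgr_gt (x + l)) => //; lra.
have n2 : \forall k \near F, (space_index k x)%:R * h k < 2 * l.
  by apply: (cvgr_lt (x + l)) => //; lra.
apply: filterS2 n1 n2 => k k1 k2; apply/andP; split.
  by rewrite -(ltr_nat R) -(ltr_pM2r (h0 k)) mul0r.
by rewrite -(ltr_nat R) -(ltr_pM2r (h0 k)) (gs_Nh (gs k)).
Qed.

Lemma space_index_r k : space_index k l = N k.
Proof.
rewrite /space_index; have -> : (l + l) / h k = (N k)%:R; last exact: natrK.
have -> : l + l = 2 * l by ring.
by rewrite -(gs_Nh (gs k)) mulfK // gt_eqF.
Qed.

Lemma space_index_l k : space_index k (- l) = 0%N.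
Proof. by rewrite /space_index addNr mul0r truncn0. Qed.

Definition val k t x : R := u k (time_index k t) (space_index k x).
Definition speed k t x : R := v k (time_index k t) (space_index k x).
(** The forward difference does not exist at the last node; capping the index there yields the
    backward difference, exactly the one in the right boundary row. *)
Definition slope k t x : R :=
  diff1 (h k) (u k (time_index k t)) (minn (space_index k x) (N k).-1).
Definition curv k t x : R := diff2 (h k) (u k (time_index k t)) (space_index k x).

Definition limU t x : R := lim (val k t x @[k --> F]).
Definition limV t x : R := lim (speed k t x @[k --> F]).
Definition limW t x : R := lim (slope k t x @[k --> F]).
Definition limQ t x : R := lim (curv k t x @[k --> F]).

Lemma ulim_cvg (s : nat -> R) B : (\forall k \near F, `|s k| <= B) -> s @ F --> lim (s @ F).
Proof. by move=> sB; exact: ultra_bounded_cvg FU sB. Qed.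

Lemma val_bound k t x : 0 <= t <= T -> - l <= x <= l -> `|val k t x| <= Z.
Proof. by move=> tT xl; apply: (gs_u (gs k)); [exact: time_index_T|exact: space_index_N]. Qed.

Lemma grid_speed_bound k t x : 0 <= t <= T -> - l <= x <= l -> `|speed k t x| <= C.
Proof. by move=> tT xl; apply: (gs_v (gs k)); [exact: time_index_T|exact: space_index_N]. Qed.

Lemma min_index_lt k i : (minn i (N k).-1 < N k)%N.
Proof. have := gs_N (gs k) => n1; nlia. Qed.

Lemma slope_bound k t x : 0 <= t <= T -> `|slope k t x| <= P.
Proof. by move=> tT; apply: (gs_diff1 (gs k)); [exact: time_index_T|exact: min_index_lt]. Qed.

Lemma curv_bound t x : 0 <= t <= T -> - l < x < l -> \forall k \near F, `|curv k t x| <= C.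
Proof.
move=> tT xl; apply: filterS (space_index_interior xl) => k kN.
by apply: (gs_diff2 (gs k)); [exact: time_index_T|].
Qed.

Lemma cvgU t x : 0 <= t <= T -> - l <= x <= l -> val k t x @[k --> F] --> limU t x.
Proof. by move=> tT xl; apply: (ulim_cvg (B := Z)); apply: nearW => k; exact: val_bound. Qed.

Lemma speed_cvg t x : 0 <= t <= T -> - l <= x <= l -> speed k t x @[k --> F] --> limV t x.
Proof. by move=> tT xl; apply: (ulim_cvg (B := C)); apply: nearW => k; exact: grid_speed_bound. Qed.

Lemma cvgW t x : 0 <= t <= T -> slope k t x @[k --> F] --> limW t x.
Proof. by move=> tT; apply: (ulim_cvg (B := P)); apply: nearW => k; exact: slope_bound. Qed.

Lemma cvgQ t x : 0 <= t <= T -> - l < x < l -> curv k t x @[k --> F] --> limQ t x.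
Proof. by move=> tT xl; apply: ulim_cvg (curv_bound tT xl). Qed.

Lemma limU_bound t x : 0 <= t <= T -> - l <= x <= l -> `|limU t x| <= Z.
Proof.
by move=> tT xl; apply: cvg_norm_le (cvgU tT xl) _; apply: nearW => k; exact: val_bound.
Qed.

Lemma limV_bound t x : 0 <= t <= T -> - l <= x <= l -> `|limV t x| <= C.
Proof.
by move=> tT xl; apply: cvg_norm_le (speed_cvg tT xl) _; apply: nearW => k; exact: grid_speed_bound.
Qed.

Lemma limW_bound t x : 0 <= t <= T -> `|limW t x| <= P.
Proof.
by move=> tT; apply: cvg_norm_le (cvgW (x := x) tT) _; apply: nearW => k; exact: slope_bound.
Qed.

Lemma limQ_bound t x : 0 <= t <= T -> - l < x < l -> `|limQ t x| <= C.
Proof. by move=> tT xl; apply: cvg_norm_le (cvgQ tT xl) (curv_bound tT xl). Qed.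

(** Grid distances converge to [t - s], which is positive, so eventually they are at most twice as
    large; only constants are lost. *)
Lemma time_step s t : 0 <= s -> s < t -> \forall k \near F,
  [/\ (time_index k s <= time_index k t)%N &
      (time_index k t - time_index k s)%:R * tau k <= 2 * (t - s)].
Proof.
move=> s0 st.
have le k : (time_index k s <= time_index k t)%N.
  by apply: le_truncn; rewrite ler_pM2r ?invr_gt0 // ltW.
have c : (time_index k t)%:R * tau k - (time_index k s)%:R * tau k @[k --> F] --> t - s.
  by apply: cvgB; apply: time_index_cvg => //; lra.
have n : \forall k \near F,
    (time_index k t)%:R * tau k - (time_index k s)%:R * tau k <= 2 * (t - s).
  by apply: (cvgr_le (t - s)) => //; lra.
by apply: filterS n => k kn; split => //; rewrite natrB // mulrBl.
Qed.

Lemma space_step x y : - l <= x -> x < y -> \forall k \near F,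
  [/\ (space_index k x <= space_index k y)%N &
      (space_index k y - space_index k x)%:R * h k <= 2 * (y - x)].
Proof.
move=> xl xy.
have le k : (space_index k x <= space_index k y)%N.
  by apply: le_truncn; rewrite ler_pM2r ?invr_gt0 // lerD2r ltW.
have c : (space_index k y)%:R * h k - (space_index k x)%:R * h k @[k --> F] --> y - x.
  have -> : y - x = (y + l) - (x + l) by ring.
  by apply: cvgB; apply: space_index_cvg => //; lra.
have n : \forall k \near F,
    (space_index k y)%:R * h k - (space_index k x)%:R * h k <= 2 * (y - x).
  by apply: (cvgr_le (y - x)) => //; lra.
by apply: filterS n => k kn; split => //; rewrite natrB // mulrBl.
Qed.

(** The factor [4] is a [2] from the length of the step and a [2] from its power, both due to
    [time_step]. *)
Lemma limU_time_taylor s t x : 0 <= s -> s < t -> t <= T -> - l <= x <= l ->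
  `|limU t x - limU s x - (t - s) * limV s x| <= 4 * C * ((t - s) * (t - s) `^ (al / 2)).
Proof.
move=> s0 st tT xl.
have sT : 0 <= s <= T by apply/andP; split; lra.
have tT' : 0 <= t <= T by apply/andP; split; lra.
have c : val k t x - val k s x
    - ((time_index k t)%:R * tau k - (time_index k s)%:R * tau k) * speed k s x @[k --> F]
    --> limU t x - limU s x - (t - s) * limV s x.
  apply: cvgB; first by apply: cvgB; exact: cvgU.
  apply: cvgM; last exact: speed_cvg.
  by apply: cvgB; apply: time_index_cvg; lra.
apply: cvg_norm_le c _; apply: filterS (time_step s0 st) => k [le dt].
have E : time_index k t = (time_index k s + (time_index k t - time_index k s))%N by rewrite subnKC.
rewrite /val /speed -mulrBl -natrB // E addKn -E.
have := gs_time_taylor al0 C0 (gs k) (n := time_index k s)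
  (m := (time_index k t - time_index k s)%N) (i := space_index k x).
rewrite -E => /(_ (time_index_T k tT') (space_index_N k xl)) /le_trans; apply.
set d := _%:R * _ in dt *; have d0 : 0 <= d by rewrite mulr_ge0 // ltW.
have ts : 0 <= t - s by lra.
have da : d `^ (al / 2) <= 2 * (t - s) `^ (al / 2).
  apply: le_trans (powR_double alh0 alh1 ts).
  by apply: ge0_ler_powR; rewrite ?nnegrE ?divr_ge0 ?(ltW al0) // mulr_ge0.
have -> : 4 * C * ((t - s) * (t - s) `^ (al / 2)) =
  2 * (t - s) * (C * (2 * (t - s) `^ (al / 2))) by ring.
apply: ler_pM => //; first by rewrite mulr_ge0 // powR_ge0.
by rewrite ler_wpM2l.
Qed.

Lemma limU_time_lip s t x : 0 <= s -> s < t -> t <= T -> - l <= x <= l ->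
  `|limU t x - limU s x| <= 2 * C * (t - s).
Proof.
move=> s0 st tT xl.
have sT : 0 <= s <= T by apply/andP; split; lra.
have tT' : 0 <= t <= T by apply/andP; split; lra.
have c : val k t x - val k s x @[k --> F] --> limU t x - limU s x.
  by apply: cvgB; exact: cvgU.
apply: cvg_norm_le c _; apply: filterS (time_step s0 st) => k [le dt].
have E : time_index k t = (time_index k s + (time_index k t - time_index k s))%N by rewrite subnKC.
have := gs_time_lip (gs k) (n := time_index k s)
  (m := (time_index k t - time_index k s)%N) (i := space_index k x).
rewrite -E => /(_ (time_index_T k tT') (space_index_N k xl)) /le_trans; apply.
by rewrite [2 * C]mulrC -mulrA ler_wpM2l.
Qed.

Lemma limV_time s t x : 0 <= s -> s < t -> t <= T -> - l <= x <= l ->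
  `|limV t x - limV s x| <= 2 * C * (t - s) `^ (al / 2).
Proof.
move=> s0 st tT xl.
have sT : 0 <= s <= T by apply/andP; split; lra.
have tT' : 0 <= t <= T by apply/andP; split; lra.
have c : speed k t x - speed k s x @[k --> F] --> limV t x - limV s x.
  by apply: cvgB; exact: speed_cvg.
apply: cvg_norm_le c _; apply: filterS (time_step s0 st) => k [le dt].
have E : time_index k t = (time_index k s + (time_index k t - time_index k s))%N by rewrite subnKC.
have := gs_vt (gs k) (n := time_index k s)
  (m := (time_index k t - time_index k s)%N) (i := space_index k x).
rewrite -E => /(_ (time_index_T k tT') (space_index_N k xl)) /le_trans; apply.
rewrite [2 * C]mulrC -mulrA ler_wpM2l //.
have ts : 0 <= t - s by lra.
apply: le_trans (powR_double alh0 alh1 ts).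
by apply: ge0_ler_powR; rewrite ?nnegrE ?divr_ge0 ?(ltW al0) // mulr_ge0 // ltW.
Qed.

Lemma limV_space t x y : 0 <= t <= T -> - l <= x -> x < y -> y <= l ->
  `|limV t y - limV t x| <= 2 * C * (y - x) `^ al.
Proof.
move=> tT xl xy yl.
have xl' : - l <= x <= l by apply/andP; split; lra.
have yl' : - l <= y <= l by apply/andP; split; lra.
have c : speed k t y - speed k t x @[k --> F] --> limV t y - limV t x.
  by apply: cvgB; exact: speed_cvg.
apply: cvg_norm_le c _; apply: filterS (space_step xl xy) => k [le dx].
rewrite /speed; move: le; rewrite leq_eqVlt => /predU1P[->|lt].
  by rewrite subrr normr0 !mulr_ge0 // powR_ge0.
have := gs_vx (gs k) (n := time_index k t) (i := space_index k y) (j := space_index k x).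
rewrite lt space_index_N // => /(_ (time_index_T k tT) isT) /le_trans; apply.
rewrite [2 * C]mulrC -mulrA ler_wpM2l //.
have xy0 : 0 <= y - x by lra.
apply: le_trans (powR_double al0 (ltW al1) xy0).
by apply: ge0_ler_powR; rewrite ?nnegrE ?(ltW al0) // mulr_ge0 // ltW.
Qed.

Lemma limW_space t x y : 0 <= t <= T -> - l <= x -> x < y -> y <= l ->
  `|limW t y - limW t x| <= 2 * C * (y - x).
Proof.
move=> tT xl xy yl.
have c : slope k t y - slope k t x @[k --> F] --> limW t y - limW t x.
  by apply: cvgB; exact: cvgW.
apply: cvg_norm_le c _; apply: filterS (space_step xl xy) => k [le dx].
rewrite /slope; set i := minn (space_index k y) _; set j := minn (space_index k x) _.
have ji : (j <= i)%N by rewrite /i /j; nlia.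
have E : i = (j + (i - j))%N by rewrite subnKC.
have := gs_diff1_lip (gs k) (n := time_index k t) (j := j) (m := (i - j)%N).
rewrite -E min_index_lt => /(_ (time_index_T k tT) isT) /le_trans; apply.
rewrite [2 * C]mulrC -mulrA ler_wpM2l //; apply: le_trans dx.
by rewrite ler_pM2r // ler_nat /i /j; nlia.
Qed.

Lemma limU_space_taylor t x y : 0 <= t <= T -> - l <= x -> x < y -> y <= l ->
  `|limU t y - limU t x - (y - x) * limW t x| <= 4 * C * (y - x) ^+ 2.
Proof.
move=> tT xl xy yl.
have xl' : - l <= x <= l by apply/andP; split; lra.
have yl' : - l <= y <= l by apply/andP; split; lra.
have c : val k t y - val k t x
    - ((space_index k y)%:R * h k - (space_index k x)%:R * h k) * slope k t x @[k --> F]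
    --> limU t y - limU t x - (y - x) * limW t x.
  apply: cvgB; first by apply: cvgB; exact: cvgU.
  apply: cvgM; last exact: cvgW.
  have -> : y - x = (y + l) - (x + l) by ring.
  by apply: cvgB; apply: space_index_cvg; lra.
apply: cvg_norm_le c _; apply: filterS (space_step xl xy) => k [le dx].
rewrite -mulrBl -natrB // /val /slope.
have yN := space_index_N k yl'.
have [xN|xN] := ltnP (space_index k x) (N k); last first.
  have -> : space_index k x = space_index k y by nlia.
  by rewrite subnn subrr !mul0r subr0 normr0 mulr_ge0 ?sqr_ge0 // mulr_ge0.
have -> : minn (space_index k x) (N k).-1 = space_index k x by nlia.
have E : space_index k y = (space_index k x + (space_index k y - space_index k x))%N by rewrite subnKC.
have := gs_space_taylor C0 (gs k) (n := time_index k t) (j := space_index k x)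
  (m := (space_index k y - space_index k x)%N) (time_index_T k tT) xN.
rewrite -E => /(_ yN) /le_trans; apply.
have -> : 4 * C * (y - x) ^+ 2 = C * (2 * (y - x)) ^+ 2 by ring.
rewrite ler_wpM2l // ler_sqr ?nnegrE ?mulr_ge0 ?(ltW (h0 k)) //; lra.
Qed.

Let Cq := curvature_const l P C a0 L.
Let Cq0 : 0 <= Cq := curvature_const_ge0 box C0.

Lemma limW_space_taylor t x y : 0 <= t <= T -> - l < x -> x < y -> y < l ->
  `|limW t y - limW t x - (y - x) * limQ t x| <= 4 * Cq * ((y - x) * (y - x) `^ al).
Proof.
move=> tT xl xy yl.
have xl' : - l < x < l by apply/andP; split; lra.
have yl' : - l < y < l by apply/andP; split; lra.
have c : slope k t y - slope k t x
    - ((space_index k y)%:R * h k - (space_index k x)%:R * h k) * curv k t x @[k --> F]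
    --> limW t y - limW t x - (y - x) * limQ t x.
  apply: cvgB; first by apply: cvgB; exact: cvgW.
  apply: cvgM; last exact: cvgQ.
  have -> : y - x = (y + l) - (x + l) by ring.
  by apply: cvgB; apply: space_index_cvg; lra.
apply: cvg_norm_le c _.
apply: filterS3 (space_step (ltW xl) xy) (space_index_interior xl') (space_index_interior yl').
move=> k [le dx] /andP[x0 xN] /andP[y0 yN].
rewrite -(mulrBl (h k) (space_index k y)%:R) -natrB // /slope /curv.
have -> : minn (space_index k x) (N k).-1 = space_index k x by nlia.
have -> : minn (space_index k y) (N k).-1 = space_index k y by nlia.
have E : space_index k y = (space_index k x + (space_index k y - space_index k x))%N by rewrite subnKC.
have := gs_diff1_taylor box al0 al1 C0 (gs k) (n := time_index k t) (j := space_index k x)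
  (m := (space_index k y - space_index k x)%N) (time_index_T k tT) x0.
rewrite -E => /(_ yN) /le_trans; apply.
set d := _%:R * _ in dx *; have d0 : 0 <= d by rewrite mulr_ge0 // ltW.
have yx : 0 <= y - x by lra.
have da : d `^ al <= 2 * (y - x) `^ al.
  apply: le_trans (powR_double al0 (ltW al1) yx).
  by apply: ge0_ler_powR; rewrite ?nnegrE ?(ltW al0) // mulr_ge0.
have -> : 4 * Cq * ((y - x) * (y - x) `^ al) = 2 * (y - x) * (Cq * (2 * (y - x) `^ al)) by ring.
apply: ler_pM => //; first by rewrite mulr_ge0 // powR_ge0.
by rewrite ler_wpM2l.
Qed.

Lemma lip4_cvg (G : R -> R -> R -> R -> R) (t x z p : R) (t' x' z' p' : nat -> R) :
  lip4 L T l Z P G -> 0 <= t <= T -> - l <= x <= l -> `|z| <= Z -> `|p| <= P ->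
  (\forall k \near F, [/\ 0 <= t' k <= T, - l <= x' k <= l, `|z' k| <= Z & `|p' k| <= P]) ->
  t' @ F --> t -> x' @ F --> x -> z' @ F --> z -> p' @ F --> p ->
  G (t' k) (x' k) (z' k) (p' k) @[k --> F] --> G t x z p.
Proof.
move=> GL tT xl zZ pP near tc xc zc pc.
have e0 : L * ((`|t' k - t| + `|x' k - x| + `|z' k - z|) + `|p' k - p|) @[k --> F] --> 0.
  have d (s : nat -> R) b : s @ F --> b -> `|s k - b| @[k --> F] --> 0.
    move=> sb; rewrite -(normr0 R); apply: cvg_norm.
    by rewrite -[X in _ --> X](subrr b); apply: cvgB => //; exact: cvg_cst.
  rewrite -[X in _ --> X](mulr0 L); apply: cvgM; first exact: cvg_cst.
  rewrite -[X in _ --> X](addr0 0); apply: cvgD; last exact: d.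
  rewrite -[X in _ --> X](addr0 0); apply: cvgD; last exact: d.
  by rewrite -[X in _ --> X](addr0 0); apply: cvgD; exact: d.
apply: cvg_dist_squeeze e0 _; apply: filterS near => k [tk xk zk pk].
exact: GL.
Qed.

Lemma lip2_cvg (G : R -> R -> R) (t z : R) (t' z' : nat -> R) :
  lip2 L T Z G -> 0 <= t <= T -> `|z| <= Z ->
  (\forall k \near F, 0 <= t' k <= T /\ `|z' k| <= Z) ->
  t' @ F --> t -> z' @ F --> z -> G (t' k) (z' k) @[k --> F] --> G t z.
Proof.
move=> GL tT zZ near tc zc.
have e0 : L * (`|t' k - t| + `|z' k - z|) @[k --> F] --> 0.
  have d (s : nat -> R) b : s @ F --> b -> `|s k - b| @[k --> F] --> 0.
    move=> sb; rewrite -(normr0 R); apply: cvg_norm.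
    by rewrite -[X in _ --> X](subrr b); apply: cvgB => //; exact: cvg_cst.
  rewrite -[X in _ --> X](mulr0 L); apply: cvgM; first exact: cvg_cst.
  by rewrite -[X in _ --> X](addr0 0); apply: cvgD; exact: d.
apply: cvg_dist_squeeze e0 _; apply: filterS near => k [tk zk].
exact: GL.
Qed.

Lemma time_in k t : 0 <= t <= T -> 0 <= (time_index k t)%:R * tau k <= T.
Proof. by move=> tT; rewrite time_index_T // mulr_ge0 // ltW. Qed.

Lemma limit_interior t x : 0 <= t <= T -> - l < x < l ->
  limV t x = a t x (limU t x) (limW t x) * limQ t x + f t x (limU t x) (limW t x).
Proof.
move=> tT xl.
have xl' : - l <= x <= l by case/andP: xl => ? ?; rewrite !ltW.
have inn := space_index_interior xl.
pose X k := grid_node l (h k) (space_index k x).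
pose D k := diff0 (h k) (u k (time_index k t)) (space_index k x).
have Xc : X @ F --> x.
  rewrite -[X in _ --> X](addrK l) [_ - l]addrC.
  by apply: cvgD; [exact: cvg_cst|apply: space_index_cvg; case/andP: xl'].
have d0E k : (0 < space_index k x)%N -> D k =
   (diff1 (h k) (u k (time_index k t)) (space_index k x)
    + diff1 (h k) (u k (time_index k t)) (space_index k x).-1) / 2.
  move=> k0; rewrite /D /diff0 /diff1 prednK //; field.
  by rewrite gt_eqF.
have slE k : (space_index k x < N k)%N -> slope k t x =
    diff1 (h k) (u k (time_index k t)) (space_index k x).
  by move=> kN; rewrite /slope; have -> : minn (space_index k x) (N k).-1 = space_index k x by nlia.
(* The equation contains the central difference, [limW] the forward one; they differ by half a cell
   times a bounded second difference. *)
have Dc : D @ F --> limW t x.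
  have Ch : C * h k @[k --> F] --> 0.
    by rewrite -[X in _ --> X](mulr0 C); apply: cvgM => //; exact: cvg_cst.
  have DS : D k - slope k t x @[k --> F] --> 0.
    apply: cvg_dist_squeeze Ch _; apply: filterS inn => k /andP[k0 kN].
    rewrite subr0 d0E // slE //.
    set w := diff1 _ _ (space_index k x); set w' := diff1 _ _ _.
    have -> : (w + w') / 2 - w = - ((w - w') / 2) by field.
    rewrite normrN normrM normfV (ger0_norm (ler0n R 2)).
    have := gs_diff1_step (gs k) (n := time_index k t) (i := space_index k x) (time_index_T k tT).
    rewrite k0 kN -/w -/w' => /(_ isT) ->; rewrite normrM (gtr0_norm (h0 k)).
    have d2 : `|diff2 (h k) (u k (time_index k t)) (space_index k x)| <= C.
      by apply: (gs_diff2 (gs k)); [exact: time_index_T|rewrite k0].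
    have := ler_wpM2l (ltW (h0 k)) d2; have := mulr_ge0 (ltW (h0 k)) (normr_ge0 (diff2 (h k) (u k (time_index k t)) (space_index k x))).
    lra.
  have -> : D = fun k => (D k - slope k t x) + slope k t x by apply/funext => k; rewrite subrK.
  by rewrite -[X in _ --> X](add0r (limW t x)); apply: cvgD => //; exact: cvgW.
have near : \forall k \near F, [/\ 0 <= (time_index k t)%:R * tau k <= T, - l <= X k <= l,
    `|val k t x| <= Z & `|D k| <= P].
  apply: filterS inn => k /andP[k0 kN]; split.
  - exact: time_in.
  - rewrite /X /grid_node lerDl mulr_ge0 ?(ltW (h0 k)) //=.
    have := space_index_le k (_ : - l <= x); have /andP[x1 x2] := xl'.
    by move=> /(_ x1); lra.
  - exact: val_bound.
  - rewrite d0E //; apply: normr_avg_le; apply: (gs_diff1 (gs k)) => //; try exact: time_index_T.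
    by nlia.
have tc : (time_index k t)%:R * tau k @[k --> F] --> t.
  by apply: time_index_cvg; case/andP: tT.
have Ub := limU_bound tT xl'; have Wb := limW_bound x tT.
have ac := lip4_cvg (box_alip box) tT xl' Ub Wb near tc Xc (cvgU tT xl') Dc.
have fc := lip4_cvg (box_flip box) tT xl' Ub Wb near tc Xc (cvgU tT xl') Dc.
have rc : a ((time_index k t)%:R * tau k) (X k) (val k t x) (D k) * curv k t x
   + f ((time_index k t)%:R * tau k) (X k) (val k t x) (D k) @[k --> F] -->
   a t x (limU t x) (limW t x) * limQ t x + f t x (limU t x) (limW t x).
  by apply: cvgD => //; apply: cvgM => //; exact: cvgQ.
have vc : speed k t x @[k --> F] -->
    a t x (limU t x) (limW t x) * limQ t x + f t x (limU t x) (limW t x).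
  move/cvgrPdist_le : rc => rc; apply/cvgrPdist_le => e e0.
  apply: filterS2 inn (rc e e0) => k kN.
  by rewrite /speed (gs_interior (gs k)) //; exact: time_index_T.
exact: (cvg_unique _ (speed_cvg tT xl') vc).
Qed.

Lemma limit_right t : 0 <= t <= T ->
  limV t l = gr t (limU t l) - br t (limU t l) * limW t l.
Proof.
move=> tT; have ll : - l <= l <= l by rewrite lexx andbT; have := l0; lra.
have tc : (time_index k t)%:R * tau k @[k --> F] --> t.
  by apply: time_index_cvg; case/andP: tT.
have near : \forall k \near F, 0 <= (time_index k t)%:R * tau k <= T /\ `|val k t l| <= Z.
  by apply: nearW => k; split; [exact: time_in|exact: val_bound].
have gc := lip2_cvg (box_grlip box) tT (limU_bound tT ll) near tc (cvgU tT ll).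
have bc := lip2_cvg (box_brlip box) tT (limU_bound tT ll) near tc (cvgU tT ll).
have rc : gr ((time_index k t)%:R * tau k) (val k t l)
   - br ((time_index k t)%:R * tau k) (val k t l) * slope k t l @[k --> F] -->
   gr t (limU t l) - br t (limU t l) * limW t l.
  by apply: cvgB => //; apply: cvgM => //; exact: cvgW.
apply: (cvg_unique _ (speed_cvg tT ll)) => //.
suff -> : (fun k => speed k t l) = (fun k => gr ((time_index k t)%:R * tau k) (val k t l)
   - br ((time_index k t)%:R * tau k) (val k t l) * slope k t l) by [].
(* At [x = l] the index is exactly [N k] and the capped slope is [diff1] at [(N k).-1], so the
   boundary row holds on every grid without error. *)
apply/funext => k; rewrite /speed /val /slope space_index_r (gs_right (gs k)).
  by have -> : minn (N k) (N k).-1 = (N k).-1 by nlia.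
exact: time_index_T.
Qed.

Lemma limit_left t : 0 <= t <= T ->
  limV t (- l) = gl t (limU t (- l)) + bl t (limU t (- l)) * limW t (- l).
Proof.
move=> tT; have ll : - l <= - l <= l by rewrite lexx; have := l0; lra.
have tc : (time_index k t)%:R * tau k @[k --> F] --> t.
  by apply: time_index_cvg; case/andP: tT.
have near : \forall k \near F, 0 <= (time_index k t)%:R * tau k <= T /\ `|val k t (- l)| <= Z.
  by apply: nearW => k; split; [exact: time_in|exact: val_bound].
have gc := lip2_cvg (box_gllip box) tT (limU_bound tT ll) near tc (cvgU tT ll).
have bc := lip2_cvg (box_bllip box) tT (limU_bound tT ll) near tc (cvgU tT ll).
have rc : gl ((time_index k t)%:R * tau k) (val k t (- l))
   + bl ((time_index k t)%:R * tau k) (val k t (- l)) * slope k t (- l) @[k --> F] -->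
   gl t (limU t (- l)) + bl t (limU t (- l)) * limW t (- l).
  by apply: cvgD => //; apply: cvgM => //; exact: cvgW.
apply: (cvg_unique _ (speed_cvg tT ll)) => //.
suff -> : (fun k => speed k t (- l)) = (fun k => gl ((time_index k t)%:R * tau k) (val k t (- l))
   + bl ((time_index k t)%:R * tau k) (val k t (- l)) * slope k t (- l)) by [].
apply/funext => k; rewrite /speed /val /slope space_index_l (gs_left (gs k)).
  by rewrite min0n.
exact: time_index_T.
Qed.

Lemma limit_initial x : - l <= x <= l -> limU 0 x = u0 x.
Proof.
move=> xl; have tT : 0 <= (0 : R) <= T by rewrite lexx ltW.
have ti0 k : time_index k 0 = 0%N by rewrite /time_index mul0r truncn0.
have Xc : grid_node l (h k) (space_index k x) @[k --> F] --> x.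
  rewrite -[X in _ --> X](addrK l) [_ - l]addrC.
  by apply: cvgD; [exact: cvg_cst|]; apply: space_index_cvg; case/andP: xl.
apply: (cvg_unique _ (cvgU tT xl)) => //.
have e0 : K * `|grid_node l (h k) (space_index k x) - x| @[k --> F] --> 0.
  rewrite -[X in _ --> X](mulr0 K); apply: cvgM; first exact: cvg_cst.
  rewrite -(normr0 R); apply: cvg_norm.
  by rewrite -[X in _ --> X](subrr x); apply: cvgB => //; exact: cvg_cst.
apply: cvg_dist_squeeze e0 _; apply: nearW => k.
rewrite /val ti0 (gs_init (gs k)); apply: u0_lip => //.
rewrite /grid_node lerDl mulr_ge0 ?(ltW (h0 k)) //=.
have /andP[x1 x2] := xl; have := space_index_le k x1; lra.
Qed.

(** [6 * C] is [4 * C] for a forward Taylor estimate plus [2 * C] for reversing it with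
    [taylor_sym]; [4 * Cq] serves the expansion of the slope. *)
Lemma limit_profile : 0 <= Z -> 0 <= P ->
  strip_profile T l al (Z + P + 6 * C + 4 * Cq) limU limV limW limQ.
Proof.
move=> Z0 P0; set A := (X in strip_profile _ _ _ X).
have A0 : 0 <= A by have := C0; have := Cq0; rewrite /A; lra.
have up c X Y : c <= A -> 0 <= Y -> X <= c * Y -> X <= A * Y.
  by move=> cA Y0 /le_trans; apply; rewrite ler_wpM2r.
have C2A : 2 * C <= A by have := C0; have := Cq0; rewrite /A; lra.
have C6A : 4 * C + 2 * C <= A by have := C0; have := Cq0; rewrite /A; lra.
have C20 : 0 <= 2 * C by rewrite mulr_ge0.
have C40 : 0 <= 4 * C by rewrite mulr_ge0.
have pg e d : 0 <= d :> R -> 0 <= d `^ e by move=> _; exact: powR_ge0.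
split=> //.
- by move=> t x tT xl; apply: le_trans (limU_bound tT xl) _; have := C0; have := Cq0; rewrite /A; lra.
- by move=> t x tT xl; apply: le_trans (limV_bound tT xl) _; have := C0; have := Cq0; rewrite /A; lra.
- by move=> t x tT xl; apply: le_trans (limW_bound x tT) _; have := C0; have := Cq0; rewrite /A; lra.
- by move=> t x tT xl; apply: le_trans (limQ_bound tT xl) _; have := C0; have := Cq0; rewrite /A; lra.
- move=> s t x sT tT xl; apply: up C6A _ _; first by rewrite mulr_ge0 ?powR_ge0.
  apply: (taylor_sym (I := [set t | 0 <= t <= T]) (G := limU^~ x) (D := limV^~ x)
    (w := fun d => d `^ (al / 2)) C40 C20 (pg (al / 2))) => //= {sT tT}s {}t /andP[s0 sT] /andP[t0 tT] st.
    exact: limU_time_taylor.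
  exact: limV_time.
- move=> t x y tT xl yl; apply: up C6A _ _; first by rewrite mulr_ge0.
  apply: (taylor_sym (I := [set x | - l <= x <= l]) (G := limU t) (D := limW t)
    (w := id)) => //= {xl yl}x {}y /andP[x0 xl] /andP[y0 yl] xy.
    by rewrite -expr2; exact: limU_space_taylor.
  exact: limW_space.
- move=> t x y tT lx xy yl; apply: up (limW_space_taylor tT lx xy yl).
    by have := C0; rewrite /A; lra.
  by rewrite mulr_ge0 ?powR_ge0 // subr_ge0 ltW.
- move=> s t x sT tT xl; apply: up C2A _ _ => //.
  apply: (modulus_sym (I := [set t | 0 <= t <= T]) (G := limU^~ x)
    (w := id)) => //= {sT tT}s {}t /andP[s0 sT] /andP[t0 tT] st.
  exact: limU_time_lip.
- move=> s t x sT tT xl; apply: up C2A _ _; first exact: powR_ge0.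
  apply: (modulus_sym (I := [set t | 0 <= t <= T]) (G := limV^~ x)
    (w := fun d => d `^ (al / 2)) C20 (pg (al / 2))) => //= {sT tT}s {}t /andP[s0 sT] /andP[t0 tT] st.
  exact: limV_time.
- move=> t x y tT xl yl; apply: up C2A _ _; first exact: powR_ge0.
  apply: (modulus_sym (I := [set x | - l <= x <= l]) (G := limV t)
    (w := fun d => d `^ al) C20 (pg al)) => //= {xl yl}x {}y /andP[x0 xl] /andP[y0 yl] xy.
  exact: limV_space.
- move=> t x y tT xl yl; apply: up C2A _ _ => //.
  apply: (modulus_sym (I := [set x | - l <= x <= l]) (G := limW t)
    (w := id)) => //= {xl yl}x {}y /andP[x0 xl] /andP[y0 yl] xy.
  exact: limW_space.
Qed.

End Limit.

(** * Regularity of the limit *)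

Lemma powR_small (R : realType) (be c e : R) : 0 < be -> 0 <= c -> 0 < e ->
  exists2 d, 0 < d & forall x, 0 <= x <= d -> c * x `^ be <= e.
Proof.
move=> be0 c0 e0; have c1 : 0 < c + 1 by lra.
exists ((e / (c + 1)) `^ be^-1); first by rewrite powR_gt0 // divr_gt0.
move=> x /andP[x0 xd].
have : x `^ be <= ((e / (c + 1)) `^ be^-1) `^ be.
  by apply: ge0_ler_powR; rewrite ?nnegrE ?powR_ge0 ?(ltW be0).
rewrite -powRrM mulVf ?gt_eqF // powRr1 ?divr_ge0 ?(ltW c1) ?(ltW e0) //.
rewrite ler_pdivlMr // => xe; have := powR_ge0 x be; lra.
Qed.

Lemma taylor_is_derive (R : realType) (G : R -> R) (D c be lo hi x : R) :
  0 < be -> 0 <= c -> lo < x < hi ->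
  (forall y, lo < y < hi -> `|G y - G x - (y - x) * D| <= c * (`|y - x| * `|y - x| `^ be)) ->
  is_derive x (1 : R) G D.
Proof.
move=> be0 c0 /andP[lx xh] GD; apply: is_derive_eps => e e0.
have [d d0 dP] := powR_small be0 c0 e0.
exists (Num.min d (Num.min (x - lo) (hi - x))); first by rewrite !lt_min d0 !subr_gt0 lx.
move=> y; rewrite !lt_min => /and3P[yd yl yh]; rewrite [D * _]mulrC.
have ylh : lo < y < hi.
  by move: yl yh; rewrite !ltr_norml => /andP[y1 y2] /andP[y3 y4]; apply/andP; split; lra.
apply: le_trans (GD y ylh) _; rewrite mulrCA [leRHS]mulrC ler_wpM2l //.
by apply: dP; rewrite normr_ge0 ltW.
Qed.

Lemma is_derive_MVT (R : realType) (G dG : R -> R) (s t : R) : s < t ->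
  (forall r, s <= r <= t -> is_derive r (1 : R) G (dG r)) ->
  exists2 c, s < c < t & G t - G s = dG c * (t - s).
Proof.
move=> st GD.
have Gd : {in `[s, t], forall r, derivable G r 1}.
  by move=> r; rewrite in_itv /= => /GD [].
have GD' r : r \in `]s, t[ -> is_derive r (1 : R) G (dG r).
  by rewrite in_itv /= => /andP[sr rt]; apply: GD; rewrite !ltW.
have [c cst E] := MVT st GD' (derivable_within_continuous Gd).
by exists c => //; move: cst; rewrite in_itv.
Qed.

Lemma interval_interior_approx (R : realType) (lo hi t e : R) :
  lo < hi -> lo <= t <= hi -> 0 < e -> exists2 s, lo < s < hi & `|t - s| < e.
Proof.
move=> lh /andP[lt th] e0; pose w := e + (hi - lo); have w0 : 0 < w by rewrite /w; lra.
pose c := e / w; have c0 : 0 < c by rewrite divr_gt0.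
have c1 : c < 1 by rewrite ltr_pdivrMr // /w; lra.
have cw : c * (hi - lo) < e.
  have : c * w = e by rewrite divfK // gt_eqF.
  by have := mulr_gt0 c0 e0; rewrite /w; lra.
(* The point is moved towards the midpoint, which lands strictly inside whichever end it started
   from. *)
exists (t + c * ((lo + hi) / 2 - t)).
  have := mulr_ge0 (ltW c0) (_ : 0 <= hi - t); have := mulr_ge0 (ltW c0) (_ : 0 <= t - lo).
  rewrite !subr_ge0 => /(_ lt) h1 /(_ th) h2.
  have h3 : 0 <= (1 - c) * (t - lo) by rewrite mulr_ge0 // subr_ge0 // ltW.
  have h4 : 0 <= (1 - c) * (hi - t) by rewrite mulr_ge0 // subr_ge0 // ltW.
  have h5 : 0 < c * (hi - lo) by rewrite mulr_gt0 // subr_gt0.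
  by apply/andP; split; lra.
rewrite opprD addrA subrr sub0r normrN normrM (gtr0_norm c0).
apply: le_lt_trans cw; rewrite ler_wpM2l ?(ltW c0) //.
by rewrite ler_norml; apply/andP; split; lra.
Qed.

(** A Hölder estimate against the candidate value proves convergence and identifies the limit, once
    the trace of neighbourhoods on the open strip is known to be proper. *)
Lemma ext_holder (R : realType) (T l : R) (w : R -> R -> R) (t x z c1 c2 be1 be2 : R) :
  0 < T -> 0 < l -> 0 <= t <= T -> - l <= x <= l ->
  0 <= c1 -> 0 <= c2 -> 0 < be1 -> 0 < be2 ->
  (forall s y, 0 < s < T -> - l < y < l ->
    `|w s y - z| <= c1 * `|t - s| `^ be1 + c2 * `|x - y| `^ be2) ->
  ext T l w t x = z.
Proof.
move=> T0 l0 tT xl c10 c20 b10 b20 wz; rewrite /ext.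
have PF : ProperFilter (within (OmegaT T l) (nbhs (t, x))).
  split; last exact: within_filter.
  rewrite /within /= => /nbhs_ballP[e /= e0 eP].
  have [s sT ts] := interval_interior_approx T0 tT e0.
  have ll : - l < l by lra.
  have [y yl xy] := interval_interior_approx ll xl e0.
  by apply: (eP (s, y)) => //; split; rewrite /= in_itv.
apply: cvg_lim => //; apply/cvgrPdist_le => e e0.
have e20 : 0 < e / 2 by rewrite divr_gt0.
have [d1 d10 D1] := powR_small b10 c10 e20.
have [d2 d20 D2] := powR_small b20 c20 e20.
rewrite /within /=; apply/nbhs_ballP; exists (Num.min d1 d2) => /=; first by rewrite lt_min d10.
move=> [s y] /= [ts xy] [/= sT yl]; rewrite !in_itv /= in sT yl.
rewrite distrC; apply: le_trans (wz s y sT yl) _.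
rewrite -ball_normE /= lt_min in ts; rewrite -ball_normE /= lt_min in xy.
case/andP: ts => ts _; case/andP: xy => _ xy.
have := D1 `|t - s|; rewrite normr_ge0 (ltW ts) => /(_ isT).
have := D2 `|x - y|; rewrite normr_ge0 (ltW xy) => /(_ isT).
lra.
Qed.

Lemma holder_semi_le (R : realType) (I : set R) (be c : R) (v : R -> R) :
  (forall x y, I x -> I y -> x < y -> `|v y - v x| <= c * (y - x) `^ be) ->
  (holder_semi I be v <= c%:E)%E.
Proof.
move=> vc; apply: ge_ereal_sup => _ [[x y] /= [Ix Iy xy] <-]; rewrite lee_fin.
rewrite ler_pdivrMr; last by rewrite powR_gt0 // normr_gt0 subr_eq0.
case: (ltgtP x y) xy => // [xy|yx] _.
  by rewrite distrC [`|x - y|]distrC [`|y - x|]gtr0_norm ?subr_gt0 //; exact: vc.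
by rewrite [`|x - y|]gtr0_norm ?subr_gt0 //; exact: vc.
Qed.

(** * Time regularity of the derivatives and extension to the closed strip *)

Section Profile.
Variables (R : realType) (T l al A Z P a0 a1 b0 L : R).
Variables (a f : R -> R -> R -> R -> R) (br bl gr gl : R -> R -> R).
Hypothesis box : box_bounds T l Z P a0 a1 b0 L a f br bl gr gl.
Hypotheses (al0 : 0 < al) (al1 : al < 1).
Variables U V W Q : R -> R -> R.
Hypothesis sp : strip_profile T l al A U V W Q.
Hypotheses (UZ : forall t x, 0 <= t <= T -> - l <= x <= l -> `|U t x| <= Z)
  (WP : forall t x, 0 <= t <= T -> - l <= x <= l -> `|W t x| <= P).
Hypothesis pde : forall t x, 0 <= t <= T -> - l < x < l ->
  V t x = a t x (U t x) (W t x) * Q t x + f t x (U t x) (W t x).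

Let A0 : 0 <= A := sp_A sp.
Let l0 : 0 < l := box_l box.
Let T0 : 0 < T := box_T box.
Let L0 : 0 <= L := box_L box.
Let ap : 0 < a0 := box_a0 box.

Lemma profile_Ux_lip t x y : 0 <= t <= T -> - l <= x <= l -> - l <= y <= l ->
  `|U t y - U t x| <= A * (1 + 2 * l) * `|y - x|.
Proof.
move=> tT xl yl; have := sp_Ux sp tT xl yl.
have := sp_W sp tT xl => w; have d2 : `|y - x| <= 2 * l.
  by rewrite ler_norml; apply/andP; split; lra.
have wd := ler_wpM2r (normr_ge0 (y - x)) w; rewrite -normrM mulrC in wd.
have dd := ler_wpM2l A0 (ler_wpM2r (normr_ge0 (y - x)) d2).
have := ler_normD (U t y - U t x - (y - x) * W t x) ((y - x) * W t x).
by rewrite subrK; lra.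
Qed.

(** Ellipticity again: the equation expresses [Q] through quantities whose moduli are known. It is
    used once with equal times and once with equal points. *)
Lemma profile_Q_dist s t x y : 0 <= s <= T -> 0 <= t <= T -> - l < x < l -> - l < y < l ->
  a0 * `|Q t y - Q s x| <= `|V t y - V s x|
    + L * (1 + A) * (`|t - s| + `|y - x| + `|U t y - U s x| + `|W t y - W s x|).
Proof.
move=> sT tT xl yl.
have xl' : - l <= x <= l by case/andP: xl => ? ?; rewrite !ltW.
have yl' : - l <= y <= l by case/andP: yl => ? ?; rewrite !ltW.
have := box_alip box tT sT yl' xl' (UZ tT yl') (UZ sT xl') (WP tT yl') (WP sT xl').
have := box_flip box tT sT yl' xl' (UZ tT yl') (UZ sT xl') (WP tT yl') (WP sT xl').
have := pde tT yl; have := pde sT xl.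
have /andP[ay _] := box_a box tT yl' (UZ tT yl') (WP tT yl').
move: (a t y _ _) (a s x _ _) (f t y _ _) (f s x _ _) ay => k k' g g' ay e1 e2 fl kl.
set E := `|t - s| + `|y - x| + `|U t y - U s x| + `|W t y - W s x| in fl kl *.
have qA := sp_Q sp sT xl.
have kQ : k * (Q t y - Q s x) = (V t y - V s x) - (g - g') - (k - k') * Q s x.
  by rewrite e1 e2; ring.
have h1 : a0 * `|Q t y - Q s x| <= `|k * (Q t y - Q s x)|.
  have k0 : 0 < k by apply: lt_le_trans ay.
  by rewrite normrM (gtr0_norm k0) ler_wpM2r.
have h2 : `|(k - k') * Q s x| <= L * E * A by rewrite normrM ler_pM.
rewrite kQ in h1; have := ler_normB (V t y - V s x - (g - g')) ((k - k') * Q s x).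
have := ler_normB (V t y - V s x) (g - g').
move: fl h1 h2; lra.
Qed.

Definition Qx_const := (A + L * (1 + A) * ((1 + A * (1 + 2 * l) + A) * (1 + 2 * l))) / a0.

Lemma profile_Q_space t x y : 0 <= t <= T -> - l < x < l -> - l < y < l ->
  `|Q t y - Q t x| <= Qx_const * `|y - x| `^ al.
Proof.
move=> tT xl yl.
have xl' : - l <= x <= l by case/andP: xl => ? ?; rewrite !ltW.
have yl' : - l <= y <= l by case/andP: yl => ? ?; rewrite !ltW.
rewrite /Qx_const [leRHS]mulrAC ler_pdivlMr // [leLHS]mulrC.
apply: le_trans (profile_Q_dist tT tT xl yl) _.
rewrite subrr normr0 add0r mulrDl lerD ?(sp_Vxd sp) // -!mulrA.
rewrite !ler_wpM2l // ?addr_ge0 //.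
have d : `|y - x| <= (1 + 2 * l) * `|y - x| `^ al.
  apply: le_powR_bounded => //; first exact: ltW.
    by have := l0; lra.
  by rewrite normr_ge0 ler_norml /=; apply/andP; split; lra.
have u := profile_Ux_lip tT xl' yl'; have w := sp_Wxd sp tT xl' yl'.
have c : 0 <= 1 + A * (1 + 2 * l) + A.
  by rewrite !addr_ge0 // mulr_ge0 // addr_ge0 // mulr_ge0 // ltW.
have := ler_wpM2l c d; move: u w; lra.
Qed.

(** Interpolation: the slope is compared with a difference quotient of [U] over distance
    [d = sqrt |t - s|], where the time increment and the Taylor error are both of order [d ^ 2]. The
    exponent [1 / 2] suffices to bound [Q] in time, which in turn allows the better exponent
    below. *)
Lemma profile_W_time s t x : 0 <= s <= T -> 0 <= t <= T -> - l <= x <= l ->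
  `|W t x - W s x| <= (4 * A + 2 * A / l) * `|t - s| `^ 2^-1.
Proof.
move=> sT tT xl; set d := _ `^ _; have d0 : 0 <= d by exact: powR_ge0.
have dd : d * d = `|t - s|.
  by rewrite -expr2 -powR_mulrn // -powRrM mulVf // powRr1.
have Al0 : 0 <= A / l by rewrite divr_ge0 // ltW.
have [dl|ld] := leP d l; last first.
  have := sp_W sp sT xl; have := sp_W sp tT xl; have := ler_normB (W t x) (W s x).
  have : A <= A / l * d by rewrite mulrAC ler_pdivlMr // ler_wpM2l // ltW.
  have := mulr_ge0 A0 d0; lra.
have [dz|dN] := eqVneq d 0.
  have : `|t - s| = 0 by rewrite -dd dz mulr0.
  by move/normr0_eq0/eqP; rewrite subr_eq0 => /eqP ->; rewrite subrr normr0 mulr_ge0 // addr_ge0 // ?mulr_ge0 // invr_ge0 ltW.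
have dp : 0 < d by rewrite lt_def dN.
(* Stepping towards the centre stays in the interval because [d <= l]. *)
have [y yl yx] : exists2 y, - l <= y <= l & `|y - x| = d.
  have [x0|x0] := leP x 0.
    exists (x + d); first by apply/andP; split; lra.
    by rewrite addrAC subrr add0r ger0_norm.
  exists (x - d); first by apply/andP; split; lra.
  by rewrite addrAC subrr add0r normrN ger0_norm.
have e1 := sp_Ux sp tT xl yl; have e2 := sp_Ux sp sT xl yl.
have e3 := sp_Utd sp sT tT xl; have e4 := sp_Utd sp sT tT yl.
rewrite yx in e1 e2; rewrite -dd in e3 e4.
rewrite -(ler_pM2l dp) -{1}yx -normrM.
have -> : (y - x) * (W t x - W s x) = (U t y - U s y) - (U t x - U s x)
  - (U t y - U t x - (y - x) * W t x) + (U s y - U s x - (y - x) * W s x) by ring.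
set p1 := U t y - U s y in e4 *; set p2 := U t x - U s x in e3 *.
set p3 := U t y - _ - _ in e1 *; set p4 := U s y - _ - _ in e2 *.
have := ler_normD (p1 - p2 - p3) p4; have := ler_normB (p1 - p2) p3.
have := ler_normB p1 p2.
have := mulr_ge0 (mulr_ge0 Al0 d0) d0; lra.
Qed.

Definition Qt_const :=
  (A + L * (1 + A) * ((1 + A) * (1 + T) + (4 * A + 2 * A / l) * (1 + T))) / a0.

Lemma profile_Q_time s t x : 0 <= s <= T -> 0 <= t <= T -> - l < x < l ->
  `|Q t x - Q s x| <= Qt_const * `|t - s| `^ (al / 2).
Proof.
move=> sT tT xl.
have xl' : - l <= x <= l by case/andP: xl => ? ?; rewrite !ltW.
rewrite /Qt_const [leRHS]mulrAC ler_pdivlMr // [leLHS]mulrC.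
apply: le_trans (profile_Q_dist sT tT xl xl) _.
rewrite subrr normr0 addr0 [leRHS]mulrDl lerD ?(sp_Vtd sp) // -[leRHS]mulrA.
rewrite ler_wpM2l // ?mulr_ge0 ?addr_ge0 //.
have r0 := normr_ge0 (t - s).
have rT : `|t - s| <= T by rewrite ler_norml; apply/andP; split; lra.
have e1 : 1 <= 1 + T by have := T0; lra.
have h1 : `|t - s| <= (1 + T) * `|t - s| `^ (al / 2).
  apply: le_powR_bounded => //; first by rewrite divr_gt0.
    by have := al1; lra.
  by rewrite normr_ge0 /=; lra.
have h2 : `|t - s| `^ 2^-1 <= (1 + T) * `|t - s| `^ (al / 2).
  rewrite [al / 2]mulrC powRrM; apply: le_powR_bounded => //; first exact: ltW.
  rewrite powR_ge0 /= leNgt; apply/negP => h.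
  have dd : `|t - s| `^ 2^-1 * `|t - s| `^ 2^-1 = `|t - s|.
    by rewrite -expr2 -powR_mulrn ?powR_ge0 // -powRrM mulVf // powRr1.
  have e0 : 0 <= 1 + T by have := T0; lra.
  have := ltr_pM e0 e0 h h; rewrite dd; have := mulr_ge0 (ltW T0) (ltW T0); have := T0; lra.
have u := sp_Utd sp sT tT xl'; have w := profile_W_time sT tT xl'.
have c : 0 <= 4 * A + 2 * A / l by rewrite addr_ge0 ?mulr_ge0 // invr_ge0 ltW.
have c' : 0 <= 1 + A by rewrite addr_ge0.
have := ler_wpM2l c h2; have := ler_wpM2l c' h1; lra.
Qed.

Lemma profile_derive_t t x : 0 < t < T -> - l <= x <= l ->
  is_derive t (1 : R) (U^~ x) (V t x).
Proof.
move=> tT xl; apply: (taylor_is_derive (c := A) (be := al / 2) _ _ tT) => // [|s sT].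
  by rewrite divr_gt0.
by apply: (sp_Ut sp) => //; [case/andP: tT|case/andP: sT] => ? ?; rewrite !ltW.
Qed.

Lemma profile_derive_x t x : 0 <= t <= T -> - l < x < l ->
  is_derive x (1 : R) (U t) (W t x).
Proof.
move=> tT xl; apply: (taylor_is_derive (c := A) (be := 1) _ _ xl) => // y yl.
rewrite powRr1 //.
by apply: (sp_Ux sp) => //; [case/andP: xl|case/andP: yl] => ? ?; rewrite !ltW.
Qed.

Lemma Qx_const_ge0 : 0 <= Qx_const.
Proof.
by rewrite divr_ge0 ?addr_ge0 ?mulr_ge0 ?addr_ge0 ?mulr_ge0 ?addr_ge0 ?mulr_ge0 // ltW.
Qed.

Lemma profile_W_taylor t x y : 0 <= t <= T -> - l < x < l -> - l < y < l ->
  `|W t y - W t x - (y - x) * Q t x| <= (A + Qx_const) * (`|y - x| * `|y - x| `^ al).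
Proof.
move=> tT xl yl; have pg d : 0 <= d -> 0 <= d `^ al by move=> _; exact: powR_ge0.
apply: (taylor_sym (I := [set x | - l < x < l]) (G := W t) (D := Q t)
  (w := fun d => d `^ al) A0 Qx_const_ge0 pg) => //= {xl yl}x {}y xl yl xy.
  by apply: (sp_Wx sp) => //; [case/andP: xl|case/andP: yl].
have := profile_Q_space tT xl yl; by rewrite [`|y - x|]gtr0_norm ?subr_gt0.
Qed.


(** Mean value theorem in time, so that the space modulus of [V] yields an extra factor
    [|y - x| ^ al] for the mixed difference. *)
Lemma profile_cross s t x y : 0 < s -> s < t -> t < T -> - l < x < l -> - l < y < l ->
  `|(U t y - U s y) - (U t x - U s x)| <= A * ((t - s) * `|y - x| `^ al).
Proof.
move=> s0 st tT xl yl.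
have xl' : - l <= x <= l by case/andP: xl => ? ?; rewrite !ltW.
have yl' : - l <= y <= l by case/andP: yl => ? ?; rewrite !ltW.
have dU r : s <= r <= t ->
    is_derive r (1 : R) (fun r => U r y - U r x) (V r y - V r x).
  move=> /andP[sr rt]; have rT : 0 < r < T by apply/andP; split; lra.
  by apply: is_deriveB; exact: profile_derive_t.
have [r /andP[sr rt] E] := is_derive_MVT st dU.
have -> : U t y - U s y - (U t x - U s x) = U t y - U t x - (U s y - U s x) by ring.
rewrite E normrM (gtr0_norm (x := t - s)) ?subr_gt0 //.
rewrite mulrCA [leLHS]mulrC ler_wpM2l ?subr_ge0 ?(ltW st) //.
by apply: (sp_Vxd sp) => //; apply/andP; split; lra.
Qed.

Definition Wt_const := 4 * A + (Qt_const + 2 * (A + Qx_const)) + 2 * A / l `^ (1 + al).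

Lemma Qt_const_ge0 : 0 <= Qt_const.
Proof.
have lA : 0 <= 2 * A / l by rewrite divr_ge0 ?mulr_ge0 // ltW.
have T1 : 0 <= 1 + T by have := T0; lra.
have A1 : 0 <= 1 + A by rewrite addr_ge0.
have A4 : 0 <= 4 * A + 2 * A / l by rewrite addr_ge0 // mulr_ge0.
apply: divr_ge0; last exact: ltW.
by apply: addr_ge0 => //; apply: mulr_ge0; [apply: mulr_ge0|apply: addr_ge0; apply: mulr_ge0].
Qed.

(** The mixed difference over distance of order [d = sqrt (t - s)] controls [W t - W s] at some
    intermediate [xi]; the expansion of [W] with coefficient [Q] carries this from [xi] back to
    [x]. *)
Lemma profile_W_holder s t x : 0 < s -> s < t -> t < T -> - l < x < l ->
  `|W t x - W s x| <= Wt_const * (t - s) `^ ((1 + al) / 2).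
Proof.
move=> s0 st tT xl.
have xl' : - l <= x <= l by case/andP: xl => ? ?; rewrite !ltW.
have sT : 0 <= s <= T by apply/andP; split; lra.
have tT' : 0 <= t <= T by apply/andP; split; lra.
have r0 : 0 < t - s by rewrite subr_gt0.
set d := (t - s) `^ 2^-1; have d0 : 0 < d by exact: powR_gt0.
have dd : d * d = t - s.
  by rewrite -expr2 -powR_mulrn ?ltW // -powRrM mulVf // powRr1 // ltW.
have dal : (t - s) `^ (al / 2) = d `^ al by rewrite [al / 2]mulrC powRrM.
have E1 : (t - s) `^ ((1 + al) / 2) = d `^ (1 + al) by rewrite [_ / 2]mulrC powRrM.
have E2 : d `^ (1 + al) = d * d `^ al.
  by rewrite powRD ?powRr1 ?(ltW d0) // (gt_eqF d0) implybT.
have Qt0 := Qt_const_ge0; have Qx0 := Qx_const_ge0.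
have lA : 0 <= 2 * A / l `^ (1 + al) by rewrite divr_ge0 ?mulr_ge0 // powR_ge0.
rewrite E1 /Wt_const; have [dl|ld] := leP d l; last first.
  have lp : 0 < l `^ (1 + al) by exact: powR_gt0.
  have h : 2 * A <= 2 * A / l `^ (1 + al) * d `^ (1 + al).
    rewrite mulrAC ler_pdivlMr // ler_wpM2l ?mulr_ge0 //.
    apply: ge0_ler_powR; rewrite ?nnegrE ?(ltW l0) ?(ltW d0) ?(ltW ld) //.
    by rewrite addr_ge0 // ltW.
  have h' : 0 <= (4 * A + (Qt_const + 2 * (A + Qx_const))) * d `^ (1 + al).
    by apply: mulr_ge0; [have := A0; lra|exact: powR_ge0].
  rewrite [leRHS]mulrDl; have := sp_W sp sT xl'; have := sp_W sp tT' xl'.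
  by have := ler_normB (W t x) (W s x); lra.
(* Half of [d], so that the neighbouring point lies in the open interval, where [Q] is defined. *)
pose e := d / 2; have e0 : 0 < e by rewrite divr_gt0.
have ed : e <= d by rewrite /e; lra.
have dG xi : - l < xi < l -> is_derive xi (1 : R) (fun xi => U t xi - U s xi) (W t xi - W s xi).
  by move=> xil; apply: is_deriveB; exact: profile_derive_x.
have [y [xi [yl xil yx xix G]]] : exists y xi, [/\ - l < y < l, - l < xi < l, `|y - x| = e,
    `|xi - x| <= e & U t y - U s y - (U t x - U s x) = (W t xi - W s xi) * (y - x)].
  have [x0|x0] := leP x 0.
    have xy : x < x + e by rewrite ltrDl.
    have [|c /andP[c1 c2] E] := is_derive_MVT xy (G := fun xi => U t xi - U s xi)
       (dG := fun xi => W t xi - W s xi).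
      by move=> c /andP[c1 c2]; apply: dG; apply/andP; rewrite /e in c2; split; lra.
    exists (x + e), c; split => //; first by apply/andP; rewrite /e; split; lra.
    - by apply/andP; rewrite /e in c2; split; lra.
    - by rewrite addrAC subrr add0r gtr0_norm.
    - by rewrite gtr0_norm ?subr_gt0 //; lra.
  have xy : x - e < x by rewrite gtrBl.
  have [|c /andP[c1 c2] E] := is_derive_MVT xy (G := fun xi => U t xi - U s xi)
     (dG := fun xi => W t xi - W s xi).
    by move=> c /andP[c1 c2]; apply: dG; apply/andP; rewrite /e in c1; split; lra.
  exists (x - e), c; split => //; first by apply/andP; rewrite /e; split; lra.
  - by apply/andP; rewrite /e in c1; split; lra.
  - by rewrite addrAC subrr add0r normrN gtr0_norm.
  - by rewrite distrC gtr0_norm ?subr_gt0 //; lra.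
  - by rewrite -opprB E; ring.
have eal : e `^ al <= d `^ al.
  by apply: ge0_ler_powR; rewrite ?nnegrE ?(ltW al0) ?(ltW e0) ?(ltW d0).
have pg := powR_ge0 d al.
have h1 : `|W t xi - W s xi| <= 2 * A * (d * d `^ al).
  have := profile_cross s0 st tT xl yl; rewrite G normrM yx -dd => h.
  rewrite -(ler_pM2r e0); apply: le_trans h _.
  have -> : 2 * A * (d * d `^ al) * e = A * (d * d * d `^ al) by rewrite /e; field.
  by rewrite ler_wpM2l // ler_wpM2l // mulr_ge0 // ltW.
have tay r : 0 <= r <= T ->
    `|W r xi - W r x - (xi - x) * Q r x| <= (A + Qx_const) * (d * d `^ al).
  move=> rT; apply: le_trans (profile_W_taylor rT xl xil) _.
  rewrite ler_wpM2l ?addr_ge0 // ler_pM ?powR_ge0 //; first exact: le_trans xix ed.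
  apply: le_trans eal; apply: ge0_ler_powR; rewrite ?nnegrE ?(ltW al0) ?(ltW e0) //.
have h2 := tay s sT; have h3 := tay t tT'.
have h4 : `|(xi - x) * (Q t x - Q s x)| <= Qt_const * (d * d `^ al).
  rewrite normrM mulrCA ler_pM //; first exact: le_trans xix ed.
  by have := profile_Q_time sT tT' xl; rewrite (gtr0_norm r0) dal.
rewrite E2.
have -> : W t x - W s x = (W t xi - W s xi) + (W s xi - W s x - (xi - x) * Q s x)
  - (W t xi - W t x - (xi - x) * Q t x) - (xi - x) * (Q t x - Q s x) by ring.
move: h1 h2 h3 h4; set p1 := W t xi - W s xi; set p2 := _ - (xi - x) * Q s x.
set p3 := _ - (xi - x) * Q t x; set p4 := (xi - x) * _ => h1 h2 h3 h4.
have := ler_normB (p1 + p2 - p3) p4; have := ler_normB (p1 + p2) p3.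
have := ler_normD p1 p2; have dpos := mulr_ge0 (ltW d0) pg.
have := mulr_ge0 A0 dpos; have := mulr_ge0 lA dpos.
move: (d * _) h1 h2 h3 h4 dpos => m h1 h2 h3 h4 dpos; lra.
Qed.

Let oc t : 0 < t < T -> 0 <= t <= T.
Proof. by case/andP=> ? ?; rewrite !ltW. Qed.

Let ocl x : - l < x < l -> - l <= x <= l.
Proof. by case/andP=> ? ?; rewrite !ltW. Qed.

Lemma dt_profile t x : 0 < t < T -> - l <= x <= l -> dt U t x = V t x.
Proof.
by move=> tT xl; rewrite /dt derive1E (derive_val (is_derive := profile_derive_t tT xl)).
Qed.

Lemma dx_profile t x : 0 <= t <= T -> - l < x < l -> dx U t x = W t x.
Proof.
by move=> tT xl; rewrite /dx derive1E (derive_val (is_derive := profile_derive_x tT xl)).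
Qed.

Lemma dx_derive t x : 0 <= t <= T -> - l < x < l -> is_derive x (1 : R) (dx U t) (Q t x).
Proof.
move=> tT xl.
apply: (taylor_is_derive (c := A + Qx_const) (be := al) _ _ xl) => // [|y yl].
  by rewrite addr_ge0 // Qx_const_ge0.
rewrite !dx_profile //; exact: (profile_W_taylor).
Qed.

Lemma dxx_profile t x : 0 <= t <= T -> - l < x < l -> dx (dx U) t x = Q t x.
Proof.
by move=> tT xl; rewrite {1}/dx derive1E (derive_val (is_derive := dx_derive tT xl)).
Qed.

Lemma norm_T_bounded (w G : R -> R -> R) (c : R) :
  (forall t x, 0 < t < T -> - l < x < l -> w t x = G t x) ->
  (forall t x, 0 < t < T -> - l < x < l -> `|G t x| <= c) ->
  (norm_T T l w < +oo)%E.
Proof.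
move=> wG Gc; apply: (@le_lt_trans _ _ c%:E); last exact: ltry.
apply: ge_ereal_sup => _ [[t x] /= [/= tT xl] <-]; rewrite !in_itv /= in tT xl.
by rewrite lee_fin wG // Gc.
Qed.

Lemma holder_t_bounded (w G : R -> R -> R) (be c : R) :
  (forall t x, 0 < t < T -> - l < x < l -> w t x = G t x) ->
  (forall s t x, 0 < s -> s < t -> t < T -> - l < x < l ->
    `|G t x - G s x| <= c * (t - s) `^ be) ->
  (holder_t T l be w < +oo)%E.
Proof.
move=> wG Gc; apply: (@le_lt_trans _ _ c%:E); last exact: ltry.
apply: ge_ereal_sup => _ [x xl <-]; rewrite /= in_itv /= in xl.
apply: holder_semi_le => s t /=; rewrite !in_itv /= => sT tT st.
by rewrite !wG //; case/andP: sT => ? _; case/andP: tT => _ ?; exact: Gc.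
Qed.

Lemma holder_x_bounded (w G : R -> R -> R) (be c : R) :
  (forall t x, 0 < t < T -> - l < x < l -> w t x = G t x) ->
  (forall t x y, 0 < t < T -> - l < x < l -> - l < y < l -> x < y ->
    `|G t y - G t x| <= c * (y - x) `^ be) ->
  (holder_x T l be w < +oo)%E.
Proof.
move=> wG Gc; apply: (@le_lt_trans _ _ c%:E); last exact: ltry.
apply: ge_ereal_sup => _ [t tT <-]; rewrite /= in_itv /= in tT.
apply: holder_semi_le => x y /=; rewrite !in_itv /= => xl yl xy.
by rewrite !wG //; exact: Gc.
Qed.

Lemma profile_par_space : par_space T l al U.
Proof.
have dtE t x : 0 < t < T -> - l < x < l -> dt U t x = V t x.
  by move=> tT xl; apply: dt_profile => //; exact: ocl.
have dxE t x : 0 < t < T -> - l < x < l -> dx U t x = W t x.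
  by move=> tT xl; apply: dx_profile => //; exact: oc.
have dxxE t x : 0 < t < T -> - l < x < l -> dx (dx U) t x = Q t x.
  by move=> tT xl; apply: dxx_profile => //; exact: oc.
split=> [t x [/= tT xl]|].
  rewrite !in_itv /= in tT xl; split.
  - by have [] := profile_derive_t tT (ocl xl).
  - by have [] := profile_derive_x (oc tT) xl.
  - by have [] := dx_derive (oc tT) xl.
rewrite /par_norm /holder_par; repeat apply: lte_add_pinfty.
- by apply: (norm_T_bounded (G := U) (c := A)) => // t x tT xl; apply: (sp_U sp); [exact: oc|exact: ocl].
- by apply: (norm_T_bounded (G := W) (c := A)) => // t x tT xl; apply: (sp_W sp); [exact: oc|exact: ocl].
- by apply: (norm_T_bounded (G := Q) (c := A)) => // t x tT xl; apply: (sp_Q sp); [exact: oc|].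
- by apply: (norm_T_bounded (G := V) (c := A)) => // t x tT xl; apply: (sp_V sp); [exact: oc|exact: ocl].
- apply: (holder_t_bounded (G := V) (c := A)) => // s t x s0 st tT xl.
  rewrite -[in leRHS](gtr0_norm (x := t - s)) ?subr_gt0 //.
  by apply: (sp_Vtd sp); last exact: ocl; apply/andP; split; lra.
- apply: (holder_x_bounded (G := V) (c := A)) => // t x y tT xl yl xy.
  rewrite -[in leRHS](gtr0_norm (x := y - x)) ?subr_gt0 //.
  by apply: (sp_Vxd sp); [exact: oc|exact: ocl|exact: ocl].
- apply: (holder_t_bounded (G := Q) (c := Qt_const)) => // s t x s0 st tT xl.
  rewrite -[in leRHS](gtr0_norm (x := t - s)) ?subr_gt0 //.
  by apply: (profile_Q_time) => //; apply/andP; split; lra.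
- apply: (holder_x_bounded (G := Q) (c := Qx_const)) => // t x y tT xl yl xy.
  rewrite -[in leRHS](gtr0_norm (x := y - x)) ?subr_gt0 //.
  by apply: (profile_Q_space) => //; exact: oc.
- apply: (holder_t_bounded (G := W) (c := Wt_const)) => // s t x s0 st tT xl.
  exact: (profile_W_holder).
Qed.

Lemma ext_U t x : 0 <= t <= T -> - l <= x <= l -> ext T l U t x = U t x.
Proof.
move=> tT xl; apply: (ext_holder (c1 := A) (be1 := 1) (c2 := A * (1 + 2 * l)) (be2 := 1)) => //.
  by rewrite mulr_ge0 // addr_ge0 // mulr_ge0 // ltW.
move=> s y sT yl; rewrite !powRr1 //.
have e1 := sp_Utd sp tT (oc sT) (ocl yl); have e2 := profile_Ux_lip tT xl (ocl yl).
rewrite [`|t - s|]distrC [`|x - y|]distrC.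
have -> : U s y - U t x = (U s y - U t y) + (U t y - U t x) by ring.
by apply: le_trans (ler_normD _ _) _; exact: lerD.
Qed.

Lemma ext_dt t x : 0 <= t <= T -> - l <= x <= l -> ext T l (dt U) t x = V t x.
Proof.
move=> tT xl; apply: (ext_holder (c1 := A) (be1 := al / 2) (c2 := A) (be2 := al)) => //.
  by rewrite divr_gt0.
move=> s y sT yl; rewrite dt_profile //; last exact: ocl.
have e1 := sp_Vtd sp tT (oc sT) (ocl yl); have e2 := sp_Vxd sp tT xl (ocl yl).
rewrite [`|t - s|]distrC [`|x - y|]distrC.
have -> : V s y - V t x = (V s y - V t y) + (V t y - V t x) by ring.
by apply: le_trans (ler_normD _ _) _; exact: lerD.
Qed.

Lemma ext_dx t x : 0 <= t <= T -> - l <= x <= l -> ext T l (dx U) t x = W t x.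
Proof.
move=> tT xl; apply: (ext_holder (c1 := 4 * A + 2 * A / l) (be1 := 2^-1) (c2 := A) (be2 := 1)) => //.
  by rewrite addr_ge0 ?mulr_ge0 // invr_ge0 ltW.
move=> s y sT yl; rewrite dx_profile ?powRr1 //; last exact: oc.
have e1 := profile_W_time tT (oc sT) (ocl yl); have e2 := sp_Wxd sp tT xl (ocl yl).
rewrite [`|t - s|]distrC [`|x - y|]distrC.
have -> : W s y - W t x = (W s y - W t y) + (W t y - W t x) by ring.
by apply: le_trans (ler_normD _ _) _; exact: lerD.
Qed.

End Profile.

Theorem corollary3p8 (R : realType) (T l alpha : R)
  (T_gt0 : 0 < T) (l_gt0 : 0 < l) (alpha01 : 0 < alpha < 1)
  (a f : R -> R -> R -> R -> R) (b g : R -> R -> R -> R)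
  (a_C2 : Ck_on4 `[0, T] `[(- l), l] setT setT 2 a)
  (f_C2 : Ck_on4 `[0, T] `[(- l), l] setT setT 2 f)
  (br_C2 : Ck_on2 `[0, T] setT 2 (fun t z => b t l z))
  (bl_C2 : Ck_on2 `[0, T] setT 2 (fun t z => b t (- l) z))
  (gr_C2 : Ck_on2 `[0, T] setT 2 (fun t z => g t l z))
  (gl_C2 : Ck_on2 `[0, T] setT 2 (fun t z => g t (- l) z))
  (a_gt0 : forall t x z p, 0 <= t <= T -> - l <= x <= l -> 0 < a t x z p)
  (b_gt0 : forall t z, 0 <= t <= T -> 0 < b t l z /\ 0 < b t (- l) z)
  (u0 : R -> R)
  (u0_C2alpha : C2alpha `[(- l), l] alpha u0)
  (compat_r :
    let u0x := derivI `[(- l), l] u0 in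
    let u0xx := derivI `[(- l), l] u0x in
    - (b 0 l (u0 l) * u0x l) + g 0 l (u0 l)
    = a 0 l (u0 l) (u0x l) * u0xx l + f 0 l (u0 l) (u0x l))
  (compat_l :
    let u0x := derivI `[(- l), l] u0 in
    let u0xx := derivI `[(- l), l] u0x in
    b 0 (- l) (u0 (- l)) * u0x (- l) + g 0 (- l) (u0 (- l))
    = a 0 (- l) (u0 (- l)) (u0x (- l)) * u0xx (- l)
      + f 0 (- l) (u0 (- l)) (u0x (- l)))
  (K : R)
  (u0_lip : forall x y, - l <= x <= l -> - l <= y <= l ->
    `|u0 x - u0 y| <= K * `|x - y|)
  (B : R) (B_gt0 : 0 < B) (Phi : R -> R)
  (Phi_nd : forall r s, 0 <= r -> r <= s -> Phi r <= Phi s)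
  (Phi_gt0 : forall r, 0 <= r -> 0 < Phi r)
  (Phi_int : (\int[@lebesgue_measure R]_(r in `[0%R, +oo[) ((Phi r)^-1)%:E
              = +oo)%E)
  (f_growth : forall t x z, 0 < t < T -> - l < x < l ->
    z * f t x z 0 <= Phi `|z| * `|z| + B)
  (g_growth : forall t z, 0 < t < T ->
    z * g t l z <= Phi `|z| * `|z| + B /\
    z * g t (- l) z <= Phi `|z| * `|z| + B)
  (M : R)
  (M_def : M = Mbound Phi T B (fine (sup_norm `[(- l), l] u0)))
  (q0 : R) (q0_geK : K <= q0)
  (psi : R -> R)
  (psi_C1 : Ck_on1 `[0, +oo[ 1 psi)
  (psi_ge1 : forall r, 0 <= r -> 1 <= psi r)
  (psi_int : ((2 * M)%:E
    < \int[@lebesgue_measure R]_(rho in `[q0, +oo[) (rho / psi rho)%:E)%E)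
  (f_bound : forall t x z p,
    0 <= t <= T -> - l <= x <= l -> - M <= z <= M ->
    `|f t x z p| <= a t x z p * psi `|p|)
  (g_bound : forall t z p, 0 < t <= T -> - M <= z <= M -> q0 <= p ->
    [/\ g t l z <= b t l z * p, - g t l z <= b t l z * p,
        - g t (- l) z <= b t (- l) z * p & g t (- l) z <= b t (- l) z * p]) :
  exists u : R -> R -> R,
    [/\ par_space T l alpha u,
        (forall t x, 0 < t < T -> - l < x < l ->
          dt u t x - a t x (u t x) (dx u t x) * dx (dx u) t x
          = f t x (u t x) (dx u t x)),
        (forall t, 0 < t < T ->
          let U := ext T l u in
          let Ut := ext T l (dt u) in
          let Ux := ext T l (dx u) in
          Ut t l + b t l (U t l) * Ux t l = g t l (U t l) /\
          Ut t (- l) - b t (- l) (U t (- l)) * Ux t (- l)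
          = g t (- l) (U t (- l))) &
        (forall x, - l <= x <= l -> ext T l u 0 x = u0 x)].
Proof.
have /andP[al0 al1] := alpha01.
have f_bound' t x z p : 0 <= t <= T -> - l <= x <= l -> `|z| <= M ->
    `|f t x z p| <= a t x z p * psi `|p|.
  by rewrite ler_norml => tT xl zM; exact: f_bound.
have gr_bound t z p : 0 < t <= T -> `|z| <= M -> q0 <= p -> `|g t l z| <= b t l z * p.
  by move=> tT; rewrite !ler_norml => zM pq; rewrite lerNl; have [-> ->] := g_bound t z p tT zM pq.
have gl_bound t z p : 0 < t <= T -> `|z| <= M -> q0 <= p -> `|g t (- l) z| <= b t (- l) z * p.
  by move=> tT; rewrite !ler_norml => zM pq; rewrite lerNl; have [_ _ -> ->] := g_bound t z p tT zM pq.
have [Z [P [C [kappa [N0 [Z0 P0 C0 k0 [[a0 [a1 [b0 [L box]]]] gex]]]]]]] :=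
  grid_solutions_exist T_gt0 l_gt0 alpha01 a_C2 f_C2 br_C2 bl_C2 gr_C2 gl_C2 a_gt0 b_gt0
    u0_C2alpha compat_r compat_l u0_lip B_gt0 Phi_nd Phi_gt0 Phi_int f_growth
    (fun t z tT => proj1 (g_growth t z tT)) (fun t z tT => proj2 (g_growth t z tT))
    M_def q0_geK psi_C1 psi_ge1 psi_int f_bound' gr_bound gl_bound.
pose N k : nat := (k + N0).+1; pose h k : R := 2 * l / (N k)%:R.
pose tau k : R := kappa * h k ^+ 2.
have /choice[u /choice[v gs]] : forall k, exists u v,
    grid_solution T l alpha Z P C a f (fun t z => b t l z) (fun t z => b t (- l) z)
      (fun t z => g t l z) (fun t z => g t (- l) z) u0 (N k) (h k) (tau k) u v.
  by move=> k; apply: gex; exact: leqW (leq_addl _ _).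
(* The ultrafilter refines the filter at infinity, so sequences tending to zero still do so along
   [F]. *)
have [F [FU oF]] := @ultraFilterLemma nat \oo _.
have h_cvg : h @ F --> 0.
  have h_oo : h @ \oo --> 0.
    rewrite -[X in _ --> X](mulr0 (2 * l)); apply: cvgM; first exact: cvg_cst.
    by rewrite (cvg_shiftn N0 (@harmonic R)); exact: cvg_harmonic.
  by move=> A /h_oo; exact: oF.
have tau_cvg : tau @ F --> 0.
  rewrite -[X in _ --> X](mulr0 kappa) -[X in kappa * X](mulr0 0).
  by apply: cvgM; [exact: cvg_cst|exact: cvgM].
have UZ := limU_bound FU gs.
have WP t x : 0 <= t <= T -> - l <= x <= l -> `|limW l F N h tau u t x| <= P.
  by move=> tT _; exact: (limW_bound FU gs).
have sp := limit_profile box al0 al1 C0 FU gs h_cvg tau_cvg Z0 P0.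
have pde := limit_interior box FU gs h_cvg tau_cvg.
exists (limU l F h tau u); split.
- exact: (profile_par_space box al0 al1 sp UZ WP pde).
- move=> t x tT xl.
  have tT' : 0 <= t <= T by case/andP: tT => ? ?; rewrite !ltW.
  have xl' : - l <= x <= l by case/andP: xl => ? ?; rewrite !ltW.
  rewrite (dt_profile al0 sp tT xl') (dx_profile sp tT' xl).
  rewrite (dxx_profile box al0 al1 sp UZ WP pde tT' xl) pde //; ring.
- move=> t tT /=; have tT' : 0 <= t <= T by case/andP: tT => ? ?; rewrite !ltW.
  have Nll : - l <= l by exact: (ge0_cp (ltW l_gt0)).2.
  have rl : - l <= l <= l by rewrite Nll lexx.
  have ll : - l <= - l <= l by rewrite Nll lexx.
  rewrite !(ext_U box sp) // !(ext_dt box al0 sp) // !(ext_dx box sp) //.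
  rewrite (limit_right box FU gs tau_cvg tT') (limit_left box FU gs tau_cvg tT').
  by split; ring.
move=> x xl; have T00 : 0 <= (0 : R) <= T by rewrite lexx ltW.
rewrite (ext_U box sp) //.
exact: (limit_initial box u0_lip FU gs h_cvg).
Qed.
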